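(* Let $u=u(x;a,E,c)$ be a $T$-periodic traveling wave profile and $\mathbf{M}(\mu)$ the monodromy matrix of $\partial_x\mathcal{L}[u]v=\mu v$. Assume $T_a$ and $T_E$ do not both vanish. Define $$\Delta=\tfrac12\big(\operatorname{tr}(\mathbf{M}_{\mu\mu}(0))\big)^3-3\big(\operatorname{tr}(\mathbf{M}_{\mu\mu\mu}(0))\big)^2,$$ and suppose $\operatorname{tr}(\mathbf{M}_{\mu\mu\mu}(0))\neq0$. (1) If $\Delta>0$, then a neighborhood of the origin in the imaginary axis is contained in $\operatorname{spec}(\partial_x\mathcal{L}[u])$ with multiplicity three. (2) If $\Delta<0$, then near the origin the spectrum consists of a neighborhood of the origin in the imaginary axis, with multiplicity one, together with two curves through the origin which are tangent there to lines through the origin with angle $\arg(iy_{2})$, $\arg(iy_3)$, where $y_2,y_3$ are the two non-real (complex conjugate) roots of the cubic $$1-\frac{y^2}{2}\operatorname{tr}(\mathbf{M}_{\mu\mu}(0))+\frac{y^3}{3}\operatorname{tr}(\mathbf{M}_{\mu\mu\mu}(0))=0.$$ In particular, in this case the periodic wave is modulationally unstable.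
   Context: Let $f\in C^2(\mathbb{R})$, $F'=f$, and for real parameters $(a,E,c)$ set $V(u;a,c)=F(u)-\frac{c}{2}u^2-au$. Standing assumption: $(a,E,c)$ lies in the interior of the parameter region for which $V(\cdot;a,c)$ has a local minimum and there are simple roots $u_-<u_+$ of $V(u;a,c)=E$ with $V(u;a,c)<E$ on $(u_-,u_+)$. Then $u(x)=u(x;a,E,c)$ denotes the nonconstant periodic solution of $\frac12u_x^2+V(u;a,c)=E$ (so $u_{xx}+f(u)-cu=a$) with $u(0)=u_-$, $u_x(0)=0$; it is a stationary solution of $u_t=u_{xxx}+(f(u))_x-cu_x$. Its period is $T=T(a,E,c)=2\int_{u_-}^{u_+}\frac{du}{\sqrt{2(E-V(u;a,c))}}$, and $T_a,T_E$ are its partial derivatives. Set $\mathcal{L}[u]=-\partial_x^2-f'(u)+c$. For $\mu\in\mathbb{C}$ let $\mathbf{M}(\mu)=\Phi(T,\mu)$, where $\Phi_x=\mathbf{H}(x;\mu)\Phi$, $\Phi(0,\mu)=\mathbf{I}$ and $\mathbf{H}(x;\mu)=\begin{pmatrix}0&1&0\\0&0&1\\-\mu-u_xf''(u)&-f'(u)+c&0\end{pmatrix}$; this is the first order system for $\partial_x\mathcal{L}[u]v=\mu v$. The spectrum $\operatorname{spec}(\partial_x\mathcal{L}[u])$ is the set of $\mu\in\mathbb{C}$ for which $\partial_x\mathcal{L}[u]\psi=\mu\psi$ has a nontrivial bounded solution on $\mathbb{R}$, equivalently for which $D(\mu,\lambda)=\det(\mathbf{M}(\mu)-\lambda\mathbf{I})$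 vanishes for some $|\lambda|=1$. The multiplicity of $\mu$ in the spectrum is the number of eigenvalues $\lambda$ of $\mathbf{M}(\mu)$ on the unit circle, counted with multiplicity (multiplicity statements near the origin refer to $\mu\neq0$; at $\mu=0$ the three branches meet). The wave is modulationally unstable if every neighborhood of $0$ contains points of the spectrum off the imaginary axis. *)

(* Defs.v *)
From HB Require Import structures.
From mathcomp Require Import all_boot all_order all_algebra.
From mathcomp Require Import complex.
From mathcomp Require Import all_classical all_reals all_analysis.

Set Implicit Arguments.
Unset Strict Implicit.
Unset Printing Implicit Defensive.

Import Order.TTheory GRing.Theory Num.Theory.
Import numFieldNormedType.Exports.

Local Open Scope classical_set_scope.
Local Open Scope ring_scope.
Local Open Scope complex_scope.

(* R[i] has no canonical normed-space structure over R, so functions of a real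
   variable with values in R[i] are differentiated through their real and
   imaginary parts. For functions of a complex variable, such as the monodromy
   matrix, derive1n over the field R[i] is the complex derivative. *)

Section RealVariable.
Context {R : realType}.
Implicit Types (g : R -> R[i]) (x : R).

Definition cderivable g x : Prop :=
  derivable (fun y => complex.Re (g y)) x 1 /\
  derivable (fun y => complex.Im (g y)) x 1.

Definition cderive g x : R[i] :=
  derive1 (fun y => complex.Re (g y)) x +i*
  derive1 (fun y => complex.Im (g y)) x.

Definition is_cderive g x (l : R[i]) : Prop :=
  cderivable g x /\ cderive g x = l.

Definition ccontinuous_at g x : Prop :=
  {for x, continuous (fun y => complex.Re (g y))} /\
  {for x, continuous (fun y => complex.Im (g y))}.

(* gamma parametrizes a simple arc through the origin, tangent there to the real
   line spanned by d, i.e. to the line through 0 of angle arg d. *)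
Definition curve_tangent_at0 (delta : R) (gamma : R -> R[i]) (d : R[i]) : Prop :=
  [/\ gamma 0 = 0,
      {in `]- delta, delta[ &, injective gamma},
      forall t, t \in `]- delta, delta[ -> ccontinuous_at gamma t
    & exists2 k : R, k != 0 & is_cderive gamma 0 (k%:C * d)].

End RealVariable.

Section TravelingWaves.
Context {R : realType}.
Implicit Types (f F u : R -> R) (a E c : R) (p : R * R * R).

Definition class_C2 f : Prop :=
  [/\ forall x, derivable f x 1, forall x, derivable (derive1 f) x 1
    & continuous (derive1n 2 f)].

Definition potential F a c (v : R) : R := F v - c / 2 * v ^+ 2 - a * v.

Definition has_local_min (V : R -> R) : Prop :=
  exists m, \forall v \near m, V m <= V v.

Definition simple_turning_points (V : R -> R) E (um up : R) : Prop :=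
  [/\ um < up,
      V um = E /\ derive1 V um != 0,
      V up = E /\ derive1 V up != 0
    & forall v, um < v < up -> V v < E].

(* Parameter triples are p = (a, E, c). *)
Definition parameter_region F : set (R * R * R) :=
  [set p | has_local_min (potential F p.1.1 p.2) /\
           exists um up,
             simple_turning_points (potential F p.1.1 p.2) p.1.2 um up].

(* If the potential has several wells at energy E, the functions u_-, u_+ of the
   parameters are determined only after choosing one of them: um and up are
   the roots obtained by following one well continuously near p0. *)
Definition turning_point_branch F (um up : R * R * R -> R) (p0 : R * R * R) :
    Prop :=
  \forall p \near p0,
    [/\ simple_turning_points (potential F p.1.1 p.2) p.1.2 (um p) (up p),
        {for p, continuous um} & {for p, continuous up}].

Definition period F (um up : R * R * R -> R) p : R :=
  2 * \int[lebesgue_measure]_(v in `]um p, up p[)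
        (Num.sqrt (2 * (p.1.2 - potential F p.1.1 p.2 v)))^-1.

Record wave_profile f F a E c (u0 T : R) u : Prop := WaveProfile {
  profile_derivable : forall x, derivable u x 1;
  profile_derivable2 : forall x, derivable (derive1 u) x 1;
  profile_ode : forall x, derive1n 2 u x + f (u x) - c * u x = a;
  profile_energy : forall x, derive1 u x ^+ 2 / 2 + potential F a c (u x) = E;
  profile_init : u 0 = u0;
  profile_init' : derive1 u 0 = 0;
  profile_nonconstant : exists x, u x != u 0;
  profile_periodic : forall x, u (x + T) = u x }.

Definition linop f c u (v : R -> R[i]) (x : R) : R[i] :=
  - cderive (cderive v) x - (derive1 f (u x))%:C * v x + c%:C * v x.

Definition spectral_solution f c u (mu : R[i]) (psi : R -> R[i]) : Prop :=
  [/\ forall x, cderivable psi x,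
      forall x, cderivable (cderive psi) x,
      forall x, cderivable (cderive (cderive psi)) x
    & forall x, cderive (linop f c u psi) x = mu * psi x].

Definition spec f c u : set R[i] :=
  [set mu | exists psi : R -> R[i],
    [/\ spectral_solution f c u mu psi,
        exists x, psi x != 0
      & exists B : R, forall x, `|psi x| <= B%:C]].

Definition system_matrix f c u (mu : R[i]) (x : R) : 'M[R[i]]_3 :=
  \matrix_(i < 3, j < 3)
    (nth [::]
      [:: [:: 0; 1; 0];
          [:: 0; 0; 1];
          [:: - mu - (derive1 u x * derive1n 2 f (u x))%:C;
              (- derive1 f (u x) + c)%:C;
              0]]
      i)`_j.

Definition fundamental_matrix (H Phi : R -> 'M[R[i]]_3) : Prop :=
  Phi 0 = 1%:M /\
  forall x i j, is_cderive (fun y => Phi y i j) x ((H x *m Phi x) i j).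

Definition monodromy_matrix f c u (T : R) (M : R[i] -> 'M[R[i]]_3) : Prop :=
  forall mu, exists2 Phi,
    fundamental_matrix (system_matrix f c u mu) Phi & M mu = Phi T.

(* The roots of the characteristic polynomial, listed with multiplicity. *)
Definition eigenvalues (A : 'M[R[i]]_3) : seq R[i] :=
  sval (closed_field_poly_normal (char_poly A)).

Definition spec_multiplicity (M : R[i] -> 'M[R[i]]_3) (mu : R[i]) : nat :=
  count (fun lambda => `|lambda| == 1) (eigenvalues (M mu)).

Definition modulationally_unstable f c u : Prop :=
  forall e : R, 0 < e ->
    exists mu, [/\ spec f c u mu, `|mu| < e%:C & complex.Re mu != 0].

End TravelingWaves.

(* Main.v *)
Require Import Defs.
From HB Require Import structures.
From mathcomp Require Import all_boot all_order all_algebra.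
From mathcomp Require Import complex.
From mathcomp Require Import all_classical all_reals all_analysis.
From mathcomp Require Import ring lra perm.

(* Let a(mu) = tr M(mu). A bilinear form conserved between solutions at mu and at - mu
   gives det (l - M(mu)) = l^3 - a(mu) l^2 + a(- mu) l - 1, and the conserved quantities
   of the linearization give a(mu) = 3 + A mu^2 / 2 + B mu^3 / 6 + O(mu^4) with A, B real.
   On the imaginary axis this polynomial is self-inversive, so it has one or three roots
   on the unit circle according to the sign of its discriminant, which is
   - t^6 (Delta + O(t)) at mu = i t. For the rest of the spectrum, substitute
   l = (1 - i t / 2) / (1 + i t / 2) and mu = i t y: dividing by t^3 leaves
   cubic(y) + O(t) = 0, whose three roots continue to Lipschitz branches y(t) by the
   contraction principle. The symmetry mu -> - conj(mu) keeps the real branch real, hence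
   mu on the axis; the two nonreal branches are the curves mu = i t y(t). *)

Set Implicit Arguments.
Unset Strict Implicit.
Unset Printing Implicit Defensive.

Import Order.TTheory GRing.Theory Num.Theory.
Import numFieldNormedType.Exports.
Local Open Scope classical_set_scope.
Local Open Scope ring_scope.
Local Open Scope complex_scope.

(** * Complex-valued functions of a real variable *)

(** At mu = 0 all three eigenvalues of M equal 1, so they need not depend smoothly on mu and cannot
    be followed one by one. The proof therefore works with their symmetric functions, of which only
    the trace is free. The unit circle enters through a real parameter t, which makes the spectrum
    near 0 the solution set of one equation in (t, mu); the scaling mu = i t y separates its
    solutions because Delta < 0 makes the limiting cubic have three distinct roots. So Delta acts
    twice: it is the leading coefficient of the discriminant in l on the axis and, up to a positive
    factor, the discriminant of the cubic in y. No power series of M is used. Iterated Duhamel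
    integrals give its complex derivatives and an exact remainder mu^4 s(mu) with s bounded and
    Lipschitz, which is all that a contraction argument asks for. Lipschitz branches suffice for the
    tangents: the factor t in i t y(t) turns a Lipschitz error into O(t^2). *)

Local Notation cnorm := (@ComplexField.Normc.normc _).

Section ComplexCalculus.
Context {R : realType}.
Implicit Types (g h : R -> R[i]) (x : R) (z : R[i]).

Lemma is_cderiveP g x l :
  is_cderive g x l <->
  is_derive x 1 (fun y => complex.Re (g y)) (complex.Re l) /\
  is_derive x 1 (fun y => complex.Im (g y)) (complex.Im l).
Proof.
split.
  move=> [[d1 d2] <-]; rewrite /cderive /= !derive1E.
  by split; apply: derivableP.
move=> [d1 d2]; split; first by split; [exact: (@ex_derive _ _ _ _ _ _ _ d1) | exact: (@ex_derive _ _ _ _ _ _ _ d2)].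
rewrite /cderive !derive1E (@derive_val _ _ _ _ _ _ _ d1) (@derive_val _ _ _ _ _ _ _ d2).
by case: (l).
Qed.

Lemma conjcD (z w : R[i]) : conjc (z + w) = conjc z + conjc w.
Proof. by rewrite rmorphD. Qed.
Lemma conjcN (z : R[i]) : conjc (- z) = - conjc z.
Proof. by rewrite rmorphN. Qed.
Lemma conjcM (z w : R[i]) : conjc (z * w) = conjc z * conjc w.
Proof. by rewrite rmorphM. Qed.
Lemma conjcX (z : R[i]) n : conjc (z ^+ n) = conjc z ^+ n.
Proof. by rewrite rmorphXn. Qed.

Lemma is_rderiveD (k k' : R -> R) (x a b : R) : is_derive x 1 k a -> is_derive x 1 k' b ->
  is_derive x 1 (fun y => k y + k' y) (a + b).
Proof. by move=> dk dk'; exact: (is_deriveD dk dk'). Qed.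

Lemma is_rderiveN (k : R -> R) (x a : R) : is_derive x 1 k a ->
  is_derive x 1 (fun y => - k y) (- a).
Proof. by move=> dk; exact: (is_deriveN dk). Qed.

Lemma is_rderiveB (k k' : R -> R) (x a b : R) : is_derive x 1 k a -> is_derive x 1 k' b ->
  is_derive x 1 (fun y => k y - k' y) (a - b).
Proof. by move=> dk dk'; apply: is_rderiveD => //; apply: is_rderiveN. Qed.

Lemma is_rderiveM (k k' : R -> R) (x a b : R) : is_derive x 1 k a -> is_derive x 1 k' b ->
  is_derive x 1 (fun y => k y * k' y) (a * k' x + k x * b).
Proof.
move=> dk dk'; apply: is_derive_eq.
by rewrite /GRing.scale /= addrC [k' x * a]mulrC.
Qed.

Lemma is_rderive_shift (k : R -> R) (x T a : R) : is_derive (x + T) 1 k a ->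
  is_derive x 1 (fun y => k (y + T)) a.
Proof.
move=> dk; have dT : is_derive x 1 (fun y : R => y + T) 1.
  by apply: is_derive_eq; rewrite addr0.
rewrite -[a]mulr1; exact: (@is_derive1_comp _ k (fun y => y + T)).
Qed.

Lemma is_cderive_cst z x : is_cderive (fun=> z) x 0.
Proof. by apply/is_cderiveP; split; apply: is_derive_cst. Qed.

Lemma cReD (z w : R[i]) : complex.Re (z + w) = complex.Re z + complex.Re w.
Proof. by case: z; case: w. Qed.
Lemma cImD (z w : R[i]) : complex.Im (z + w) = complex.Im z + complex.Im w.
Proof. by case: z; case: w. Qed.
Lemma cReN (z : R[i]) : complex.Re (- z) = - complex.Re z.
Proof. by case: z. Qed.
Lemma cImN (z : R[i]) : complex.Im (- z) = - complex.Im z.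
Proof. by case: z. Qed.
Lemma cReM (z w : R[i]) :
  complex.Re (z * w) = complex.Re z * complex.Re w - complex.Im z * complex.Im w.
Proof. by case: z; case: w. Qed.
Lemma cImM (z w : R[i]) :
  complex.Im (z * w) = complex.Re z * complex.Im w + complex.Im z * complex.Re w.
Proof. by case: z; case: w. Qed.

Lemma is_cderiveD g h x l m : is_cderive g x l -> is_cderive h x m ->
  is_cderive (fun y => g y + h y) x (l + m).
Proof.
move=> /is_cderiveP[g1 g2] /is_cderiveP[h1 h2]; apply/is_cderiveP; split.
  by under eq_fun do rewrite cReD; rewrite cReD; apply: is_deriveD.
by under eq_fun do rewrite cImD; rewrite cImD; apply: is_deriveD.
Qed.

Lemma is_cderiveN g x l : is_cderive g x l -> is_cderive (fun y => - g y) x (- l).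
Proof.
move=> /is_cderiveP[g1 g2]; apply/is_cderiveP; split.
  by under eq_fun do rewrite cReN; rewrite cReN; apply: is_deriveN.
by under eq_fun do rewrite cImN; rewrite cImN; apply: is_deriveN.
Qed.

Lemma is_cderiveB g h x l m : is_cderive g x l -> is_cderive h x m ->
  is_cderive (fun y => g y - h y) x (l - m).
Proof. by move=> dg dh; apply: is_cderiveD => //; apply: is_cderiveN. Qed.

Lemma is_cderiveM g h x l m : is_cderive g x l -> is_cderive h x m ->
  is_cderive (fun y => g y * h y) x (l * h x + g x * m).
Proof.
move=> /is_cderiveP[g1 g2] /is_cderiveP[h1 h2]; apply/is_cderiveP; split.
  under eq_fun do rewrite cReM.
  apply: (is_derive_eq (is_rderiveB (is_rderiveM g1 h1) (is_rderiveM g2 h2))).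
  by rewrite cReD !cReM /=; ring.
under eq_fun do rewrite cImM.
apply: (is_derive_eq (is_rderiveD (is_rderiveM g1 h2) (is_rderiveM g2 h1))).
by rewrite cImD !cImM /=; ring.
Qed.

Lemma is_cderive_real (k : R -> R) x l : is_derive x 1 k l ->
  is_cderive (fun y => (k y)%:C) x l%:C.
Proof. by move=> dk; apply/is_cderiveP; split => //=; apply: is_derive_cst. Qed.

Lemma is_cderive_conj g x l : is_cderive g x l ->
  is_cderive (fun y => conjc (g y)) x (conjc l).
Proof.
have ReJ (z : R[i]) : complex.Re (conjc z) = complex.Re z by case: z.
have ImJ (z : R[i]) : complex.Im (conjc z) = - complex.Im z by case: z.
move=> /is_cderiveP[g1 g2]; apply/is_cderiveP; split.
  by under eq_fun do rewrite ReJ; rewrite ReJ.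
by under eq_fun do rewrite ImJ; rewrite ImJ; apply: is_rderiveN.
Qed.

Lemma is_cderive_shift g x T l : is_cderive g (x + T) l ->
  is_cderive (fun y => g (y + T)) x l.
Proof.
move=> /is_cderiveP[g1 g2]; apply/is_cderiveP; split.
  exact: (@is_rderive_shift (fun y => complex.Re (g y))).
exact: (@is_rderive_shift (fun y => complex.Im (g y))).
Qed.

Lemma is_cderive_eq g x l m : is_cderive g x l -> l = m -> is_cderive g x m.
Proof. by move=> ? <-. Qed.

Lemma is_cderive_ext g h x l : (forall y, g y = h y) -> is_cderive g x l ->
  is_cderive h x l.
Proof. by move=> /funext ->. Qed.

Lemma is_cderive_unique g x l m : is_cderive g x l -> is_cderive g x m -> l = m.
Proof. by move=> [_ <-] [_ <-]. Qed.

Lemma is_cderive_cont g x l : is_cderive g x l -> ccontinuous_at g x.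
Proof.
move=> [[d1 d2] _]; split; apply: differentiable_continuous.
  exact/derivable1_diffP.
exact/derivable1_diffP.
Qed.

Lemma is_cderive_sum n (g : 'I_n -> R -> R[i]) x (l : 'I_n -> R[i]) :
  (forall i, is_cderive (g i) x (l i)) ->
  is_cderive (fun y => \sum_(i < n) g i y) x (\sum_(i < n) l i).
Proof.
elim: n g l => [|n IH] g l dg.
  rewrite big_ord0; apply: is_cderive_ext (is_cderive_cst 0 x) => y.
  by rewrite big_ord0.
rewrite big_ord_recl.
apply: (@is_cderive_ext (fun y => g ord0 y + \sum_(i < n) g (lift ord0 i) y)).
  by move=> y; rewrite big_ord_recl.
by apply: is_cderiveD => //; apply: IH.
Qed.

Lemma is_cderive0_cst g : (forall x, is_cderive g x 0) -> forall x, g x = g 0.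
Proof.
move=> dg x.
have H1 : complex.Re (g x) = complex.Re (g 0).
  by apply: (@is_derive_0_is_cst _ (fun y => complex.Re (g y))) => y; have /is_cderiveP[] := dg y.
have H2 : complex.Im (g x) = complex.Im (g 0).
  by apply: (@is_derive_0_is_cst _ (fun y => complex.Im (g y))) => y; have /is_cderiveP[] := dg y.
by move: H1 H2; case: (g x) (g 0) => ? ? [? ?] /= -> ->.
Qed.

Lemma cnorm_ge0 z : 0 <= cnorm z.
Proof. by case: z => a b; apply: sqrtr_ge0. Qed.

Lemma cnormE z : `|z| = (cnorm z)%:C.
Proof. by rewrite normc_def; case: z. Qed.

Lemma ler_cnormD z w : cnorm (z + w) <= cnorm z + cnorm w.
Proof. exact: le_normcD. Qed.

Lemma cnormM z w : cnorm (z * w) = cnorm z * cnorm w.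
Proof. exact: ComplexField.Normc.normcM. Qed.

Lemma cnormN z : cnorm (- z) = cnorm z.
Proof. by case: z => a b /=; rewrite !sqrrN. Qed.

Lemma cnormR x : cnorm x%:C = `|x|.
Proof. by rewrite /= expr0n addr0 sqrtr_sqr. Qed.

Lemma cnorm0 : cnorm (0 : R[i]) = 0.
Proof. by rewrite (cnormR 0) normr0. Qed.

Lemma cnorm1 : cnorm (1 : R[i]) = 1.
Proof. by rewrite (cnormR 1) normr1. Qed.

Lemma cnormX z n : cnorm (z ^+ n) = cnorm z ^+ n.
Proof. by elim: n => [|n IH]; rewrite ?expr0 ?cnorm1 // !exprS cnormM IH. Qed.

Lemma cnorm_eq0 z : (cnorm z == 0) = (z == 0).
Proof.
apply/eqP/eqP => [|->]; last exact: cnorm0.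
exact: ComplexField.Normc.eq0_normc.
Qed.

Lemma cnormV z : cnorm z^-1 = (cnorm z)^-1.
Proof. exact: ComplexField.Normc.normcV. Qed.

Lemma cnormJ z : cnorm (conjc z) = cnorm z.
Proof. by case: z => a b /=; rewrite sqrrN. Qed.

Lemma cnorm_distC z w : cnorm (z - w) = cnorm (w - z).
Proof. by rewrite -cnormN opprB. Qed.

Lemma cnorm_geRe z : `|complex.Re z| <= cnorm z.
Proof.
case: z => a b /=; rewrite -(sqrtr_sqr a); apply: ler_wsqrtr.
by rewrite lerDl sqr_ge0.
Qed.

Lemma cnorm_geIm z : `|complex.Im z| <= cnorm z.
Proof.
case: z => a b /=; rewrite -(sqrtr_sqr b); apply: ler_wsqrtr.
by rewrite lerDr sqr_ge0.
Qed.

Lemma cnorm_leReIm z : cnorm z <= `|complex.Re z| + `|complex.Im z|.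
Proof.
have {1}-> : z = (complex.Re z)%:C + 'i * (complex.Im z)%:C.
  by case: z => a b; simpc.
apply: le_trans (ler_cnormD _ _) _; rewrite cnormM !cnormR.
have -> : cnorm ('i%C : R[i]) = 1 by rewrite /= expr0n /= expr1n add0r sqrtr1.
by rewrite mul1r.
Qed.

Lemma real_mean_bound (k k' : R -> R) (L C x : R) :
  (forall y : R, is_derive y 1 k (k' y)) -> (forall y : R, `|y| <= L -> `|k' y| <= C) ->
  `|x| <= L -> `|k x - k 0| <= C * L.
Proof.
move=> dk bk xL.
have C0 : 0 <= C by apply: le_trans (bk x xL).
have ck : forall a b : R, {within `[a, b], continuous k}.
  move=> a b; apply: derivable_within_continuous => y _; exact: (@ex_derive _ _ _ _ _ _ _ (dk y)).
have aux (a b : R) : a <= b -> `|a| <= L -> `|b| <= L -> `|k b - k a| <= C * (b - a).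
  move=> ab aL bL.
  have [c cab ->] := @MVT_segment R k k' a b ab (fun y _ => dk y) (ck a b).
  rewrite normrM [`|b - a|]ger0_norm ?subr_ge0 //.
  apply: ler_wpM2r; first by rewrite subr_ge0.
  apply: bk; move: cab aL bL; rewrite in_itv /= !ler_norml; lra.
have [x0|x0] := leP 0 x.
  apply: le_trans (aux 0 x x0 _ xL) _; first by rewrite normr0 (le_trans _ xL).
  by rewrite subr0 ler_wpM2l // -(ger0_norm x0).
rewrite distrC; apply: le_trans (aux x 0 (ltW x0) xL _) _.
  by rewrite normr0 (le_trans _ xL).
by rewrite sub0r ler_wpM2l // -(ltr0_norm x0).
Qed.

(** The mean value theorem fails for complex values, so it is applied to the real and imaginary
    parts; their sum costs the factor 2. *)
Lemma cderive_mean_bound g g' (L C x : R) :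
  (forall y, is_cderive g y (g' y)) -> (forall y, `|y| <= L -> cnorm (g' y) <= C) ->
  `|x| <= L -> cnorm (g x - g 0) <= 2 * C * L.
Proof.
move=> dg bg xL.
apply: le_trans (cnorm_leReIm _) _.
rewrite -mulrA mulr_natl mulr2n cReD cReN cImD cImN; apply: lerD.
- apply: (@real_mean_bound (fun y => complex.Re (g y)) (fun y => complex.Re (g' y))) => // y.
    by have /is_cderiveP[] := dg y.
  by move=> /bg; apply: le_trans; apply: cnorm_geRe.
- apply: (@real_mean_bound (fun y => complex.Im (g y)) (fun y => complex.Im (g' y))) => // y.
    by have /is_cderiveP[] := dg y.
  by move=> /bg; apply: le_trans; apply: cnorm_geIm.
Qed.

Lemma ccont_bounded g (L : R) : (forall x, ccontinuous_at g x) ->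
  exists2 C : R, 0 < C & forall x, `|x| <= L -> cnorm (g x) <= C.
Proof.
move=> cg.
have aux (k : R -> R) : continuous k -> exists2 C : R, 0 <= C & forall x, `|x| <= L -> `|k x| <= C.
  move=> ck; have [L0|L0] := leP 0 L; last first.
    by exists 0 => // x xL; have := normr_ge0 x; rewrite leNgt (le_lt_trans xL L0).
  have cn : {within `[- L, L], continuous (fun x => `|k x|)}.
    apply: continuous_subspaceT => x.
    apply: (continuous_comp (ck x)); exact: norm_continuous.
  have [|c _ bc] := EVT_max _ cn; first by lra.
  exists `|k c| => // x; rewrite ler_norml => xL; apply: bc.
  by rewrite in_itv.
have [C1 C10 b1] := aux (fun x => complex.Re (g x)) (fun x => (cg x).1).
have [C2 C20 b2] := aux (fun x => complex.Im (g x)) (fun x => (cg x).2).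
exists (C1 + C2 + 1); first by lra.
move=> x xL; apply: le_trans (cnorm_leReIm _) _.
by have := b1 x xL; have := b2 x xL; lra.
Qed.

End ComplexCalculus.

(** * Antiderivatives on the whole line *)

Section Antiderivative.
Context {R : realType}.

(** The fundamental theorem is applied to the right of the lower end b of the integral. To cover all
    of R the lower end moves with x, and the value at 0 is subtracted; [indep] shows that the
    difference does not depend on b, so b may be frozen near each point. *)
Lemma continuous_antiderivative (g : R -> R) : continuous g ->
  exists G : R -> R, G 0 = 0 /\ forall x : R, is_derive x 1 G (g x).
Proof.
move=> cg.
pose F (b x : R) := (\int[lebesgue_measure]_(t in `[b, x]) g t)%R.
have dF (b x : R) : b < x -> is_derive x 1 (F b) (g x).
  move=> bx.
  have [] := @continuous_FTC1_closed R g b x (x + 1) _ _ bx (cg x).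
  - by lra.
  - apply: continuous_compact_integrable; first exact: segment_compact.
    exact: continuous_subspaceT.
  - move=> d1 d2; rewrite -d2 derive1E; exact: derivableP.
have cst (h : R -> R) (b x : R) : (forall y : R, b < y -> is_derive y 1 h 0) ->
    b < x -> b < 0 -> h x = h 0.
  move=> dh bx b0.
  have aux (y z : R) : y <= z -> b < y -> h z = h y.
    move=> yz y1.
    have dh' (t : R) : t \in `[y, z] -> is_derive t 1 h 0.
      by rewrite in_itv /= => /andP[yt _]; apply: dh; apply: lt_le_trans yt.
    have ch : {within `[y, z], continuous h}.
      by apply: (@derivable_within_continuous _ _ h) => t tt; exact: (@ex_derive _ _ _ _ _ _ _ (dh' t tt)).
    have dh2 (t : R) (tt : t \in `]y, z[) : is_derive t 1 h 0 by apply: dh'; apply: subset_itv_oo_cc tt.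
    have [c _ E] := @MVT_segment R h (fun=> 0) y z yz dh2 ch.
    exact: (subr0_eq (etrans E (mul0r _))).
  by have [x0|x0] := leP 0 x; [apply: aux | apply/esym; apply: aux => //; apply: ltW].
have indep (b b' x : R) : b < 0 -> b' < 0 -> b < x -> b' < x ->
    F b x - F b 0 = F b' x - F b' 0.
  move=> b0 b'0 bx b'x.
  have E : F b x - F b' x = F b 0 - F b' 0.
    apply: (cst (fun y => F b y - F b' y) (Num.max b b')).
    - move=> y; rewrite gt_max => /andP[y1 y2].
      by apply: (is_derive_eq (is_rderiveB (dF _ _ y1) (dF _ _ y2))); rewrite subrr.
    - by rewrite gt_max bx.
    - by rewrite gt_max b0.
  by move: (F b x) (F b' x) (F b 0) (F b' 0) E => w1 w2 w3 w4 E; lra.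
exists (fun x => F (- `|x| - 1) x - F (- `|x| - 1) 0); split.
  by rewrite subrr.
move=> x.
have nx := normr_ge0 x; have lx := ler_norm (- x); rewrite normrN in lx.
(* A fixed lower end that lies to the left of 0 and of every y with |x - y| < 1. *)
pose b : R := - `|x| - 2.
have H : is_derive x 1 (fun y => F b y - F b 0) (g x).
  have bx : b < x by rewrite /b; lra.
  apply: (is_derive_eq (is_rderiveB (dF _ _ bx) (is_derive_cst (F b 0) x 1))).
  by rewrite subr0.
apply: near_eq_is_derive H.
near=> y.
have yx : `|x - y| < 1 by near: y; apply: nbhsx_ballx.
have := ler_normB x (x - y); rewrite (_ : x - (x - y) = y); last by ring.
have ny := normr_ge0 y; have ly := ler_norm (- y); rewrite normrN in ly.
by move=> h; apply: indep; rewrite /b; lra.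
Unshelve. all: by end_near. Qed.

Lemma ccontinuous_antiderivative (g : R -> R[i]) : (forall x, ccontinuous_at g x) ->
  exists G : R -> R[i], G 0 = 0 /\ forall x, is_cderive G x (g x).
Proof.
move=> cg.
have [G1 [G10 dG1]] := continuous_antiderivative (fun x => (cg x).1).
have [G2 [G20 dG2]] := continuous_antiderivative (fun x => (cg x).2).
exists (fun x => G1 x +i* G2 x); split; first by rewrite G10 G20.
by move=> x; apply/is_cderiveP; split; [exact: dG1 | exact: dG2].
Qed.

End Antiderivative.

(** * Linear systems *)

Section MatrixCalculus.
Context {R : realType}.
Notation C := R[i].

Definition is_mderive m n (Y : R -> 'M[C]_(m, n)) x (L : 'M[C]_(m, n)) :=
  forall i j, is_cderive (fun y => Y y i j) x (L i j).

Lemma is_mderiveM m n p (Y : R -> 'M[C]_(m, n)) (Z : R -> 'M[C]_(n, p)) x K L :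
  is_mderive Y x K -> is_mderive Z x L ->
  is_mderive (fun y => Y y *m Z y) x (K *m Z x + Y x *m L).
Proof.
move=> dY dZ i j; rewrite !mxE -big_split /=.
apply: (@is_cderive_ext _ (fun y => \sum_k Y y i k * Z y k j)).
  by move=> y; rewrite mxE.
by apply: (@is_cderive_sum _ _ (fun k y => Y y i k * Z y k j)) => k; apply: is_cderiveM.
Qed.

Lemma is_mderive_cst m n (A : 'M[C]_(m, n)) x : is_mderive (fun=> A) x 0.
Proof. by move=> i j; rewrite mxE; apply: is_cderive_cst. Qed.

Lemma is_mderiveD m n (Y Z : R -> 'M[C]_(m, n)) x K L :
  is_mderive Y x K -> is_mderive Z x L -> is_mderive (fun y => Y y + Z y) x (K + L).
Proof.
move=> dY dZ i j; rewrite mxE; apply: is_cderive_ext (is_cderiveD (dY i j) (dZ i j)) => y.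
by rewrite mxE.
Qed.

Lemma is_mderiveN m n (Y : R -> 'M[C]_(m, n)) x K :
  is_mderive Y x K -> is_mderive (fun y => - Y y) x (- K).
Proof.
move=> dY i j; rewrite mxE; apply: is_cderive_ext (is_cderiveN (dY i j)) => y.
by rewrite mxE.
Qed.

Lemma is_mderiveZ m n (Y : R -> 'M[C]_(m, n)) x K (z : C) :
  is_mderive Y x K -> is_mderive (fun y => z *: Y y) x (z *: K).
Proof.
move=> dY i j; rewrite mxE.
apply: (is_cderive_eq (is_cderive_ext _ (is_cderiveM (is_cderive_cst z x) (dY i j)))).
  by move=> y; rewrite mxE.
by rewrite mul0r add0r.
Qed.

Lemma is_mderive_shift m n (Y : R -> 'M[C]_(m, n)) x T K :
  is_mderive Y (x + T) K -> is_mderive (fun y => Y (y + T)) x K.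
Proof. by move=> dY i j; apply: (@is_cderive_shift _ (fun y => Y y i j)). Qed.

Lemma is_mderive_eq m n (Y : R -> 'M[C]_(m, n)) x K L :
  is_mderive Y x K -> K = L -> is_mderive Y x L.
Proof. by move=> ? <-. Qed.

Lemma is_mderive_unique m n (Y : R -> 'M[C]_(m, n)) x K L :
  is_mderive Y x K -> is_mderive Y x L -> K = L.
Proof. by move=> dK dL; apply/matrixP => i j; apply: is_cderive_unique (dK i j) (dL i j). Qed.

Lemma is_mderive0_cst m n (Y : R -> 'M[C]_(m, n)) :
  (forall x, is_mderive Y x 0) -> forall x, Y x = Y 0.
Proof.
move=> dY x; apply/matrixP => i j; apply: (@is_cderive0_cst _ (fun y => Y y i j)) => y.
by have := dY y i j; rewrite mxE.
Qed.

(** Existence is enough here: the derivative of the adjugate is later found by differentiating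
    [Phi *m \adj Phi = 1], without a formula for the derivative of a determinant. *)
Lemma is_mderive_det n (Y : R -> 'M[C]_n) x K :
  is_mderive Y x K -> exists d, is_cderive (fun y => \det (Y y)) x d.
Proof.
move=> dY; rewrite /determinant.
elim: (index_enum _) => [|s r [d IH]].
  exists 0; apply: is_cderive_ext (is_cderive_cst 0 x) => y.
  by rewrite big_nil.
have [e H] : exists e, is_cderive (fun y => \prod_i Y y i (s i)) x e.
  elim: (index_enum _) => [|i r' [e IH']].
    exists 0; apply: is_cderive_ext (is_cderive_cst 1 x) => y.
    by rewrite big_nil.
  eexists; apply: is_cderive_ext (is_cderiveM (dY i (s i)) IH') => y.
  by rewrite big_cons.
eexists; apply: is_cderive_ext (is_cderiveD (is_cderiveM (is_cderive_cst ((-1) ^+ s) x) H) IH) => y.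
by rewrite big_cons.
Qed.

Lemma is_mderive_adj n (Y : R -> 'M[C]_n) x K :
  is_mderive Y x K -> exists D, is_mderive (fun y => \adj (Y y)) x D.
Proof.
move=> dY.
have H i j : exists d, is_cderive (fun y => (\adj (Y y)) i j) x d.
  have dm : is_mderive (fun y => row' j (col' i (Y y))) x (row' j (col' i K)).
    move=> k l; rewrite !mxE; apply: is_cderive_ext (dY _ _) => y.
    by rewrite !mxE.
  have [d Hd] := is_mderive_det dm.
  eexists; apply: is_cderive_ext (is_cderiveM (is_cderive_cst ((-1) ^+ (j + i)) x) Hd) => y.
  by rewrite mxE.
exists (\matrix_(i, j) sval (cid (H i j))) => i j; rewrite mxE.
exact: svalP (cid (H i j)).
Qed.

Section LinearSystem.
Context (n : nat) (H : R -> 'M[C]_n) (Phi : R -> 'M[C]_n).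
Hypothesis dPhi : forall x, is_mderive Phi x (H x *m Phi x).
Hypothesis det1 : forall x, \det (Phi x) = 1.

Lemma mul_Phi_adj x : Phi x *m \adj (Phi x) = 1%:M.
Proof. by rewrite mul_mx_adj det1. Qed.

Lemma mul_adj_Phi x : \adj (Phi x) *m Phi x = 1%:M.
Proof. by rewrite mul_adj_mx det1. Qed.

(** As the determinant is 1, the adjugate is the inverse; being polynomial in the entries, it is
    differentiated without division. *)
Lemma is_mderive_adj_sys x :
  is_mderive (fun y => \adj (Phi y)) x (- (\adj (Phi x) *m H x)).
Proof.
have [D dD] := is_mderive_adj (dPhi x).
apply: (is_mderive_eq dD).
have := is_mderive_unique (is_mderiveM (dPhi x) dD) (_ : is_mderive _ x 0).
move=> /(_ (fun i j => is_cderive_ext _ (is_mderive_cst 1%:M x i j))) E.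
have {}E : H x *m Phi x *m \adj (Phi x) + Phi x *m D = 0.
  by apply: E => i j y; rewrite mul_Phi_adj.
have := congr1 (mulmx (\adj (Phi x))) E.
rewrite mulmx0 mulmxDr -!mulmxA mul_Phi_adj mulmx1 [X in _ + X]mulmxA mul_adj_Phi mul1mx.
by move=> /eqP; rewrite addrC addr_eq0 => /eqP.
Qed.

Lemma linear_system_inhom m (Y G : R -> 'M[C]_(n, m)) :
  (forall x, is_mderive Y x (H x *m Y x + G x)) ->
  forall x, is_mderive (fun y => \adj (Phi y) *m Y y) x (\adj (Phi x) *m G x).
Proof.
move=> dY x; apply: (is_mderive_eq (is_mderiveM (is_mderive_adj_sys x) (dY x))).
by rewrite mulmxDr mulNmx -mulmxA addrA addNr add0r.
Qed.

Lemma linear_system_unique m (Y : R -> 'M[C]_(n, m)) :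
  (forall x, is_mderive Y x (H x *m Y x)) -> Phi 0 = 1%:M ->
  forall x, Y x = Phi x *m Y 0.
Proof.
move=> dY Phi0 x.
have dW : forall x, is_mderive (fun y => \adj (Phi y) *m Y y) x 0.
  move=> y; rewrite -(mulmx0 _ (\adj (Phi y))).
  by apply: (@linear_system_inhom _ Y (fun=> 0)) => z; rewrite addr0.
have := is_mderive0_cst dW x; rewrite Phi0 adj1 mul1mx => <-.
by rewrite mulmxA mul_Phi_adj mul1mx.
Qed.

End LinearSystem.
End MatrixCalculus.

(** * The third order equation and its conserved pairing *)

Definition o0 : 'I_3 := @Ordinal 3 0 isT.
Definition o1 : 'I_3 := @Ordinal 3 1 isT.
Definition o2 : 'I_3 := @Ordinal 3 2 isT.

Lemma sum3 (V : nmodType) (F : 'I_3 -> V) : \sum_(k < 3) F k = F o0 + F o1 + F o2.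
Proof.
rewrite !big_ord_recl big_ord0 addr0 addrA.
by congr (F _ + F _ + F _); apply: val_inj.
Qed.

Lemma forall3 (P : 'I_3 -> Prop) : P o0 -> P o1 -> P o2 -> forall i, P i.
Proof.
move=> P0 P1 P2 [[|[|[|//]]] h].
- by rewrite (_ : Ordinal h = o0) //; apply: val_inj.
- by rewrite (_ : Ordinal h = o1) //; apply: val_inj.
- by rewrite (_ : Ordinal h = o2) //; apply: val_inj.
Qed.

Lemma det3 (K : comNzRingType) (A : 'M[K]_3) : \det A =
  A o0 o0 * (A o1 o1 * A o2 o2 - A o1 o2 * A o2 o1)
  - A o0 o1 * (A o1 o0 * A o2 o2 - A o1 o2 * A o2 o0)
  + A o0 o2 * (A o1 o0 * A o2 o1 - A o1 o1 * A o2 o0).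
Proof.
(* Indexing by natural numbers lets the iterated lifts of the cofactor expansion compute to
   numerals, so that equal entries become syntactically equal for [ring]. *)
pose B i j := A (inord i) (inord j).
have EA i j : A i j = B i j by rewrite /B !inord_val.
rewrite (expand_det_row _ ord0) !big_ord_recl big_ord0 /cofactor.
rewrite !(expand_det_row _ ord0) !big_ord_recl !big_ord0 /cofactor !det_mx11 !mxE !EA /= /bump /=.
rewrite !add0n !addn0 /=; ring.
Qed.

Definition principal_minors (K : comNzRingType) (A : 'M[K]_3) :=
  A o0 o0 * A o1 o1 - A o0 o1 * A o1 o0 + (A o0 o0 * A o2 o2 - A o0 o2 * A o2 o0)
  + (A o1 o1 * A o2 o2 - A o1 o2 * A o2 o1).

Lemma tr_adj3 (K : comNzRingType) (A : 'M[K]_3) : \tr (\adj A) = principal_minors A.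
Proof.
pose B i j := A (inord i) (inord j).
have EA i j : A i j = B i j by rewrite /B !inord_val.
rewrite /mxtrace sum3 /principal_minors !mxE /cofactor.
rewrite !(expand_det_row _ ord0) !big_ord_recl !big_ord0 /cofactor.
rewrite !det_mx11 !mxE !EA /= /bump /= !add0n !addn0 /=; ring.
Qed.

Lemma char_poly3 (K : comNzRingType) (A : 'M[K]_3) l :
  (char_poly A).[l] = l ^+ 3 - \tr A * l ^+ 2 + principal_minors A * l - \det A.
Proof.
have -> : (char_poly A).[l] =
  (l - A o0 o0) * ((l - A o1 o1) * (l - A o2 o2) - - A o1 o2 * - A o2 o1) -
  - A o0 o1 * (- A o1 o0 * (l - A o2 o2) - - A o1 o2 * - A o2 o0) +
  - A o0 o2 * (- A o1 o0 * - A o2 o1 - (l - A o1 o1) * - A o2 o0).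
  by rewrite /char_poly det3 !mxE /= ?mulr1n ?mulr0n !hornerE.
rewrite /principal_minors /mxtrace sum3 det3; ring.
Qed.

Section CompanionSystem.
Context {R : realType}.
Notation C := R[i].
Context (q q1 : R -> R) (Phi : C -> R -> 'M[C]_3).

(** The equation (q v - v'')' = mu v as a first order system, with [q] for c - f'(u) and [q1] for
    its derivative. *)
Definition companion_matrix (mu : C) (x : R) : 'M[C]_3 :=
  \matrix_(i < 3, j < 3)
    (nth [::] [:: [:: 0; 1; 0]; [:: 0; 0; 1]; [:: (q1 x)%:C - mu; (q x)%:C; 0]] i)`_j.

Definition is_solution m mu (v : R -> 'M[C]_(3, m)) :=
  forall x, is_mderive v x (companion_matrix mu x *m v x).

Lemma companion_mul m mu x (v : 'M[C]_(3, m)) j :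
  [/\ (companion_matrix mu x *m v) o0 j = v o1 j,
      (companion_matrix mu x *m v) o1 j = v o2 j &
      (companion_matrix mu x *m v) o2 j = ((q1 x)%:C - mu) * v o0 j + (q x)%:C * v o1 j].
Proof. by split; rewrite mxE sum3 !mxE /=; ring. Qed.

Lemma is_solutionP m mu (v : R -> 'M[C]_(3, m)) : is_solution mu v <->
  forall x j, [/\ is_cderive (fun y => v y o0 j) x (v x o1 j),
    is_cderive (fun y => v y o1 j) x (v x o2 j) &
    is_cderive (fun y => v y o2 j) x (((q1 x)%:C - mu) * v x o0 j + (q x)%:C * v x o1 j)].
Proof.
split=> dv x.
  move=> j; have [E0 E1 E2] := companion_mul mu x (v x) j.
  by split; apply: is_cderive_eq (dv x _ j) _.
apply: forall3 => j; have [E0 E1 E2] := companion_mul mu x (v x) j; have [] := dv x j.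
- by rewrite E0.
- by rewrite E1.
- by rewrite E2.
Qed.

Hypothesis dq : forall x : R, is_derive x 1 q (q1 x).
Hypothesis Phi0 : forall mu, Phi mu 0 = 1%:M.
Hypothesis dPhi : forall mu, is_solution mu (Phi mu).

(** Liouville's formula for a system matrix of trace zero. *)
Lemma det_Phi mu x : \det (Phi mu x) = 1.
Proof.
have d0 : forall y, is_cderive (fun x => \det (Phi mu x)) y 0.
  move=> y.
  have [a0 b0 c0] := (is_solutionP mu (Phi mu)).1 (dPhi mu) y o0.
  have [a1 b1 c1] := (is_solutionP mu (Phi mu)).1 (dPhi mu) y o1.
  have [a2 b2 c2] := (is_solutionP mu (Phi mu)).1 (dPhi mu) y o2.
  apply: is_cderive_ext (fun y => esym (det3 (Phi mu y))) _.
  apply: is_cderive_eq.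
    exact: is_cderiveD (is_cderiveB
      (is_cderiveM a0 (is_cderiveB (is_cderiveM b1 c2) (is_cderiveM b2 c1)))
      (is_cderiveM a1 (is_cderiveB (is_cderiveM b0 c2) (is_cderiveM b2 c0))))
      (is_cderiveM a2 (is_cderiveB (is_cderiveM b0 c1) (is_cderiveM b1 c0))).
  by cbv beta; ring.
by rewrite (is_cderive0_cst d0) Phi0 det1.
Qed.

Lemma solution_unique m mu (v : R -> 'M[C]_(3, m)) : is_solution mu v ->
  forall x, v x = Phi mu x *m v 0.
Proof.
move=> dv x; apply: (linear_system_unique (dPhi mu)) => //.
exact: det_Phi.
Qed.

(** [q] and [q1] are real, so conjugation carries solutions for mu to solutions for conj mu, and
    initial data determine them. *)
Lemma Phi_conj mu x : Phi (conjc mu) x = map_mx conjc (Phi mu x).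
Proof.
have H : is_solution (conjc mu) (fun y => map_mx conjc (Phi mu y)).
  apply/is_solutionP => y j.
  have [a b c] := (is_solutionP mu (Phi mu)).1 (dPhi mu) y j.
  split.
  - apply: is_cderive_eq (is_cderive_ext _ (is_cderive_conj a)) _; last by rewrite mxE.
    by move=> z; rewrite mxE.
  - apply: is_cderive_eq (is_cderive_ext _ (is_cderive_conj b)) _; last by rewrite mxE.
    by move=> z; rewrite mxE.
  - apply: is_cderive_eq (is_cderive_ext _ (is_cderive_conj c)) _.
      by move=> z; rewrite mxE.
    by rewrite !mxE conjcD !conjcM conjcD conjcN !conjc_real.
by rewrite (solution_unique H x) Phi0 map_mx1 mulmx1.
Qed.

Section Periodic.
Context (T : R).
Hypothesis qT : forall x, q (x + T) = q x.
Hypothesis q1T : forall x, q1 (x + T) = q1 x.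

Lemma solution_shift m mu (v : R -> 'M[C]_(3, m)) : is_solution mu v ->
  is_solution mu (fun x => v (x + T)).
Proof.
move=> dv x; apply: is_mderive_eq (is_mderive_shift (dv (x + T))) _.
by congr (_ *m _); apply/matrixP => i j; rewrite !mxE qT q1T.
Qed.

Lemma Phi_shift mu x : Phi mu (x + T) = Phi mu x *m Phi mu T.
Proof. by have := solution_unique (solution_shift (dPhi mu)) x; rewrite add0r. Qed.

Definition Lop x (v : 'M[C]_3) j := (q x)%:C * v o0 j - v o2 j.

Lemma is_cderive_Lop mu x j :
  is_cderive (fun y => Lop y (Phi mu y) j) x (mu * Phi mu x o0 j).
Proof.
have [a b c] := (is_solutionP mu (Phi mu)).1 (dPhi mu) x j.
apply: is_cderive_eq.
  exact: is_cderiveB (is_cderiveM (is_cderive_real (dq x)) a) c.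
by rewrite /=; ring.
Qed.

(* [L v * L z + mu (v z' - v' z)] is conserved along solutions [v] for [mu]
   and [z] for [- mu], so the monodromy matrices at [mu] and [- mu] are
   contragredient for the corresponding bilinear form. *)
Definition pairing mu x (v z : 'M[C]_3) j k :=
  Lop x v j * Lop x z k + mu * (v o0 j * z o1 k - v o1 j * z o0 k).

(** From (L v)' = mu v and (L z)' = - mu z, the product L v L z has derivative mu (z v'' - v z''),
    which cancels the derivative of mu (v z' - v' z). *)
Lemma pairing_conserved mu x j k :
  pairing mu x (Phi mu x) (Phi (- mu) x) j k = pairing mu 0 1%:M 1%:M j k.
Proof.
have d0 : forall y, is_cderive (fun x => pairing mu x (Phi mu x) (Phi (- mu) x) j k) y 0.
  move=> y.
  have [a b c] := (is_solutionP mu (Phi mu)).1 (dPhi mu) y j.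
  have [a' b' c'] := (is_solutionP (- mu) (Phi (- mu))).1 (dPhi (- mu)) y k.
  apply: is_cderive_eq.
    apply: is_cderiveD (is_cderiveM (is_cderive_Lop mu y j) (is_cderive_Lop (- mu) y k)) _.
    apply: is_cderiveM (is_cderive_cst mu y) _.
    exact: is_cderiveB (is_cderiveM a b') (is_cderiveM b a').
  by rewrite /Lop; ring.
by rewrite (is_cderive0_cst d0) !Phi0.
Qed.

(** Conservation reads A^T Om B = Om, so B is similar to the transposed inverse of A. Since det A =
    1, its trace is the second symmetric function of the eigenvalues of A. *)
Lemma tr_monodromyN mu : mu != 0 ->
  \tr (Phi (- mu) T) = principal_minors (Phi mu T).
Proof.
move=> mu0.
set A := Phi mu T; set B := Phi (- mu) T.
pose w := (q 0)%:C : C.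
(* Coefficients of [Lop] at x = 0; [Om] below is the matrix of the pairing there. *)
pose L (i : 'I_3) : C := [:: w; 0; -1]`_i.
pose Om : 'M[C]_3 := \matrix_(i < 3, k < 3) (L i * L k
  + mu * ((i == o0)%:R * (k == o1)%:R - (i == o1)%:R * (k == o0)%:R)).
have E : A^T *m Om *m B = Om.
  apply/matrixP => j k; have := pairing_conserved mu T j k.
  rewrite /pairing /Lop -[in q T](add0r T) qT -/A -/B -/w => H.
  rewrite mxE sum3 !mxE !sum3 !mxE /L /= !(mulr1, mulr0, mul0r, mul1r, subr0, sub0r, addr0, add0r).
  move: H; rewrite /w !mxE; move: j k; apply: forall3; apply: forall3 => /= H;
    by apply: (etrans _ (etrans H _)); ring.
(* The determinant is mu^2: this is where mu = 0 is excluded. *)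
have uO : Om \in unitmx.
  rewrite unitmxE unitfE det3 !mxE /L /=.
  have nz (z : C) : z = mu ^+ 2 -> z != 0 by move=> ->; rewrite expf_neq0.
  by apply: nz; ring.
have E2 : Om *m B = (\adj A)^T *m Om.
  have := congr1 (mulmx (\adj A)^T) E.
  by rewrite !mulmxA -trmx_mul mul_mx_adj det_Phi trmx1 mul1mx.
have -> : B = invmx Om *m ((\adj A)^T *m Om) by rewrite -E2 mulKmx.
by rewrite mxtrace_mulC -mulmxA mulmxV // mulmx1 mxtrace_tr tr_adj3.
Qed.
End Periodic.
End CompanionSystem.

(** * Dependence on the spectral parameter *)

Section ParameterDependence.
Context {R : realType}.
Notation C := R[i].
Context (q q1 : R -> R) (Phi : C -> R -> 'M[C]_3).
Hypothesis Phi0 : forall mu, Phi mu 0 = 1%:M.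
Hypothesis dPhi : forall mu, is_solution q q1 mu (Phi mu).
Let comp := companion_matrix q q1.

Definition mdiff m n (Y : R -> 'M[C]_(m, n)) := forall x, exists K, is_mderive Y x K.

Definition bounded_on (L : R) (Y : R -> 'M[C]_3) (c : R) :=
  forall x, `|x| <= L -> forall i j, cnorm (Y x i j) <= c.

Definition dmu : 'M[C]_3 := - delta_mx o2 o0.

Lemma companion_dmu mu nu x : comp nu x = comp mu x + (nu - mu) *: dmu.
Proof.
apply/matrixP; apply: forall3; apply: forall3; rewrite !mxE /= ?mulr0n ?mulr1n; ring.
Qed.

(* [Z] is the image of [Y] under the operator Y |-> Phi (int_0^x Phi^-1 dmu Y) of
   variation of constants, where [dmu] is the derivative of the system matrix in [mu]. *)
Definition Duhamel mu (Y Z : R -> 'M[C]_3) :=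
  Z 0 = 0 /\ forall x, is_mderive Z x (comp mu x *m Z x + dmu *m Y x).

Lemma Duhamel_lin mu a b Y Z Y' Z' : Duhamel mu Y Z -> Duhamel mu Y' Z' ->
  Duhamel mu (fun x => a *: Y x + b *: Y' x) (fun x => a *: Z x + b *: Z' x).
Proof.
move=> [Z0 dZ] [Z'0 dZ']; split; first by rewrite Z0 Z'0 !scaler0 addr0.
move=> x; apply: is_mderive_eq.
  exact: is_mderiveD (is_mderiveZ a (dZ x)) (is_mderiveZ b (dZ' x)).
by rewrite !mulmxDr -!scalemxAr !scalerDr addrACA.
Qed.

Lemma Duhamel_ext mu Y Z Y' Z' : (forall x, Y x = Y' x) -> (forall x, Z x = Z' x) ->
  Duhamel mu Y Z -> Duhamel mu Y' Z'.
Proof. by move=> /funext -> /funext ->. Qed.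

Lemma Duhamel_unique mu Y Z Z' : Duhamel mu Y Z -> Duhamel mu Y Z' -> forall x, Z x = Z' x.
Proof.
move=> dZ dZ' x.
have [H0 dH] := Duhamel_lin 1 (-1) dZ dZ'.
have dH' : is_solution q q1 mu (fun x => 1 *: Z x + -1 *: Z' x).
  move=> y; apply: is_mderive_eq (dH y) _.
  by rewrite !scale1r !scaleN1r subrr mulmx0 addr0.
have := solution_unique Phi0 dPhi dH' x; rewrite H0 mulmx0 scale1r scaleN1r.
exact: subr0_eq.
Qed.

Lemma mdiff_Phi mu : mdiff (Phi mu).
Proof. by move=> x; eexists; apply: dPhi. Qed.

Lemma mdiff_adj mu : mdiff (fun x => \adj (Phi mu x)).
Proof. by move=> x; exact: is_mderive_adj (dPhi mu x). Qed.

Lemma Duhamel_exists mu Y : mdiff Y -> exists Z, Duhamel mu Y Z.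
Proof.
move=> dY.
pose g x := \adj (Phi mu x) *m (dmu *m Y x).
have dg x : exists K, is_mderive g x K.
  have [K1 d1] := mdiff_adj mu x; have [K2 d2] := dY x.
  eexists; exact: is_mderiveM d1 (is_mderiveM (is_mderive_cst dmu x) d2).
have H i j : exists G : R -> C, G 0 = 0 /\ forall x, is_cderive G x (g x i j).
  apply: (ccontinuous_antiderivative (g := fun x => g x i j)) => x.
  have [K dK] := dg x; exact: is_cderive_cont (dK i j).
pose W x : 'M[C]_3 := \matrix_(i, j) sval (cid (H i j)) x.
have dW x : is_mderive W x (g x).
  move=> i j; have [_] := svalP (cid (H i j)) => /(_ x).
  by apply: is_cderive_ext => y; rewrite mxE.
exists (fun x => Phi mu x *m W x); split.
  rewrite Phi0 mul1mx; apply/matrixP => i j; rewrite !mxE.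
  by have [] := svalP (cid (H i j)).
move=> x; apply: is_mderive_eq (is_mderiveM (dPhi mu x) (dW x)) _.
by rewrite /g mulmxA !mulmxA (mul_Phi_adj (det_Phi Phi0 dPhi mu)) mul1mx.
Qed.

Lemma mdiff_bounded L Y : mdiff Y -> exists2 c : R, 0 < c & bounded_on L Y c.
Proof.
move=> dY.
have H i j : exists2 c : R, 0 < c & forall x, `|x| <= L -> cnorm (Y x i j) <= c.
  apply: (@ccont_bounded _ (fun x => Y x i j)) => x.
  have [K dK] := dY x; exact: is_cderive_cont (dK i j).
pose c i j := sval (cid2 (H i j)).
have c0 i j : 0 < c i j by rewrite /c; case: cid2.
have cP i j x : `|x| <= L -> cnorm (Y x i j) <= c i j by rewrite /c; case: cid2 => ? ? /= h; exact: h.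
exists (\sum_i \sum_j c i j).
  rewrite !sum3; have := (c0 o0 o0, c0 o0 o1, c0 o0 o2).
  have := (c0 o1 o0, c0 o1 o1, c0 o1 o2); have := (c0 o2 o0, c0 o2 o1, c0 o2 o2).
  by move=> [[? ?] ?] [[? ?] ?] [[? ?] ?]; rewrite !addr_gt0.
move=> x xL i j; apply: le_trans (cP i j x xL) _.
rewrite (bigD1 i) //= (bigD1 j) //= -addrA lerDl.
by rewrite addr_ge0 // sumr_ge0 // => k _; [apply: ltW | apply: sumr_ge0 => l _; apply: ltW].
Qed.

Lemma mulmx_bound (A B : 'M[C]_3) a b : (forall i j, cnorm (A i j) <= a) ->
  (forall i j, cnorm (B i j) <= b) -> forall i j, cnorm ((A *m B) i j) <= 3 * (a * b).
Proof.
move=> hA hB i j; rewrite mxE sum3.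
have H k : cnorm (A i k * B k j) <= a * b.
  by rewrite cnormM ler_pM ?cnorm_ge0.
apply: le_trans (ler_cnormD _ _) _; have := ler_cnormD (A i o0 * B o0 j) (A i o1 * B o1 j).
have := (H o0, H o1, H o2) => -[[]]; lra.
Qed.

(** The constant depends on [Phi mu] and its inverse on [-L, L] but not on the source [Y]; all later
    estimates are iterations of this one. *)
Lemma Duhamel_bound mu L : 0 <= L -> exists2 K : R, 0 < K &
  forall Y Z c, Duhamel mu Y Z -> bounded_on L Y c -> bounded_on L Z (K * c).
Proof.
move=> L0.
have [a a0 ba] := mdiff_bounded L (mdiff_Phi mu).
have [b b0 bb] := mdiff_bounded L (mdiff_adj mu).
(* A factor 3 for each of the three matrix products and 2 L from the mean value bound; the summand 1
   keeps the constant positive when L = 0. *)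
exists (3 * (a * (2 * (3 * (b * 3)) * L)) + 1).
  by rewrite ltr_wpDl // !mulr_ge0 // ltW.
move=> Y Z c [Z0 dZ] bY.
have c0 : 0 <= c by apply: le_trans (cnorm_ge0 _) (bY 0 _ o0 o0); rewrite normr0.
have dW := linear_system_inhom (dPhi mu) (det_Phi Phi0 dPhi mu) dZ.
have bE x : `|x| <= L -> forall i j, cnorm ((dmu *m Y x) i j) <= 3 * c.
  move=> xL i j; rewrite -[3 * c]/(3 * c) -[c in 3 * c]mul1r.
  apply: mulmx_bound; last by apply: bY.
  by move=> k l; rewrite !mxE cnormN; case: (_ && _); rewrite ?cnorm1 ?cnorm0 ?ler01.
have bW x : `|x| <= L -> forall i j, cnorm ((\adj (Phi mu x) *m Z x) i j) <= 2 * (3 * (b * (3 * c))) * L.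
  move=> xL i j.
  have := @cderive_mean_bound _ (fun y => (\adj (Phi mu y) *m Z y) i j) _ L (3 * (b * (3 * c))) x
    (fun y => dW y i j).
  have -> : (\adj (Phi mu 0) *m Z 0) i j = 0 by rewrite Z0 mulmx0 mxE.
  rewrite subr0; apply=> // y yL.
  by apply: mulmx_bound; [apply: bb | apply: bE].
move=> x xL i j.
have -> : Z x = Phi mu x *m (\adj (Phi mu x) *m Z x).
  by rewrite mulmxA (mul_Phi_adj (det_Phi Phi0 dPhi mu)) mul1mx.
apply: le_trans (mulmx_bound (ba x xL) (bW x xL) i j) _.
apply: (@le_trans _ _ (3 * (a * (2 * (3 * (b * 3)) * L)) * c)).
  by rewrite le_eqVlt; apply/orP; left; apply/eqP; ring.
by rewrite ler_wpM2r // lerDl.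
Qed.

(* Closes the a priori estimates of the Duhamel equation in place of Gronwall's inequality. *)
Lemma bounded_on_half L Y c S : bounded_on L Y S ->
  (forall S, bounded_on L Y S -> bounded_on L Y (c + S / 2)) -> bounded_on L Y (2 * c).
Proof.
move=> bS half x xL i j.
have bn n : exists2 S', bounded_on L Y S' & (S' - 2 * c) * 2 ^+ n = S - 2 * c.
  elim: n => [|n [S' bS' hS']]; first by exists S => //; rewrite expr0 mulr1.
  exists (c + S' / 2); first exact: half.
  rewrite -hS' exprS mulrA; congr (_ * _); lra.
have vn n : (cnorm (Y x i j) - 2 * c) * 2 ^+ n <= S - 2 * c.
  have [S' bS' <-] := bn n.
  by rewrite ler_wpM2r ?exprn_ge0 // lerD2r bS'.
rewrite leNgt; apply/negP => vc; rewrite -subr_gt0 in vc.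
have [n hn] : exists n : nat, S - 2 * c < (cnorm (Y x i j) - 2 * c) * n%:R.
  pose z := (S - 2 * c) / (cnorm (Y x i j) - 2 * c).
  exists (Num.bound `|z|).
  have -> : S - 2 * c = (cnorm (Y x i j) - 2 * c) * z by rewrite [RHS]mulrC /z divfK // gt_eqF.
  by rewrite ltr_pM2l //; apply: le_lt_trans (ler_norm z) (archi_boundP (normr_ge0 z)).
have h : n%:R <= 2 ^+ n :> R by rewrite -natrX ler_nat; exact/ltnW/ltn_expl.
by have := lt_le_trans hn (ler_wpM2l (ltW vc) h); rewrite ltNge vn.
Qed.

(** Choice turns the relation into an operator that can be iterated; on [mdiff] arguments the
    default value is never taken. *)
Definition Duhamel_op mu (Y : R -> 'M[C]_3) : R -> 'M[C]_3 :=
  xget (fun=> 0) [set Z | Duhamel mu Y Z].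

Lemma Duhamel_opP mu Y : mdiff Y -> Duhamel mu Y (Duhamel_op mu Y).
Proof. by move=> dY; have [Z dZ] := Duhamel_exists mu dY; rewrite /Duhamel_op; case: xgetP => [? _ //|] /(_ Z). Qed.

Lemma mdiff_Duhamel mu Y Z : Duhamel mu Y Z -> mdiff Z.
Proof. by move=> [_ dZ] x; eexists; apply: dZ. Qed.

(** The k-th Taylor coefficient in the parameter. Differentiating the system k times in mu gives the
    source k dmu Phi^(k-1); division by k! removes the factor k and leaves a plain iteration. *)
Definition Phi_deriv mu k : R -> 'M[C]_3 := iter k (Duhamel_op mu) (Phi mu).

Lemma mdiff_iter mu nu k : mdiff (iter k (Duhamel_op mu) (Phi nu)).
Proof.
elim: k => [|k IH] /=; first exact: mdiff_Phi.
exact: mdiff_Duhamel (Duhamel_opP mu IH).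
Qed.

Lemma Phi_derivP mu k : Duhamel mu (Phi_deriv mu k) (Phi_deriv mu k.+1).
Proof. exact/Duhamel_opP/mdiff_iter. Qed.

(** The system matrix is affine in the parameter, so this difference formula is exact for all [nu],
    with no limit taken. *)
Lemma Duhamel_Phi mu nu :
  Duhamel mu (fun x => (nu - mu) *: Phi nu x) (fun x => Phi nu x - Phi mu x).
Proof.
split; first by rewrite !Phi0 subrr.
move=> x; apply: is_mderive_eq (is_mderiveD (dPhi nu x) (is_mderiveN (dPhi mu x))) _.
by rewrite -/comp (companion_dmu mu nu) mulmxDl mulmxBr -scalemxAl -scalemxAr addrAC.
Qed.

Lemma inhomogeneous_diff (A D Y Y' Z Z' : 'M[C]_3) (z : C) :
  (A + z *: D) *m Y + D *m Z - (A *m Y' + D *m Z') = A *m (Y - Y') + D *m (z *: Y + (Z - Z')).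
Proof.
rewrite mulmxDl mulmxBr mulmxDr mulmxBr -scalemxAl -scalemxAr.
move: (A *m Y) (A *m Y') (D *m Y) (D *m Z) (D *m Z') => ? ? ? ? ?.
by apply/matrixP => i j; rewrite !mxE; ring.
Qed.

Lemma Duhamel_Phi_deriv mu nu k : Duhamel mu
  (fun x => (nu - mu) *: Phi_deriv nu k.+1 x + (Phi_deriv nu k x - Phi_deriv mu k x))
  (fun x => Phi_deriv nu k.+1 x - Phi_deriv mu k.+1 x).
Proof.
have [Z0 dZ] := Phi_derivP nu k; have [Z0' dZ'] := Phi_derivP mu k.
split; first by rewrite Z0 Z0' subrr.
move=> x; apply: is_mderive_eq (is_mderiveD (dZ x) (is_mderiveN (dZ' x))) _.
rewrite -!/comp (companion_dmu mu nu); exact: inhomogeneous_diff.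
Qed.

(** * Bounds uniform for parameters near a given one *)

Section LocalBounds.
Context (mu : C) (L : R) (L0 : 0 <= L).

Lemma bounded_onD Y Z a b : bounded_on L Y a -> bounded_on L Z b ->
  bounded_on L (fun x => Y x + Z x) (a + b).
Proof.
move=> bY bZ x xL i j; rewrite mxE; apply: le_trans (ler_cnormD _ _) _.
by apply: lerD; [apply: bY | apply: bZ].
Qed.

Lemma bounded_onZ (z : C) Y a : bounded_on L Y a ->
  bounded_on L (fun x => z *: Y x) (cnorm z * a).
Proof.
by move=> bY x xL i j; rewrite mxE cnormM ler_wpM2l ?cnorm_ge0 ?bY.
Qed.

Lemma bounded_on_le Y a b : bounded_on L Y a -> a <= b -> bounded_on L Y b.
Proof. by move=> bY ab x xL i j; apply: le_trans ab; apply: bY. Qed.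

Lemma bounded_on_ext Y Z a : (forall x, Y x = Z x) -> bounded_on L Y a -> bounded_on L Z a.
Proof. by move=> /funext ->. Qed.

Let K := sval (cid2 (Duhamel_bound mu L0)).
Let K0 : 0 < K. Proof. by rewrite /K; case: cid2. Qed.
Let KP Y Z c : Duhamel mu Y Z -> bounded_on L Y c -> bounded_on L Z (K * c).
Proof. by rewrite /K; case: cid2 => ? ? /= h; apply: h. Qed.

(** Within this radius, multiplication by nu - mu followed by the Duhamel operator at least halves a
    bound. *)
Definition duhamel_radius : R := (2 * K)^-1.

Lemma duhamel_radius_gt0 : 0 < duhamel_radius.
Proof. by rewrite invr_gt0 mulr_gt0. Qed.

Lemma radius_contraction z c : cnorm z <= duhamel_radius -> 0 <= c -> K * (cnorm z * c) <= c / 2.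
Proof.
move=> zr c0; rewrite mulrA mulrC ler_wpM2l //.
apply: le_trans (ler_wpM2l (ltW K0) zr) _.
by rewrite /duhamel_radius invfM mulrCA divff ?mulr1 // gt_eqF.
Qed.

Lemma bounded_on_ge0 Y c : bounded_on L Y c -> 0 <= c.
Proof. by move=> bY; apply: le_trans (cnorm_ge0 _) (bY 0 _ o0 o0); rewrite normr0. Qed.

(** [Z] occurs in its own source. Continuity gives it some bound S, which may depend on [Z];
    repeated halving replaces S by a bound in terms of [c] alone. *)
Lemma Duhamel_half Y Z G z c : mdiff Z -> Duhamel mu (fun x => z *: Z x + Y x) (fun x => Z x - G x) ->
  cnorm z <= duhamel_radius -> bounded_on L Y c -> bounded_on L G c ->
  bounded_on L Z (2 * (K * c + c)).
Proof.
move=> mZ dZ zr bY bG; have [S _ bS] := mdiff_bounded L mZ.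
apply: bounded_on_half bS _ => S' bS'.
have := bounded_onD (KP dZ (bounded_onD (bounded_onZ z bS') bY)) bG.
move=> /(bounded_on_ext (fun x => subrK (G x) (Z x)))/bounded_on_le; apply.
by have := radius_contraction zr (bounded_on_ge0 bS'); rewrite mulrDr; lra.
Qed.

Lemma Phi_deriv_bounded k : exists2 c : R, 0 < c &
  forall nu, cnorm (nu - mu) <= duhamel_radius -> bounded_on L (Phi_deriv nu k) c.
Proof.
elim: k => [|k [c c0 IH]].
  have [c c0 bc] := mdiff_bounded L (mdiff_Phi mu).
  exists (2 * (K * c + c)); first by rewrite mulr_gt0 // addr_gt0 // mulr_gt0.
  move=> nu nr; apply: (@Duhamel_half (fun=> 0) _ (Phi mu) (nu - mu)) => //.
  - exact: mdiff_Phi.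
  - by apply: Duhamel_ext (Duhamel_Phi mu nu) => // x; rewrite addr0.
  - by move=> x xL i j; rewrite mxE cnorm0 ltW.
have [d d0 bd] := mdiff_bounded L (mdiff_iter mu mu k.+1).
exists (2 * (K * (c + c + d) + (c + c + d))).
  by rewrite mulr_gt0 // addr_gt0 // ?mulr_gt0 // !addr_gt0.
move=> nu nr; apply: (Duhamel_half _ (Duhamel_Phi_deriv mu nu k) nr).
- exact: mdiff_iter.
- apply: bounded_on_le; first apply: bounded_onD (IH _ nr) _.
    apply: (bounded_on_ext (Y := fun x => -1 *: Phi_deriv mu k x)); first by move=> x; rewrite scaleN1r.
    apply: bounded_onZ; apply: IH; rewrite subrr cnorm0; exact/ltW/duhamel_radius_gt0.
  by rewrite cnormN cnorm1 mul1r lerDl ltW.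
- by apply: bounded_on_le bd _; rewrite lerDr addr_ge0 // ltW.
Qed.

Lemma Phi_deriv_lip k : exists2 c : R, 0 < c & forall nu, cnorm (nu - mu) <= duhamel_radius ->
  bounded_on L (fun x => Phi_deriv nu k x - Phi_deriv mu k x) (cnorm (nu - mu) * c).
Proof.
elim: k => [|k [c c0 IH]].
  have [c c0 bc] := Phi_deriv_bounded 0.
  exists (K * c); first exact: mulr_gt0.
  move=> nu nr; rewrite mulrCA; apply: KP (Duhamel_Phi mu nu) _.
  exact/bounded_onZ/bc.
have [d d0 bd] := Phi_deriv_bounded k.+1.
exists (K * (d + c)); first by rewrite mulr_gt0 // addr_gt0.
move=> nu nr; rewrite mulrCA; apply: KP (Duhamel_Phi_deriv mu nu k) _.
by rewrite mulrDr; apply: bounded_onD; [apply/bounded_onZ/bd | apply: IH].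
Qed.

(** The factor k + 1 is that of T_k' = (k + 1) T_(k+1) for Taylor coefficients T_k. The remainder of
    order k + 1 is the Duhamel image of the remainder of order k plus nu - mu times a Lipschitz
    error, both quadratic. *)
Lemma Phi_deriv_taylor k : exists2 c : R, 0 < c & forall nu, cnorm (nu - mu) <= duhamel_radius ->
  bounded_on L (fun x => Phi_deriv nu k x - Phi_deriv mu k x
     - (nu - mu) *: (k.+1%:R *: Phi_deriv mu k.+1 x)) (cnorm (nu - mu) ^+ 2 * c).
Proof.
elim: k => [|k [c c0 IH]].
  have [c c0 bc] := Phi_deriv_lip 0.
  exists (K * c); first exact: mulr_gt0.
  move=> nu nr; rewrite mulrCA; apply: KP; last first.
    by rewrite expr2 -mulrA; apply: bounded_onZ; apply: bc.
  have := Duhamel_lin 1 (- (nu - mu)) (Duhamel_Phi mu nu) (Phi_derivP mu 0).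
  apply: Duhamel_ext => x.
    by rewrite scale1r scaleNr scalerBr.
  by rewrite !scale1r scaleNr.
have [d d0 bd] := Phi_deriv_lip k.+1.
exists (K * (d + c)); first by rewrite mulr_gt0 // addr_gt0.
move=> nu nr; rewrite mulrCA; apply: KP; last first.
  rewrite mulrDr; apply: bounded_onD (IH _ nr).
  by rewrite expr2 -mulrA; apply: bounded_onZ; apply: bd.
have := Duhamel_lin 1 (- ((nu - mu) * k.+2%:R)) (Duhamel_Phi_deriv mu nu k) (Phi_derivP mu k.+1).
apply: Duhamel_ext => x; last by rewrite scale1r scaleNr scalerA.
move: (Phi_deriv nu k.+1 x) (Phi_deriv mu k.+1 x) (Phi_deriv nu k x) (Phi_deriv mu k x) => ? ? ? ?.
by apply/matrixP => i j; rewrite !mxE -[k.+2%:R]natr1; ring.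
Qed.

End LocalBounds.

(** Taylor remainders at the origin: [Phi nu] equals the sum of nu^j [Phi_deriv 0 j] over j < k plus
    nu^k times this matrix, exactly. *)
Definition Phi_rem nu k : R -> 'M[C]_3 := iter k (Duhamel_op 0) (Phi nu).

Lemma Phi_remE nu k x : Phi_rem nu k x = Phi_deriv 0 k x + nu *: Phi_rem nu k.+1 x.
Proof.
suff H : forall x, Phi_rem nu k x - Phi_deriv 0 k x = nu *: Phi_rem nu k.+1 x.
  by rewrite -H addrC subrK.
have lin Y Z : Duhamel 0 Y Z -> Duhamel 0 (fun x => nu *: Y x) (fun x => nu *: Z x).
  move=> dZ; apply: Duhamel_ext (Duhamel_lin nu 0 dZ dZ) => y.
    by rewrite scale0r addr0.
  by rewrite scale0r addr0.
elim: k => [|k IH] y.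
  have H1 : Duhamel 0 (fun x => nu *: Phi nu x) (fun x => Phi nu x - Phi 0 x).
    by apply: Duhamel_ext (Duhamel_Phi 0 nu) => // z; rewrite subr0.
  exact: (Duhamel_unique H1 (lin _ _ (Duhamel_opP 0 (mdiff_Phi nu))) y).
have H2 : Duhamel 0 (fun x => nu *: Phi_rem nu k.+1 x) (fun x => nu *: Phi_rem nu k.+2 x).
  exact/lin/Duhamel_opP/mdiff_iter.
have D1 : Duhamel 0 (Phi_rem nu k) (Phi_rem nu k.+1) by exact/Duhamel_opP/mdiff_iter.
have H3 : Duhamel 0 (fun x => nu *: Phi_rem nu k.+1 x)
    (fun x => Phi_rem nu k.+1 x - Phi_deriv 0 k.+1 x).
  apply: Duhamel_ext (Duhamel_lin 1 (-1) D1 (Phi_derivP 0 k)) => z.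
    by rewrite scale1r scaleN1r IH.
  by rewrite scale1r scaleN1r.
exact: (Duhamel_unique H3 H2 y).
Qed.

(** The base case k = 0 compares two parameters through the halving argument. Afterwards the
    operator at 0 is linear and bounded, so it preserves both estimates. *)
Lemma Phi_rem_lip L (L0 : 0 <= L) k : exists r c : R, [/\ 0 < r, 0 < c &
  forall nu nu', cnorm nu <= r -> cnorm nu' <= r ->
   bounded_on L (Phi_rem nu k) c /\
   bounded_on L (fun x => Phi_rem nu k x - Phi_rem nu' k x) (cnorm (nu - nu') * c)].
Proof.
have r0 := duhamel_radius_gt0 0 L0.
have [K K0 KP] := Duhamel_bound 0 L0.
elim: k => [|k [r [c [r1 c0 IH]]]]; last first.
  exists r, (K * c); split => //; first exact: mulr_gt0.
  move=> nu nu' nr nr'; have [b1 b2] := IH nu nu' nr nr'.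
  have D1 v : Duhamel 0 (Phi_rem v k) (Phi_rem v k.+1) by exact/Duhamel_opP/mdiff_iter.
  split; first exact: KP (D1 nu) b1.
  rewrite mulrCA; apply: (KP (fun x => Phi_rem nu k x - Phi_rem nu' k x)) b2.
  apply: Duhamel_ext (Duhamel_lin 1 (-1) (D1 nu) (D1 nu')) => z.
    by rewrite scale1r scaleN1r.
  by rewrite scale1r scaleN1r.
have [c c0 bc] := Phi_deriv_bounded 0 L0 0.
have {}bc nu : cnorm nu <= duhamel_radius 0 L0 -> bounded_on L (Phi nu) c.
  by move=> nr; apply: bc; rewrite subr0.
have [K' K'0 KP'] : exists2 K' : R, 0 < K' & forall nu nu', cnorm nu <= duhamel_radius 0 L0 ->
    cnorm nu' <= duhamel_radius 0 L0 ->
    bounded_on L (fun x => Phi nu x - Phi nu' x) (cnorm (nu - nu') * K').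
  exists (2 * (2 * (sval (cid2 (Duhamel_bound 0 L0)) * c) + c)).
    rewrite mulr_gt0 // addr_gt0 // mulr_gt0 // mulr_gt0 //; by case: cid2.
  move=> nu nu' nr nr'.
  have mZ : mdiff (fun x => Phi nu x - Phi nu' x).
    by move=> x; eexists; exact: is_mderiveD (dPhi nu x) (is_mderiveN (dPhi nu' x)).
  have D : Duhamel 0 (fun x => nu *: (Phi nu x - Phi nu' x) + (nu - nu') *: Phi nu' x)
     (fun x => (Phi nu x - Phi nu' x) - 0).
    apply: Duhamel_ext (Duhamel_lin 1 (-1) (Duhamel_Phi 0 nu) (Duhamel_Phi 0 nu')) => x.
      by apply/matrixP => i j; rewrite !mxE; ring.
    by apply/matrixP => i j; rewrite !mxE; ring.
  have n0 := cnorm_ge0 (nu - nu').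
  have b1 : bounded_on L (fun x => (nu - nu') *: Phi nu' x) (cnorm (nu - nu') * c).
    exact/bounded_onZ/bc.
  have b2 : bounded_on L (fun=> 0) (cnorm (nu - nu') * c).
    by move=> x xL i j; rewrite mxE cnorm0 mulr_ge0 // ltW.
  have := Duhamel_half mZ D nr b1 b2; move/bounded_on_le; apply.
  case: cid2 => k0 /= k00 _.
  have := mulr_ge0 n0 (mulr_ge0 (ltW k00) (ltW c0)); have := mulr_ge0 n0 (ltW c0); nra.
exists (duhamel_radius 0 L0), (c + K'); split => //; first exact: addr_gt0.
move=> nu nu' nr nr'; split; first by apply: bounded_on_le (bc nu nr) _; rewrite lerDl ltW.
apply: bounded_on_le (KP' nu nu' nr nr') _.
by rewrite ler_wpM2l ?cnorm_ge0 // lerDr ltW.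
Qed.

End ParameterDependence.

(** * The trace of the monodromy matrix *)

Section MatrixDerive.
Context {R : realType}.
Notation C := R[i].

(** Matrices carry the maximum norm, so an entrywise quadratic remainder identifies the complex
    derivative. *)
Lemma derive1_mx_lim (f : C -> 'M[C]_3) mu (D : 'M[C]_3) (r c : R) : 0 < r -> 0 < c ->
  (forall nu, cnorm (nu - mu) <= r -> forall i j,
     cnorm ((f nu - f mu - (nu - mu) *: D) i j) <= cnorm (nu - mu) ^+ 2 * c) ->
  derive1 f mu = D.
Proof.
move=> r0 c0 H; rewrite /derive1; apply: cvg_lim => //.
apply/cvgrPdist_le => e e0.
(* In the partial order of [R[i]] a positive element is real. *)
have e_real : e = (complex.Re e)%:C.
  by move: (e0); rewrite ltcE; case: (e) => a b /= /andP[/eqP ->].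
near=> h.
have hn0 : h != 0 by near: h; exact: nbhs_dnbhs_neq.
have he : `|h| < (Num.min r (complex.Re e / c))%:C.
  near: h; apply: dnbhs0_lt; rewrite ltcR lt_min r0 divr_gt0 //.
  by move: e0; rewrite ltcE => /andP[].
rewrite cnormE ltcR lt_min in he; have /andP[h1 h2] := he.
set A := D - _.
have bA i j : `|A i j| <= e.
  rewrite cnormE e_real lecR.
  have -> : A i j = - (h^-1 * (f (h + mu) - f mu - h *: D) i j).
    rewrite /A !mxE; field; exact: hn0.
  rewrite cnormN cnormM cnormV.
  have := H (h + mu); rewrite addrK => /(_ (ltW h1) i j) hb.
  have hp : 0 < cnorm h by rewrite lt_neqAle eq_sym cnorm_eq0 hn0 cnorm_ge0.
  rewrite mulrC ler_pdivrMr //; apply: le_trans hb _.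
  rewrite expr2 mulrC mulrA ler_wpM2r ?cnorm_ge0 //.
  by rewrite mulrC -ler_pdivlMr // ltW.
have H' : mx_norm A <= e.
  by have [->|/mx_norm_neq0 [ij ->]] := eqVneq (mx_norm A) 0; [exact: ltW | exact: bA].
exact: H'.
Unshelve. all: by end_near. Qed.

End MatrixDerive.

(** * Orders of vanishing at the origin *)

Section BigO.
Context {R : realType}.
Notation C := R[i].

Definition cbigO k (g : C -> C) := exists r c : R, [/\ 0 < r, 0 < c &
  forall nu, cnorm nu <= r -> cnorm (g nu) <= c * cnorm nu ^+ k].

Lemma cbigO_ext k g h : (forall nu, g nu = h nu) -> cbigO k g -> cbigO k h.
Proof. by move=> /funext ->. Qed.

Lemma cbigOD k g h : cbigO k g -> cbigO k h -> cbigO k (fun nu => g nu + h nu).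
Proof.
move=> [r [c [r0 c0 H]]] [r' [c' [r'0 c'0 H']]].
exists (Num.min r r'), (c + c'); split; [by rewrite lt_min r0|exact: addr_gt0|].
move=> nu; rewrite le_min => /andP[h1 h2]; apply: le_trans (ler_cnormD _ _) _.
by rewrite mulrDl lerD ?H ?H'.
Qed.

Lemma cbigON k g : cbigO k g -> cbigO k (fun nu => - g nu).
Proof. by move=> [r [c [r0 c0 H]]]; exists r, c; split => // nu /H; rewrite cnormN. Qed.

Lemma cbigOB k g h : cbigO k g -> cbigO k h -> cbigO k (fun nu => g nu - h nu).
Proof. by move=> Hg Hh; apply: cbigOD => //; apply: cbigON. Qed.

Lemma cbigOM k l g h : cbigO k g -> cbigO l h -> cbigO (k + l) (fun nu => g nu * h nu).
Proof.
move=> [r [c [r0 c0 H]]] [r' [c' [r'0 c'0 H']]].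
exists (Num.min r r'), (c * c'); split; [by rewrite lt_min r0|exact: mulr_gt0|].
move=> nu; rewrite le_min => /andP[h1 h2]; rewrite cnormM exprD mulrACA.
by rewrite ler_pM ?cnorm_ge0 ?H ?H'.
Qed.

Lemma cbigO_cst z : cbigO 0 (fun=> z).
Proof.
exists 1, (cnorm z + 1); split => //; first by rewrite ltr_wpDl ?cnorm_ge0.
by move=> nu _; rewrite expr0 mulr1 lerDl.
Qed.

Lemma cbigOW k g : cbigO k.+1 g -> cbigO k g.
Proof.
move=> [r [c [r0 c0 H]]]; exists (Num.min r 1), c; split => //; first by rewrite lt_min r0 ltr01.
move=> nu; rewrite le_min => /andP[h1 h2]; apply: le_trans (H _ h1) _.
by rewrite exprS ler_wpM2l ?(ltW c0) // ler_piMl ?exprn_ge0 ?cnorm_ge0.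
Qed.

Lemma cbigOMl k z g : cbigO k g -> cbigO k (fun nu => z * g nu).
Proof. by move=> H; have := cbigOM (cbigO_cst z) H; rewrite add0n. Qed.

Lemma cbigO_at0 k g : cbigO k.+1 g -> g 0 = 0.
Proof.
move=> [r [c [r0 c0 H]]]; apply/eqP; rewrite -cnorm_eq0 eq_le cnorm_ge0 andbT.
by have := H 0; rewrite cnorm0 expr0n mulr0; apply; apply: ltW.
Qed.

Lemma cbigO_Xn k : cbigO k (fun mu : C => mu ^+ k).
Proof. by exists 1, 1; split => // nu _; rewrite mul1r cnormX. Qed.

Lemma cbigO_coef k (z : C) : cbigO k.+1 (fun mu => mu ^+ k * z) -> z = 0.
Proof.
move=> [r [c [r0 c0 H]]]; apply/eqP; rewrite -cnorm_eq0 eq_le cnorm_ge0 andbT leNgt; apply/negP => z0.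
pose t := Num.min r (cnorm z / (2 * c)).
have t0 : 0 < t by rewrite lt_min r0 divr_gt0 // mulr_gt0.
have := H t%:C; rewrite cnormM cnormX cnormR gtr0_norm // ge_min lexx => /(_ isT).
rewrite exprSr mulrCA ler_pM2l ?exprn_gt0 // leNgt => /negP; apply.
have : t <= cnorm z / (2 * c) by rewrite ge_min lexx orbT.
rewrite ler_pdivlMr ?mulr_gt0 //; nra.
Qed.

End BigO.

Section Monodromy.
Context {R : realType}.
Notation C := R[i].
Context (q q1 : R -> R) (Phi : C -> R -> 'M[C]_3).
Hypothesis dq : forall x : R, is_derive x 1 q (q1 x).
Hypothesis Phi0 : forall mu, Phi mu 0 = 1%:M.
Hypothesis dPhi : forall mu, is_solution q q1 mu (Phi mu).
Context (T : R).
Hypothesis qT : forall x, q (x + T) = q x.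
Hypothesis q1T : forall x, q1 (x + T) = q1 x.

(** An equality of functions, not just of values at 0, because the induction differentiates the k-th
    derivative once more. *)
Lemma derive1n_Phi k : derive1n k (fun nu => Phi nu T) =
  fun nu => (k`!)%:R *: Phi_deriv q q1 Phi nu k T.
Proof.
elim: k => [|k IH]; first by apply/funext => nu; rewrite derive1n0 scale1r.
rewrite derive1nS IH; apply/funext => mu.
have [c c0 H] := Phi_deriv_taylor Phi0 dPhi mu (normr_ge0 T) k.
apply: (@derive1_mx_lim _ _ _ _ (duhamel_radius Phi0 dPhi mu (normr_ge0 T)) (k`!%:R * c)).
- exact: duhamel_radius_gt0.
- by rewrite mulr_gt0 // ltr0n fact_gt0.
move=> nu nr i j.
have := H nu nr T (lexx _) i j.
set Y := Phi_deriv _ _ _ nu k T; set Y' := Phi_deriv _ _ _ mu k T.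
set Z := Phi_deriv _ _ _ mu k.+1 T => h; clearbody Y Y' Z.
have -> : (k`!%:R *: Y - k`!%:R *: Y' - (nu - mu) *: ((k.+1)`!%:R *: Z)) i j =
   k`!%:R * (Y - Y' - (nu - mu) *: (k.+1%:R *: Z)) i j.
  by rewrite !mxE factS natrM; ring.
rewrite cnormM mulrCA (_ : cnorm k`!%:R = k`!%:R); last first.
  by rewrite -[k`!%:R](rmorph_nat (real_complex R)) cnormR ger0_norm.
by rewrite ler_wpM2l.
Qed.

Context (U U1 U2 : R -> R).
Hypothesis dU : forall x : R, is_derive x 1 U (U1 x).
Hypothesis dU1 : forall x : R, is_derive x 1 U1 (U2 x).
Hypothesis dU2 : forall x : R, is_derive x 1 U2 (q x * U1 x).
Hypothesis UT : forall x, U (x + T) = U x.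
Hypothesis U10 : U1 0 = 0.
Hypothesis U20 : U2 0 != 0.

Lemma is_derive_periodic (V V1 : R -> R) : (forall x : R, is_derive x 1 V (V1 x)) ->
  (forall x, V (x + T) = V x) -> forall x, V1 (x + T) = V1 x.
Proof.
move=> dV VT x; have := is_rderive_shift (dV (x + T)).
under eq_fun do rewrite VT.
by move=> d1; rewrite -(@derive_val _ _ _ _ _ _ _ d1) (@derive_val _ _ _ _ _ _ _ (dV x)).
Qed.

Let U1T : U1 T = 0.
Proof. by rewrite -[T]add0r (is_derive_periodic dU UT). Qed.

Let U2T : U2 T = U2 0.
Proof. by rewrite -[T]add0r (is_derive_periodic dU1 (is_derive_periodic dU UT)). Qed.

Let k : C := (U2 0)%:C.
Let k0 : k != 0. Proof. by rewrite /k; apply: contra U20 => /eqP[->]. Qed.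

(** The translation mode u' solves the equation at mu = 0 with data (0, u''(0), 0); dividing by
    u''(0) gives the middle column. *)
Lemma Phi_col1 x : [/\ Phi 0 x o0 o1 = (U1 x)%:C / k, Phi 0 x o1 o1 = (U2 x)%:C / k
  & Phi 0 x o2 o1 = (q x * U1 x)%:C / k].
Proof.
pose v x : 'M[C]_(3, 1) := \matrix_(i < 3, j < 1)
  [:: (U1 x)%:C / k; (U2 x)%:C / k; (q x * U1 x)%:C / k]`_i.
have dreal (h : R -> R) (z a : R) : is_derive z 1 h a ->
    is_cderive (fun y => (h y)%:C / k) z (a%:C / k).
  move=> dh; apply: is_cderive_eq (is_cderiveM (is_cderive_real dh) (is_cderive_cst k^-1 z)) _.
  by rewrite mulr0 addr0.
have dv : is_solution q q1 0 v.
  apply/is_solutionP => y j; split.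
  - apply: is_cderive_eq (is_cderive_ext _ (dreal _ _ _ (dU1 y))) _; last by rewrite mxE.
    by move=> z; rewrite mxE.
  - apply: is_cderive_eq (is_cderive_ext _ (dreal _ _ _ (dU2 y))) _; last by rewrite mxE.
    by move=> z; rewrite mxE.
  - apply: is_cderive_eq (is_cderive_ext _ (dreal _ _ _ (is_rderiveM (dq y) (dU1 y)))) _.
      by move=> z; rewrite mxE.
    by rewrite !mxE /= rmorphD !rmorphM /=; ring.
have v0 : v 0 = delta_mx o1 0.
  apply/matrixP => i j; rewrite !mxE ord1 eqxx andbT; move: i.
  by apply: forall3; rewrite /= ?U10 ?mulr0 ?rmorph0 ?mul0r //= divff.
have := solution_unique Phi0 dPhi dv x; rewrite v0 => E.
have Ei i : v x i 0 = Phi 0 x i o1.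
  by rewrite E mxE sum3 !mxE /= mulr0 mulr1 mulr0 addr0 add0r.
by rewrite -!Ei !mxE.
Qed.

Let L := `|T|.
Let L0 : 0 <= L := normr_ge0 T.
Let TL : `|T| <= L := lexx _.

Lemma real_bounded (V V1 : R -> R) : (forall x : R, is_derive x 1 V (V1 x)) ->
  exists2 c : R, 0 < c & forall x, `|x| <= L -> cnorm (V x)%:C <= c.
Proof.
move=> dV; apply: (@ccont_bounded _ (fun x => (V x)%:C)) => x.
exact: is_cderive_cont (is_cderive_real (dV x)).
Qed.

Let Lj nu j x := Lop q x (Phi nu x) j.

Let Phi_bounds : exists r c : R, [/\ 0 < r, 0 < c & forall nu, cnorm nu <= r ->
  forall x, `|x| <= L -> forall i j, cnorm (Phi nu x i j) <= c /\
    cnorm (Phi nu x i j - Phi 0 x i j) <= cnorm nu * c].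
Proof.
have [c c0 bc] := Phi_deriv_bounded Phi0 dPhi 0 L0 0.
have [d d0 bd] := Phi_deriv_lip Phi0 dPhi 0 L0 0.
exists (duhamel_radius Phi0 dPhi 0 L0), (c + d); split; [exact: duhamel_radius_gt0|exact: addr_gt0|].
move=> nu nr x xL i j; rewrite -[nu]subr0 in nr; split.
  by apply: le_trans (bc nu nr x xL i j) _; rewrite lerDl ltW.
have := bd nu nr x xL i j; rewrite !mxE subr0 => /le_trans; apply.
by rewrite ler_wpM2l ?cnorm_ge0 // lerDr ltW.
Qed.

(* With [L v = q v - v''], both [L v] and [U L v + U' v' - U'' v] have a derivative
   of the form [mu] times a bounded function. *)
Let row0 j : cbigO 1 (fun nu => Phi nu T o0 j - (1%:M : 'M[C]_3) o0 j) /\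
             cbigO 1 (fun nu => Phi nu T o2 j - (1%:M : 'M[C]_3) o2 j).
Proof.
have [r [c [r0 c0 bc]]] := Phi_bounds.
have [b b0 bb] := real_bounded dU.
have O1 : cbigO 1 (fun nu => Lj nu j T - Lj nu j 0).
  exists r, (2 * c * (L + 1)); split => //; first by rewrite !mulr_gt0 // ltr_wpDl.
  move=> nu nr.
  have bd y : `|y| <= L -> cnorm (nu * Phi nu y o0 j) <= cnorm nu * c.
    by move=> yL; rewrite cnormM ler_wpM2l ?cnorm_ge0 //; have [] := bc nu nr y yL o0 j.
  apply: le_trans (cderive_mean_bound (fun y => is_cderive_Lop dq dPhi nu y j) bd TL) _.
  have := mulr_ge0 (cnorm_ge0 nu) (ltW c0); have := L0; rewrite expr1; nra.
pose Q nu x := (U x)%:C * Lj nu j x + ((U1 x)%:C * Phi nu x o1 j - (U2 x)%:C * Phi nu x o0 j).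
have dQ nu x : is_cderive (Q nu) x (nu * ((U x)%:C * Phi nu x o0 j)).
  have [d0 d1 d2] := (is_solutionP q q1 nu (Phi nu)).1 (dPhi nu) x j.
  apply: is_cderive_eq.
    apply: is_cderiveD (is_cderiveM (is_cderive_real (dU x)) (is_cderive_Lop dq dPhi nu x j)) _.
    exact: is_cderiveB (is_cderiveM (is_cderive_real (dU1 x)) d1)
                       (is_cderiveM (is_cderive_real (dU2 x)) d0).
  by rewrite /Lj /Lop rmorphM /=; ring.
have O2 : cbigO 1 (fun nu => Q nu T - Q nu 0).
  exists r, (2 * (b * c) * (L + 1)); split => //; first by rewrite !mulr_gt0 // ltr_wpDl.
  move=> nu nr.
  have bd y : `|y| <= L -> cnorm (nu * ((U y)%:C * Phi nu y o0 j)) <= cnorm nu * (b * c).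
    move=> yL; rewrite cnormM ler_wpM2l ?cnorm_ge0 // cnormM.
    by rewrite ler_pM ?cnorm_ge0 ?bb //; have [] := bc nu nr y yL o0 j.
  apply: le_trans (cderive_mean_bound (dQ nu) bd TL) _.
  have := mulr_ge0 (cnorm_ge0 nu) (mulr_ge0 (ltW b0) (ltW c0)); have := L0; rewrite expr1; nra.
have UT0 : U T = U 0 by rewrite -[T in LHS]add0r UT.
have qT0 : q T = q 0 by rewrite -[T in LHS]add0r qT.
(* U' vanishes at 0 and at T, so there Q is U(0) L v - U''(0) v; removing the L v part by [O1]
   isolates v. *)
have O3 : cbigO 1 (fun nu => Phi nu T o0 j - (1%:M : 'M[C]_3) o0 j).
  apply: cbigO_ext (cbigOMl (- k^-1) (cbigOB O2 (cbigOMl (U 0)%:C O1))) => nu.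
  rewrite /Q /Lj U1T U10 U2T UT0 Phi0 -/k; field.
  exact: k0.
split => //.
apply: cbigO_ext (cbigOB (cbigOMl (q 0)%:C O3) O1) => nu.
by rewrite /Lj /Lop qT0 Phi0; ring.
Qed.

(* At [mu = 0] the middle column is [U' / U''(0)], hence periodic; correcting the two
   conserved quantities by their first order terms in [mu] gains one more order. *)
Let col1 : [/\ cbigO 1 (fun nu => Phi nu T o1 o1 - 1), cbigO 2 (fun nu => Phi nu T o0 o1)
  & cbigO 2 (fun nu => Phi nu T o2 o1)].
Proof.
have [r [c [r0 c0 bc]]] := Phi_bounds.
have [b b0 bb] := real_bounded dU1.
have qT0 : q T = q 0 by rewrite -[T in LHS]add0r qT.
have UT0 : U T = U 0 by rewrite -[T in LHS]add0r UT.
(* At mu = 0 the column starts with U' / k, so (L v)' = nu v makes nu (U - U(0)) / k the first order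
   part of L v. It vanishes at both ends of the period. *)
pose g nu x := Lj nu o1 x - nu * ((U x - U 0)%:C / k).
have dg nu x : is_cderive (g nu) x (nu * (Phi nu x o0 o1 - Phi 0 x o0 o1)).
  have dU' : is_derive x 1 (fun y => U y - U 0) (U1 x).
    by apply: (is_derive_eq (is_rderiveB (dU x) (is_derive_cst (U 0) x 1))); rewrite subr0.
  apply: is_cderive_eq.
    apply: is_cderiveB (is_cderive_Lop dq dPhi nu x o1) _.
    apply: is_cderiveM (is_cderive_cst nu x) _.
    exact: is_cderiveM (is_cderive_real dU') (is_cderive_cst k^-1 x).
  by have [-> _ _] := Phi_col1 x; ring.
have g0 nu : g nu 0 = 0.
  by rewrite /g /Lj /Lop Phi0 !mxE /= subrr rmorph0 mul0r !mulr0 !subr0.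
have bg nu x : cnorm nu <= r -> `|x| <= L -> cnorm (g nu x) <= 2 * (cnorm nu * (cnorm nu * c)) * L.
  move=> nr xL; rewrite -[g nu x]subr0 -(g0 nu).
  apply: cderive_mean_bound (dg nu) _ xL => y yL.
  by rewrite cnormM ler_wpM2l ?cnorm_ge0 //; have [] := bc nu nr y yL o0 o1.
have Og : cbigO 2 (fun nu => Lj nu o1 T).
  exists r, (2 * c * (L + 1)); split => //; first by rewrite !mulr_gt0 // ltr_wpDl.
  move=> nu nr; have := bg nu T nr TL; rewrite /g UT0 subrr rmorph0 mul0r mulr0 subr0.
  move=> /le_trans; apply.
  have := mulr_ge0 (cnorm_ge0 nu) (mulr_ge0 (cnorm_ge0 nu) (ltW c0)); have := L0; nra.
(* Since (U' v' - U'' v)' = - U' L v, the added square absorbs the first order part of L v and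
   leaves the derivative - U' g. *)
pose h nu x := ((U1 x)%:C * Phi nu x o1 o1 - (U2 x)%:C * Phi nu x o0 o1)
   + nu * (((U x - U 0) * (U x - U 0))%:C / (2 * k)).
have dh nu x : is_cderive (h nu) x (- ((U1 x)%:C * g nu x)).
  have dU' : is_derive x 1 (fun y => U y - U 0) (U1 x).
    by apply: (is_derive_eq (is_rderiveB (dU x) (is_derive_cst (U 0) x 1))); rewrite subr0.
  have [d0 d1 d2] := (is_solutionP q q1 nu (Phi nu)).1 (dPhi nu) x o1.
  apply: is_cderive_eq.
    apply: is_cderiveD (is_cderiveB (is_cderiveM (is_cderive_real (dU1 x)) d1)
                       (is_cderiveM (is_cderive_real (dU2 x)) d0)) _.
    apply: is_cderiveM (is_cderive_cst nu x) _.
    exact: is_cderiveM (is_cderive_real (is_rderiveM dU' dU')) (is_cderive_cst _ x).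
  rewrite /g /Lj /Lop /= !(rmorphD, rmorphN, rmorphM) /=; field.
  exact: k0.
have h0 nu : h nu 0 = 0.
  by rewrite /h subrr mulr0 rmorph0 mul0r mulr0 U10 Phi0 !mxE /= mulr0 rmorph0 mul0r subrr addr0.
have Oh : cbigO 2 (fun nu => h nu T).
  exists r, (2 * (b * (2 * c * (L + 1))) * (L + 1)); split => //.
    by rewrite !mulr_gt0 // ltr_wpDl.
  move=> nu nr; rewrite -[h nu T]subr0 -(h0 nu).
  have n0 := mulr_ge0 (cnorm_ge0 nu) (mulr_ge0 (cnorm_ge0 nu) (ltW c0)).
  have bd y : `|y| <= L -> cnorm (- ((U1 y)%:C * g nu y)) <= b * (2 * (cnorm nu * (cnorm nu * c)) * L).
    by move=> yL; rewrite cnormN cnormM ler_pM ?cnorm_ge0 ?bb ?bg.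
  apply: le_trans (cderive_mean_bound (dh nu) bd TL) _.
  have := mulr_ge0 (ltW b0) n0; have := L0; rewrite expr2; nra.
have hO01 : cbigO 2 (fun nu => Phi nu T o0 o1).
  apply: cbigO_ext (cbigOMl (- k^-1) Oh) => nu.
  rewrite /h UT0 subrr mulr0 rmorph0 mul0r mulr0 addr0 U1T U2T -/k rmorph0 mul0r; field.
  exact: k0.
split => //.
  exists r, c; split => // nu nr; have [_] := bc nu nr T TL o1 o1.
  have [_ -> _] := Phi_col1 T; rewrite U2T -/k divff //.
  by rewrite mulrC expr1.
apply: cbigO_ext (cbigOB (cbigOMl (q 0)%:C hO01) Og) => nu.
by rewrite /Lj /Lop qT0; ring.
Qed.

(** Solving det = 1 for the trace leaves only products. The entries (1,0) and (1,2), counted from 0,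
    need not be small, and they come multiplied by the off-diagonal entries of the middle column:
    hence the second order needed in [col1]. *)
Lemma tr_monodromy_bigO : cbigO 2 (fun nu => \tr (Phi nu T) - 3).
Proof.
have [r [c [r0 c0 bc]]] := Phi_bounds.
have OM i j : cbigO 0 (fun nu => Phi nu T i j).
  exists r, c; split => // nu nr; rewrite expr0 mulr1.
  by have [] := bc nu nr T TL i j.
have [hO11 hO01 hO21] := col1.
have [hO00 hO20] := row0 o0; have [hO02 hO22] := row0 o2.
have {}hO00 : cbigO 1 (fun nu => Phi nu T o0 o0 - 1).
  by apply: cbigO_ext hO00 => nu; rewrite !mxE.
have {}hO20 : cbigO 1 (fun nu => Phi nu T o2 o0).
  by apply: cbigO_ext hO20 => nu; rewrite !mxE /= subr0.
have {}hO02 : cbigO 1 (fun nu => Phi nu T o0 o2).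
  by apply: cbigO_ext hO02 => nu; rewrite !mxE /= subr0.
have {}hO22 : cbigO 1 (fun nu => Phi nu T o2 o2 - 1).
  by apply: cbigO_ext hO22 => nu; rewrite !mxE.
have X1 := cbigOM hO00 hO11; have X2 := cbigOM hO00 hO22; have X3 := cbigOM hO11 hO22.
have X4 := cbigOM X1 (cbigOW hO22).
have X5 := cbigOM (OM o0 o0) (cbigOM (OM o1 o2) hO21).
have X6 := cbigOM hO01 (cbigOB (cbigOM (OM o1 o0) (OM o2 o2)) (cbigOM (OM o1 o2) (OM o2 o0))).
have X7 := cbigOM (cbigOM (OM o0 o2) (OM o1 o0)) hO21.
have X8 := cbigOM hO02 (cbigOM (OM o1 o1) hO20).
rewrite ?addn0 ?add0n /= in X1 X2 X3 X4 X5 X6 X7 X8.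
apply: cbigO_ext (cbigOB (cbigOD (cbigOD (cbigOB (cbigOD X5 X6) X7) X8) (cbigON X4)) (cbigOD (cbigOD X1 X2) X3)) => nu.
have := det_Phi Phi0 dPhi nu T; rewrite det3 /mxtrace sum3 => D.
move: D; set m00 := Phi nu T o0 o0; set m11 := Phi nu T o1 o1; set m22 := Phi nu T o2 o2.
move=> /eqP; rewrite -subr_eq0 => /eqP D; rewrite -[RHS]subr0 -[in RHS]D; ring.
Qed.

(** The pairing degenerates at mu = 0. There the matrix is the identity except for its middle row,
    and both sides equal 3. *)
Lemma monodromy0 : \tr (Phi 0 T) = principal_minors (Phi 0 T).
Proof.
have [hO11 hO01 hO21] := col1.
have [/cbigO_at0 hO00 /cbigO_at0 hO20] := row0 o0; have [/cbigO_at0 hO02 /cbigO_at0 hO22] := row0 o2.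
move/cbigO_at0: hO11; move/cbigO_at0: hO01; move/cbigO_at0: hO21 => h21 h01 h11.
rewrite !mxE /= ?subr0 in hO00 hO20 hO02 hO22.
rewrite /principal_minors /mxtrace sum3 h01 h21 hO20 hO02 (subr0_eq hO00) (subr0_eq hO22) (subr0_eq h11).
ring.
Qed.

Lemma tr_monodromyN' mu : \tr (Phi (- mu) T) = principal_minors (Phi mu T).
Proof.
have [->|mu0] := eqVneq mu 0; first by rewrite oppr0 monodromy0.
exact: (tr_monodromyN dq Phi0 dPhi qT mu0).
Qed.

End Monodromy.

(** * Floquet theory *)

Section Eigenvalues.
Context {R : realType}.
Notation C := R[i].
Implicit Types (A : 'M[C]_3).

Lemma eigenvaluesE A : char_poly A = \prod_(z <- eigenvalues A) ('X - z%:P).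
Proof.
rewrite /eigenvalues; case: closed_field_poly_normal => r /= {1}->.
by rewrite (monicP (char_poly_monic A)) scale1r.
Qed.

Lemma eigenvalues3 A : exists l1 l2 l3, eigenvalues A = [:: l1; l2; l3] /\
  forall l, l ^+ 3 - \tr A * l ^+ 2 + principal_minors A * l - \det A
     = (l - l1) * (l - l2) * (l - l3).
Proof.
have := eigenvaluesE A; have := size_char_poly A.
case: (eigenvalues A) => [|l1 [|l2 [|l3 [|l4 r]]]] Hs E;
  rewrite E size_prod_XsubC in Hs => //.
exists l1, l2, l3; split => // l; rewrite -char_poly3 E !big_cons big_nil.
by rewrite mulr1 !hornerM !hornerXsubC mulrA.
Qed.

End Eigenvalues.

Section Floquet.
Context {R : realType}.
Notation C := R[i].

Lemma geometric_bound0 (rho B s : R) : 0 <= rho < 1 -> 0 <= s ->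
  (forall n, s <= rho ^+ n * B) -> s = 0.
Proof.
move=> /andP[r0 r1] s0 H; apply/eqP; rewrite eq_le s0 andbT.
have : (fun n => rho ^+ n * B) @ \oo --> 0 * B.
  by apply: cvgM; [apply: cvg_expr; rewrite ger0_norm | apply: cvg_cst].
rewrite mul0r => cv.
rewrite leNgt; apply/negP => sp.
have [N _ /(_ N (leqnn N)) h] := cvgr_lt _ cv _ sp.
by have := H N; rewrite leNgt h.
Qed.

Context (T : R).

Definition shift_sub (l : C) (phi : R -> C) x := phi (x + T) - l * phi x.

(** phi(x + T) = l phi(x) makes a nonzero value grow geometrically along multiples of T, forward if
    |l| > 1 and backward if |l| < 1. *)
Lemma shift_sub_inj l phi (B : R) : cnorm l != 1 -> (forall x, cnorm (phi x) <= B) ->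
  (forall x, shift_sub l phi x = 0) -> forall x, phi x = 0.
Proof.
move=> l1 bphi H x.
have E y : phi (y + T) = l * phi y by apply: subr0_eq; apply: H.
have En n y : phi (y + T *+ n) = l ^+ n * phi y.
  elim: n => [|n IH]; first by rewrite mulr0n addr0 expr0 mul1r.
  by rewrite mulrSr addrA E IH exprS mulrA.
apply/eqP; rewrite -cnorm_eq0; apply/eqP.
have [h|h|/eqP] := ltrgtP (cnorm l) 1; last by rewrite (negbTE l1).
  apply: (@geometric_bound0 (cnorm l) B); rewrite ?cnorm_ge0 ?h // => n.
  have := En n (x - T *+ n); rewrite subrK => ->.
  by rewrite cnormM cnormX ler_wpM2l ?exprn_ge0 ?cnorm_ge0.
have l0 : 0 < cnorm l by apply: lt_trans h.
apply: (@geometric_bound0 (cnorm l)^-1 B); rewrite ?cnorm_ge0 ?invr_ge0 ?cnorm_ge0 //.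
  by rewrite invf_lt1.
move=> n; rewrite exprVn mulrC ler_pdivlMr ?exprn_gt0 // mulrC -cnormX -cnormM -En.
exact: bphi.
Qed.

Lemma shift_sub_bounded l phi (B : R) : (forall x, cnorm (phi x) <= B) ->
  exists B', forall x, cnorm (shift_sub l phi x) <= B'.
Proof.
move=> bphi; exists (B + cnorm l * B) => x.
apply: le_trans (ler_cnormD _ _) _; rewrite cnormN cnormM.
by rewrite lerD ?ler_wpM2l ?cnorm_ge0.
Qed.

Lemma bounded_annihilated (r : seq C) phi (B : R) : (forall x, cnorm (phi x) <= B) ->
  (forall x, foldr shift_sub phi r x = 0) -> (exists x, phi x != 0) ->
  has (fun l => cnorm l == 1) r.
Proof.
move=> bphi H [x0 nz].
have bf s : exists B', forall x, cnorm (foldr shift_sub phi s x) <= B'.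
  elim: s => [|l s [B' IH]]; first by exists B.
  exact: shift_sub_bounded IH.
elim: r H => [|l r IH] /= H; first by rewrite (H x0) eqxx in nz.
have [//|l1] := eqVneq (cnorm l) 1.
have [B' bB'] := bf r.
exact: IH (shift_sub_inj l1 bB' H).
Qed.

Lemma periodic_bounded (g : R -> R) : T != 0 -> (forall x, g (x + T) = g x) ->
  (exists c, forall x, `|x| <= `|T| -> g x <= c) -> exists c, forall x, g x <= c.
Proof.
move=> T0 gT [c bc]; exists c => x.
have gn n y : g (y + T *+ n) = g y.
  by elim: n => [|n IH]; rewrite ?mulr0n ?addr0 // mulrSr addrA gT.
have gz (n : int) y : g (y + T *~ n) = g y.
  case: n => n; first exact: gn.
  by rewrite NegzE mulrNz -pmulrn -[LHS](gn n.+1) subrK.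
pose n := Num.floor (x / T).
rewrite -(subrK (T *~ n) x) gz; apply: bc.
have -> : x - T *~ n = T * (x / T - n%:~R).
  by rewrite mulrBr mulrCA divff // mulr1 mulrzr.
rewrite normrM ler_piMr //.
have := floor_itv (x / T); rewrite -/n intrD ler_norml; lra.
Qed.

End Floquet.

(** * Bounded solutions and unit eigenvalues *)

Section Spectrum.
Context {R : realType}.
Notation C := R[i].
Context (q q1 : R -> R) (Phi : C -> R -> 'M[C]_3).
Hypothesis Phi0 : forall mu, Phi mu 0 = 1%:M.
Hypothesis dPhi : forall mu, is_solution q q1 mu (Phi mu).
Context (T : R).
Hypothesis qT : forall x, q (x + T) = q x.
Hypothesis q1T : forall x, q1 (x + T) = q1 x.

Definition bounded_solution mu (v : R -> 'M[C]_(3, 1)) :=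
  [/\ is_solution q q1 mu v, exists x, v x o0 0 != 0 &
     exists B : R, forall x, cnorm (v x o0 0) <= B].

(* Let S be the shift by [T]. By Cayley-Hamilton the product of S - l over the eigenvalues
   l annihilates a solution, and S - l is injective on bounded functions if |l| <> 1. *)
Lemma bounded_solution_eigenvalue mu v : bounded_solution mu v ->
  has (fun l => cnorm l == 1) (eigenvalues (Phi mu T)).
Proof.
move=> [dv nz [B bB]]; set M := Phi mu T.
apply: (@bounded_annihilated _ T _ (fun x => v x o0 0) B) => //.
have H r x : foldr (shift_sub T) (fun x => v x o0 0) r x =
    (Phi mu x *m horner_mx M (\prod_(z <- r) ('X - z%:P)) *m v 0) o0 0.
  elim: r x => [|l r IH] x /=.
    by rewrite big_nil rmorph1 mulmx1 -(solution_unique Phi0 dPhi dv).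
  rewrite /shift_sub !IH big_cons rmorphM rmorphB /= horner_mx_X horner_mx_C.
  rewrite (Phi_shift Phi0 dPhi qT q1T) -/M -[M - _]/(M - l%:M).
  set P := horner_mx M _.
  have -> : (M - l%:M) * P = M *m P - l *: P by rewrite -mul_scalar_mx -mulmxBl.
  have mxB (A A' : 'M[C]_(3, 1)) : (A - l *: A') o0 0 = A o0 0 - l * A' o0 0 by rewrite !mxE.
  by rewrite mulmxBr mulmxBl -scalemxAr -scalemxAl !mulmxA mxB.
by move=> x; rewrite H -eigenvaluesE Cayley_Hamilton mulmx0 mul0mx mxE.
Qed.

Lemma eigenvalue_bounded_solution mu l : T != 0 -> cnorm l = 1 ->
  l \in eigenvalues (Phi mu T) -> exists v, bounded_solution mu v.
Proof.
move=> T0 l1 lM; set M := Phi mu T in lM.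
(* [det0P] provides a left kernel vector; the transpose makes it a right eigenvector of M. *)
have : \det (l%:M - M)^T == 0.
  have : root (char_poly M) l by rewrite eigenvaluesE root_prod_XsubC.
  rewrite det_tr /root char_poly3 => /eqP E; apply/eqP; rewrite -[RHS]E.
  rewrite (det3 (l%:M - M)) (det3 M) !mxE /= /principal_minors /mxtrace sum3; ring.
move=> /det0P[w' w0 Hw].
pose w := w'^T.
have Mw : M *m w = l *: w.
  have := congr1 trmx Hw; rewrite trmx_mul trmxK trmx0 mulmxBl mul_scalar_mx -/w.
  by move=> /subr0_eq.
pose v x := Phi mu x *m w.
have dv : is_solution q q1 mu v.
  move=> x; apply: is_mderive_eq (is_mderiveM (dPhi mu x) (is_mderive_cst w x)) _.
  by rewrite mulmx0 addr0 mulmxA.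
have vT x : v (x + T) = l *: v x.
  by rewrite /v (Phi_shift Phi0 dPhi qT q1T) -mulmxA Mw -scalemxAr.
exists v; split => //.
(* If the first component vanished identically, so would its derivatives, which are the other
   components, and then the eigenvector itself. *)
- apply: contrapT => H.
  have v0 x : v x o0 0 = 0 by apply/eqP/negPn/negP => nz; apply: H; exists x.
  have zero (g g' : R -> C) : (forall x, is_cderive g x (g' x)) -> (forall x, g x = 0) -> forall x, g' x = 0.
    move=> dg g0 x; apply: (is_cderive_unique (dg x)).
    by apply: is_cderive_ext (is_cderive_cst 0 x) => y; rewrite g0.
  have dv' x := (is_solutionP q q1 mu v).1 dv x 0.
  have v1 : forall x, v x o1 0 = 0.
    by apply: (zero (fun x => v x o0 0)) => // x; have [] := dv' x.
  have v2 : forall x, v x o2 0 = 0.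
    by apply: (zero (fun x => v x o1 0)) => // x; have [] := dv' x.
  have w00 : w = 0.
    rewrite -[w]mul1mx -(Phi0 mu) -/(v 0); apply/matrixP => i j; rewrite ord1 [RHS]mxE.
    by move: i; apply: forall3.
  by rewrite -[w']trmxK -/w w00 trmx0 eqxx in w0.
- apply: (@periodic_bounded _ T (fun x => cnorm (v x o0 0))) => //.
    by move=> x; rewrite vT mxE cnormM l1 mul1r.
  have [c _ bc] := @ccont_bounded _ (fun x => v x o0 0) `|T| (fun x => is_cderive_cont (dv x o0 0)).
  by exists c.
Qed.

Lemma bounded_solutionP mu : T != 0 ->
  (exists v, bounded_solution mu v) <-> has (fun l => cnorm l == 1) (eigenvalues (Phi mu T)).
Proof.
move=> T0; split=> [[v]|/hasP[l lM /eqP l1]]; first exact: bounded_solution_eigenvalue.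
exact: eigenvalue_bounded_solution l1 lM.
Qed.

End Spectrum.

(** * The periodic wave *)

Lemma horner_expand (K : comNzRingType) (w z : nat -> K) (x : K) :
  (forall j, w j = z j + x * w j.+1) ->
  w 0%N = z 0%N + x * z 1%N + x ^+ 2 * z 2%N + x ^+ 3 * z 3%N + x ^+ 4 * w 4%N.
Proof. by move=> H; rewrite (H 0%N) (H 1%N) (H 2%N) (H 3%N); ring. Qed.

Lemma cubic_taylor (K : numFieldType) (z0 z1 z2 z3 A B x w t : K) :
  z0 = 3 -> z1 = 0 -> A = 2`!%:R * z2 -> B = 3`!%:R * z3 ->
  t = z0 + x * z1 + x ^+ 2 * z2 + x ^+ 3 * z3 + x ^+ 4 * w ->
  t = 3 + A / 2 * x ^+ 2 + B / 6 * x ^+ 3 + x ^+ 4 * w.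
Proof. by move=> -> -> -> -> ->; rewrite (_ : 3`! = 6)%N // (_ : 2`! = 2)%N //; field. Qed.

Section Wave.
Context {R : realType}.
Notation C := R[i].
Context (f F : R -> R) (a E c : R) (um : R) (T : R) (u : R -> R) (M : C -> 'M[C]_3).
Hypothesis f_C2 : class_C2 f.
Hypothesis F_f : forall x : R, is_derive x 1 F (f x).
Hypothesis um_simple : derive1 (potential F a c) um != 0.
Hypothesis u_profile : wave_profile f F a E c um T u.
Hypothesis M_monodromy : monodromy_matrix f c u T M.

Let q x := - derive1 f (u x) + c.
Let q1 x := - (derive1 u x * derive1n 2 f (u x)).

Let du x : is_derive (x : R) 1 u (derive1 u x).
Proof. by rewrite derive1E; apply: derivableP; exact: (profile_derivable u_profile). Qed.

Let du1 x : is_derive (x : R) 1 (derive1 u) (derive1n 2 u x).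
Proof. by rewrite /= derive1E; apply: derivableP; exact: (profile_derivable2 u_profile). Qed.

Let df v : is_derive (v : R) 1 f (derive1 f v).
Proof. by rewrite derive1E; apply: derivableP; case: f_C2. Qed.

Let df1 v : is_derive (v : R) 1 (derive1 f) (derive1n 2 f v).
Proof. by rewrite /= derive1E; apply: derivableP; case: f_C2. Qed.

Let dfu x : is_derive (x : R) 1 (fun y => derive1 f (u y)) (derive1n 2 f (u x) * derive1 u x).
Proof. exact: (@is_derive1_comp _ (derive1 f) u x). Qed.

Let dq x : is_derive (x : R) 1 q (q1 x).
Proof.
apply: (is_derive_eq (is_rderiveD (is_rderiveN (dfu x)) (is_derive_cst c x 1))).
by rewrite addr0 /q1 mulrC.
Qed.

(** The profile equation expresses u'' through u, which supplies a third derivative and shows that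
    u' lies in the kernel of the linearization. *)
Let du2 x : is_derive (x : R) 1 (derive1n 2 u) (q x * derive1 u x).
Proof.
have -> : derive1n 2 u = fun x => (a - f (u x)) + c * u x.
  by apply/funext => y; have := profile_ode u_profile y; lra.
have dfx : is_derive (x : R) 1 (fun y => f (u y)) (derive1 f (u x) * derive1 u x).
  exact: (@is_derive1_comp _ f u x).
apply: (is_derive_eq (is_rderiveD (is_rderiveB (is_derive_cst a x 1) dfx)
  (is_rderiveM (is_derive_cst c x 1) (du x)))).
by rewrite /q /=; ring.
Qed.

Let uT x : u (x + T) = u x := profile_periodic u_profile x.

Let qT x : q (x + T) = q x. Proof. by rewrite /q uT. Qed.

Let q1T x : q1 (x + T) = q1 x.
Proof. by rewrite /q1 uT (is_derive_periodic du uT). Qed.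

(** u''(0) = - V'(u_-), nonzero because the turning point is a simple root. *)
Let u20 : derive1n 2 u 0 != 0.
Proof.
have dV : is_derive um 1 (potential F a c) (f um - c * um - a).
  have d2 : is_derive um 1 (fun v : R => c / 2 * v ^+ 2) (c * um).
    apply: (is_derive_eq (is_rderiveM (is_derive_cst (c / 2) um 1)
      (is_rderiveM (is_derive_id um 1) (is_derive_id um 1)))).
    by rewrite /=; lra.
  have d1 : is_derive um 1 (fun v : R => a * v) a.
    apply: (is_derive_eq (is_rderiveM (is_derive_cst a um 1) (is_derive_id um 1))).
    by rewrite /= mul0r add0r mulr1.
  exact: (is_rderiveB (is_rderiveB (F_f um) d2) d1).
apply: contra um_simple => /eqP u0.
rewrite derive1E (@derive_val _ _ _ _ _ _ _ dV); apply/eqP.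
have := profile_ode u_profile 0; rewrite u0 (profile_init u_profile); lra.
Qed.

Let PhiP := choice (fun mu => let: ex_intro2 Phi h1 h2 := M_monodromy mu in
  ex_intro (fun Phi => fundamental_matrix (system_matrix f c u mu) Phi /\ M mu = Phi T)
     Phi (conj h1 h2)).
Let Phi := projT1 PhiP.

Let Phi0 mu : Phi mu 0 = 1%:M.
Proof. by have [[]] := projT2 PhiP mu. Qed.

Let MPhi mu : M mu = Phi mu T.
Proof. by have [] := projT2 PhiP mu. Qed.

Lemma system_matrixE mu x : system_matrix f c u mu x = companion_matrix q q1 mu x.
Proof.
apply/matrixP; apply: forall3; apply: forall3; rewrite !mxE //=.
by rewrite /q1 rmorphN /= addrC.
Qed.

Let dPhi mu : is_solution q q1 mu (Phi mu).
Proof.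
move=> x; rewrite -system_matrixE => i j.
by have [[_ +] _] := projT2 PhiP mu; apply.
Qed.

Lemma spectral_solutionP mu psi : spectral_solution f c u mu psi <->
  exists2 v : R -> 'M[C]_(3, 1), is_solution q q1 mu v & forall x, v x o0 0 = psi x.
Proof.
have dL (p0 p1 p2 p3 : R -> C) x : is_cderive p0 x (p1 x) -> is_cderive p2 x (p3 x) ->
   is_cderive (fun x => - p2 x - (derive1 f (u x))%:C * p0 x + c%:C * p0 x) x
     (- p3 x + (q1 x)%:C * p0 x + (q x)%:C * p1 x).
  move=> d0 d2; apply: is_cderive_eq.
    apply: is_cderiveD (is_cderiveB (is_cderiveN d2) (is_cderiveM (is_cderive_real (dfu x)) d0))
      (is_cderiveM (is_cderive_cst c%:C x) d0).
  rewrite /q /q1 !(rmorphD, rmorphN, rmorphM) /=; ring.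
split.
  move=> [d0 d1 d2 H].
  have D0 x : is_cderive psi x (cderive psi x) by split.
  have D1 x : is_cderive (cderive psi) x (cderive (cderive psi) x) by split.
  have D2 x : is_cderive (cderive (cderive psi)) x (cderive (cderive (cderive psi)) x) by split.
  pose v x : 'M[C]_(3, 1) :=
    \matrix_(i < 3, j < 1) [:: psi x; cderive psi x; cderive (cderive psi) x]`_i.
  have v0 x : psi x = v x o0 0 by rewrite mxE.
  have v1 x : cderive psi x = v x o1 0 by rewrite mxE.
  have v2 x : cderive (cderive psi) x = v x o2 0 by rewrite mxE.
  clearbody v; exists v => //; apply/is_solutionP => x j; rewrite ord1; split.
  - by rewrite -v1; apply: is_cderive_ext (D0 x).
  - by rewrite -v2; apply: is_cderive_ext (D1 x).
  - apply: is_cderive_eq (is_cderive_ext v2 (D2 x)) _.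
    have [_] := dL _ _ _ _ x (D0 x) (D2 x); rewrite -/(linop f c u psi) H -v0 -v1 => E'.
    rewrite mulrBl E'; ring.
move=> [v dv vpsi].
have dv' x := (is_solutionP q q1 mu v).1 dv x 0.
have -> : psi = fun x => v x o0 0 by apply/funext.
have E1 : cderive (fun x => v x o0 0) = fun x => v x o1 0.
  by apply/funext => x; have [[_ ->] _ _] := dv' x.
have E2 : cderive (fun x => v x o1 0) = fun x => v x o2 0.
  by apply/funext => x; have [_ [_ ->] _] := dv' x.
split; rewrite ?E1 ?E2.
- by move=> x; have [[]] := dv' x.
- by move=> x; have [_ []] := dv' x.
- by move=> x; have [_ _ []] := dv' x.
move=> x; rewrite /linop E1 E2; have [d0 d1 d2] := dv' x.
have [_ ->] := dL _ (fun x => v x o1 0) _ (fun x => ((q1 x)%:C - mu) * v x o0 0 + (q x)%:C * v x o1 0) x d0 d2.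
ring.
Qed.

(** For T = 0 the matrix M would be constantly 1. This gives a nonzero period without evaluating the
    period integral. *)
Lemma trace_deriv_neq0_T : \tr (derive1n 3 M 0) != 0 -> T != 0.
Proof.
apply: contra => /eqP T0.
have -> : M = fun mu => Phi mu T by apply/funext.
rewrite (derive1n_Phi Phi0 dPhi) T0.
by have [-> _] := Phi_derivP Phi0 dPhi 0 2; rewrite scaler0 linear0.
Qed.

Lemma spec_eigenvalues mu : T != 0 ->
  spec f c u mu <-> has (fun l => cnorm l == 1) (eigenvalues (M mu)).
Proof.
move=> T0; rewrite MPhi -(bounded_solutionP Phi0 dPhi qT q1T) //; split.
  move=> [psi [/spectral_solutionP[v dv vpsi] [x nz] [B bB]]].
  exists v; split => //; first by exists x; rewrite vpsi.
  by exists B => y; rewrite vpsi -lecR -cnormE.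
move=> [v [dv [x nz] [B bB]]]; exists (fun x => v x o0 0); split.
- by apply/spectral_solutionP; exists v.
- by exists x.
- by exists B => y; rewrite cnormE lecR.
Qed.

Lemma eigenvalues_monodromy mu : exists l1 l2 l3, eigenvalues (M mu) = [:: l1; l2; l3] /\
  forall l, l ^+ 3 - \tr (M mu) * l ^+ 2 + \tr (M (- mu)) * l - 1
     = (l - l1) * (l - l2) * (l - l3).
Proof.
have [l1 [l2 [l3 [-> H]]]] := eigenvalues3 (M mu).
exists l1, l2, l3; split => // l; rewrite -H !MPhi (det_Phi Phi0 dPhi).
by rewrite (tr_monodromyN' dq Phi0 dPhi qT du du1 du2 uT (profile_init' u_profile) u20).
Qed.

Lemma tr_monodromy_conj mu : \tr (M (conjc mu)) = conjc (\tr (M mu)).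
Proof. by rewrite !MPhi (Phi_conj Phi0 dPhi) /mxtrace !sum3 !mxE !conjcD. Qed.

(** [s] is the trace of the fourth remainder [Phi_rem]. The coefficients of orders 0 and 1 are read
    off from tr M - 3 = O(mu^2). *)
Lemma tr_monodromy_taylor : exists (s : C -> C) (r k : R), [/\ 0 < r, 0 < k,
  forall mu, \tr (M mu) = 3 + \tr (derive1n 2 M 0) / 2 * mu ^+ 2
      + \tr (derive1n 3 M 0) / 6 * mu ^+ 3 + mu ^+ 4 * s mu &
  forall mu mu', cnorm mu <= r -> cnorm mu' <= r ->
    cnorm (s mu) <= k /\ cnorm (s mu - s mu') <= cnorm (mu - mu') * k].
Proof.
have [r [k [r0 k0 H]]] := Phi_rem_lip Phi0 dPhi (normr_ge0 T) 4.
have [z [w [X O2 dz wR]]] : exists (z : nat -> C) (w : C -> C), [/\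
    forall mu, \tr (M mu) = z 0%N + mu * z 1%N + mu ^+ 2 * z 2%N + mu ^+ 3 * z 3%N + mu ^+ 4 * w mu,
    cbigO 2 (fun mu => \tr (M mu) - 3),
    forall k, \tr (derive1n k M 0) = k`!%:R * z k &
    forall mu mu', cnorm mu <= r -> cnorm mu' <= r ->
      cnorm (w mu) <= 3 * k /\ cnorm (w mu - w mu') <= cnorm (mu - mu') * (3 * k)].
  exists (fun j => \tr (Phi_deriv q q1 Phi 0 j T)), (fun mu => \tr (Phi_rem q q1 Phi mu 4 T)).
  split.
  - move=> nu; rewrite MPhi -[Phi nu T]/(Phi_rem q q1 Phi nu 0 T).
    have Hj j : \tr (Phi_rem q q1 Phi nu j T) =
        \tr (Phi_deriv q q1 Phi 0 j T) + nu * \tr (Phi_rem q q1 Phi nu j.+1 T).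
      by rewrite (Phi_remE Phi0 dPhi) linearD linearZ.
    exact: (@horner_expand _ (fun j => \tr (Phi_rem q q1 Phi nu j T))
      (fun j => \tr (Phi_deriv q q1 Phi 0 j T)) nu Hj).
  - apply: cbigO_ext
      (tr_monodromy_bigO dq Phi0 dPhi qT du du1 du2 uT (profile_init' u_profile) u20) => nu.
    by rewrite MPhi.
  - move=> j; have -> : M = fun mu => Phi mu T by apply/funext.
    by rewrite (derive1n_Phi Phi0 dPhi) linearZ.
  move=> mu mu' h h'; have [b1 b2] := H mu mu' h h'.
  have tr3 (A : 'M[C]_3) b : (forall i, cnorm (A i i) <= b) -> cnorm (\tr A) <= 3 * b.
    move=> hA; rewrite /mxtrace sum3; apply: le_trans (ler_cnormD _ _) _.
    have := ler_cnormD (A o0 o0) (A o1 o1); have := (hA o0, hA o1, hA o2) => -[[]]; lra.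
  split; first by apply: tr3 => i; apply: b1.
  rewrite -linearB mulrCA; apply: tr3 => i; exact: (b2 T (lexx _) i i).
exists w, r, (3 * k); split => //; first exact: mulr_gt0.
move=> mu.
have z0 : z 0%N = 3.
  have := cbigO_at0 O2; rewrite (X 0) => Z0.
  rewrite (_ : z 0%N = z 0%N + 0 * z 1%N + 0 ^+ 2 * z 2%N + 0 ^+ 3 * z 3%N + 0 ^+ 4 * w 0); last by ring.
  exact: subr0_eq.
have z1 : z 1%N = 0.
  apply: (@cbigO_coef _ 1).
  have Os : cbigO 0 (fun mu => z 2%N + mu * z 3%N + mu ^+ 2 * w mu).
    have Oid : cbigO 1 (fun mu : C => mu) by apply: cbigO_ext (cbigO_Xn 1) => nu; rewrite expr1.
    have OR : cbigO 0 w.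
      exists r, (3 * k); split => //; first exact: mulr_gt0.
      by move=> nu nr; rewrite expr0 mulr1; have [] := wR nu nu nr nr.
    have := cbigOD (cbigOD (cbigO_cst (z 2%N)) (cbigOW (cbigOM Oid (cbigO_cst (z 3%N)))))
      (cbigOW (cbigOW (cbigOM (cbigOM Oid Oid) OR))).
    by apply: cbigO_ext => nu; rewrite expr2.
  by apply: cbigO_ext (cbigOB O2 (cbigOM (cbigO_Xn 2) Os)) => nu; rewrite X z0; ring.
exact: (cubic_taylor z0 z1 (dz 2%N) (dz 3%N) (X mu)).
Qed.

End Wave.

(** * Self-inversive cubics and the discriminant *)

Section SelfInversive.
Context {R : realType}.
Notation C := R[i].

(** Discriminant of l^3 - e1 l^2 + e2 l - 1; [vdm3] is a square root of it. *)
Definition disc3 (e1 e2 : C) :=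
  e1 ^+ 2 * e2 ^+ 2 - 4 * e2 ^+ 3 - 4 * e1 ^+ 3 + 18 * e1 * e2 - 27.

Definition vdm3 (l1 l2 l3 : C) := (l1 - l2) * (l2 - l3) * (l3 - l1).

Lemma vieta3 (e1 e2 e3 l1 l2 l3 : C) :
  (forall l, l ^+ 3 - e1 * l ^+ 2 + e2 * l - e3 = (l - l1) * (l - l2) * (l - l3)) ->
  [/\ e1 = l1 + l2 + l3, e2 = l1 * l2 + l1 * l3 + l2 * l3 & e3 = l1 * l2 * l3].
Proof.
move=> H; have H0 := H 0; have H1 := H 1; have HN := H (-1).
have E3 : e3 = l1 * l2 * l3.
  have -> : e3 = - (0 ^+ 3 - e1 * 0 ^+ 2 + e2 * 0 - e3) by ring.
  by rewrite H0; ring.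
have E1 : e1 = l1 + l2 + l3.
  have -> : e1 = - (((1 ^+ 3 - e1 * 1 ^+ 2 + e2 * 1 - e3) +
     ((-1) ^+ 3 - e1 * (-1) ^+ 2 + e2 * -1 - e3)) / 2) - e3 by field.
  by rewrite H1 HN E3; field.
split => //.
have -> : e2 = (1 ^+ 3 - e1 * 1 ^+ 2 + e2 * 1 - e3) - 1 + e1 + e3 by ring.
by rewrite H1 E3 E1; ring.
Qed.

Lemma vdm3_sqrE (l1 l2 l3 e1 e2 e3 : C) :
  e1 = l1 + l2 + l3 -> e2 = l1 * l2 + l1 * l3 + l2 * l3 -> e3 = l1 * l2 * l3 ->
  vdm3 l1 l2 l3 ^+ 2 = e1 ^+ 2 * e2 ^+ 2 - 4 * e2 ^+ 3 - 4 * e1 ^+ 3 * e3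
    + 18 * e1 * e2 * e3 - 27 * e3 ^+ 2.
Proof. by move=> -> -> ->; rewrite /vdm3; ring. Qed.

Lemma vdm3_sqr (l1 l2 l3 : C) : l1 * l2 * l3 = 1 ->
  vdm3 l1 l2 l3 ^+ 2 = disc3 (l1 + l2 + l3) (l1 * l2 + l1 * l3 + l2 * l3).
Proof. by move=> h; rewrite (vdm3_sqrE erefl erefl (esym h)) /disc3; ring. Qed.

Lemma cnorm1_conj (l : C) : (cnorm l == 1) = (l * conjc l == 1).
Proof.
have -> : l * conjc l = (cnorm l ^+ 2)%:C by rewrite -sqr_normc cnormE rmorphXn.
by rewrite -[1 in RHS](rmorph1 (real_complex R)) (inj_eq (@complexI R)) sqrp_eq1 ?cnorm_ge0.
Qed.

Lemma conj_fixed_sqr_Re (V : C) : conjc V = V -> 0 <= complex.Re (V ^+ 2).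
Proof.
move=> /(congr1 (@complex.Im R)); rewrite expr2 cReM; case: V => a b /= hb.
have -> : b = 0 by lra.
by rewrite mulr0 subr0 -expr2 sqr_ge0.
Qed.

Lemma conj_antifixed_sqr_Re (V : C) : conjc V = - V -> complex.Re (V ^+ 2) <= 0.
Proof.
move=> /(congr1 (@complex.Re R)); rewrite expr2 cReM; case: V => a b /= ha.
have -> : a = 0 by lra.
by rewrite mulr0 sub0r oppr_le0 -expr2 sqr_ge0.
Qed.

(** On the circle conjugation is inversion. With product 1 this maps [vdm3] to its opposite, so
    [vdm3] is purely imaginary. *)
Lemma unit_triple (l1 l2 l3 : C) : cnorm l1 = 1 -> cnorm l2 = 1 -> cnorm l3 = 1 ->
  l1 * l2 * l3 = 1 -> complex.Re (vdm3 l1 l2 l3 ^+ 2) <= 0.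
Proof.
move=> /eqP h1 /eqP h2 /eqP h3 h.
move: h1 h2 h3; rewrite !cnorm1_conj => /eqP h1 /eqP h2 /eqP h3.
apply: conj_antifixed_sqr_Re.
have c1 : conjc l1 = l2 * l3 by rewrite -[conjc l1]mul1r -h -[RHS]mul1r -h1; ring.
have c2 : conjc l2 = l1 * l3 by rewrite -[conjc l2]mul1r -h -[RHS]mul1r -h2; ring.
have c3 : conjc l3 = l1 * l2 by rewrite -[conjc l3]mul1r -h -[RHS]mul1r -h3; ring.
rewrite /vdm3 !conjcM !conjcD !conjcN c1 c2 c3.
transitivity (- ((l1 - l2) * (l2 - l3) * (l3 - l1)) * (l1 * l2 * l3)); first by ring.
by rewrite h mulr1.
Qed.

(** Reflection in the circle exchanges l1 and l2. The exchange adds one more sign to the previous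
    computation, so [vdm3] is real. *)
Lemma pair_triple (l1 l2 l3 : C) : l2 * conjc l1 = 1 -> l1 * l2 * l3 = 1 ->
  0 <= complex.Re (vdm3 l1 l2 l3 ^+ 2) /\ cnorm l3 = 1.
Proof.
move=> h12 h.
have h21 : l1 * conjc l2 = 1.
  by have := congr1 conjc h12; rewrite conjcM conjcK conjc1 mulrC.
have h3 : l3 * conjc l3 = 1.
  have := congr1 conjc h; rewrite !conjcM conjc1 => h'.
  transitivity ((l3 * conjc l3) * ((l2 * conjc l1) * (l1 * conjc l2))).
    by rewrite h12 h21 !mulr1.
  transitivity ((l1 * l2 * l3) * (conjc l1 * conjc l2 * conjc l3)); first by ring.
  by rewrite h h' mulr1.
split; last by apply/eqP; rewrite cnorm1_conj h3.
apply: conj_fixed_sqr_Re.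
have c1 : conjc l1 = l1 * l3 by rewrite -[conjc l1]mul1r -h -[RHS]mul1r -h12; ring.
have c2 : conjc l2 = l2 * l3 by rewrite -[conjc l2]mul1r -h -[RHS]mul1r -h21; ring.
have c3 : conjc l3 = l1 * l2 by rewrite -[conjc l3]mul1r -h -[RHS]mul1r -h3; ring.
rewrite /vdm3 !conjcM !conjcD !conjcN c1 c2 c3.
transitivity (((l1 - l2) * (l2 - l3) * (l3 - l1)) * (l1 * l2 * l3)); first by ring.
by rewrite h mulr1.
Qed.

(** Reflection in the circle maps roots to roots, so a root off the circle has a partner and the
    third root is on it. The weak inequalities let both alternatives cover multiple roots; a strict
    sign then decides. *)
Lemma self_inversive_roots (e l1 l2 l3 : C) :
  (forall l, l ^+ 3 - e * l ^+ 2 + conjc e * l - 1 = (l - l1) * (l - l2) * (l - l3)) ->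
  (count (fun l => cnorm l == 1) [:: l1; l2; l3] = 3%N /\
     complex.Re (disc3 e (conjc e)) <= 0) \/
  (count (fun l => cnorm l == 1) [:: l1; l2; l3] = 1%N /\
     0 <= complex.Re (disc3 e (conjc e))).
Proof.
move=> H; have [E1 E2 E3] := vieta3 H; rewrite E2 E1.
have P := esym E3; rewrite -vdm3_sqr //.
have refl (l : C) : l ^+ 3 - e * l ^+ 2 + conjc e * l - 1 = 0 -> l != 0 ->
    exists2 m, m * conjc l = 1 & m = l1 \/ m = l2 \/ m = l3.
  move=> h l0; have cl0 : conjc l != 0 by rewrite conjc_eq0.
  exists (conjc l)^-1; first by rewrite mulVf.
  have := congr1 conjc h; rewrite !(conjcD, conjcN, conjcM, conjcX) conjcK conjc1 conjc0 => h'.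
  have : ((conjc l)^-1 - l1) * ((conjc l)^-1 - l2) * ((conjc l)^-1 - l3) = 0.
    rewrite -H.
    transitivity (- (conjc l ^+ 3 - conjc e * conjc l ^+ 2 + e * conjc l - 1) * (conjc l)^-1 ^+ 3).
      by field; exact: cl0.
    by rewrite h' oppr0 mul0r.
  by move=> /eqP; rewrite !mulf_eq0 !subr_eq0 => /orP[/orP[]|] /eqP ->; auto.
have r1 : l1 ^+ 3 - e * l1 ^+ 2 + conjc e * l1 - 1 = 0 by rewrite H subrr !mul0r.
have r2 : l2 ^+ 3 - e * l2 ^+ 2 + conjc e * l2 - 1 = 0 by rewrite H subrr mulr0 !mul0r.
have r3 : l3 ^+ 3 - e * l3 ^+ 2 + conjc e * l3 - 1 = 0 by rewrite H subrr mulr0.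
have nz (x y z : C) : x * y * z = 1 -> [/\ x != 0, y != 0 & z != 0].
  move=> h; have : x * y * z != 0 by rewrite h oner_neq0.
  by rewrite !mulf_eq0 !negb_or => /andP[/andP[]].
have [n1 n2 n3] := nz _ _ _ P.
have nu (l m : C) : m * conjc l = 1 -> (cnorm l == 1) = (m == l) .
  move=> h; rewrite cnorm1_conj; have [ml|ml] := eqVneq m l; first by rewrite -{1}ml h eqxx.
  apply/negbTE; apply: contra ml => /eqP h'.
  have l0 : conjc l != 0.
    by apply/negP => /eqP c0; move: h; rewrite c0 mulr0 => /eqP; rewrite eq_sym oner_eq0.
  by apply/eqP/(mulIf l0); rewrite h h'.
have notunit (l m : C) : m * conjc l = 1 -> cnorm l != 1 -> cnorm m != 1.
  move=> h; have h' : l * conjc m = 1.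
    by have := congr1 conjc h; rewrite conjcM conjcK conjc1 mulrC.
  by rewrite (nu _ _ h) (nu _ _ h') eq_sym.
(* The square of [vdm3] is symmetric, so the roots may be relabelled. *)
have symV (x y z x' y' z' : C) : vdm3 x y z ^+ 2 = vdm3 x' y' z' ^+ 2 ->
   0 <= complex.Re (vdm3 x y z ^+ 2) -> 0 <= complex.Re (vdm3 x' y' z' ^+ 2) by move=> ->.
have main (x y z : C) : y * conjc x = 1 -> x * y * z = 1 -> cnorm x != 1 ->
    [/\ 0 <= complex.Re (vdm3 x y z ^+ 2), cnorm x != 1, cnorm y != 1 & cnorm z = 1].
  by move=> h h' nx; have [? ?] := pair_triple h h'; split => //; apply: notunit h nx.
have P132 : l1 * l3 * l2 = 1 by rewrite -P; ring.
have P213 : l2 * l1 * l3 = 1 by rewrite -P; ring.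
have P231 : l2 * l3 * l1 = 1 by rewrite -P; ring.
have P312 : l3 * l1 * l2 = 1 by rewrite -P; ring.
have P321 : l3 * l2 * l1 = 1 by rewrite -P; ring.
have [u1|u1] := boolP (cnorm l1 == 1); last first.
  right; have [m hm [Em|[Em|Em]]] := refl l1 r1 n1; subst m.
  - by move: u1; rewrite (nu _ _ hm) eqxx.
  - have [V a b d] := main _ _ _ hm P u1.
    by rewrite /= (negbTE a) (negbTE b) d eqxx.
  - have [V a b d] := main _ _ _ hm P132 u1.
    rewrite /= (negbTE a) (negbTE b) d eqxx; split => //.
    by apply: symV V; rewrite /vdm3; ring.
have [u2|u2] := boolP (cnorm l2 == 1); last first.
  right; have [m hm [Em|[Em|Em]]] := refl l2 r2 n2; subst m.
  - have [V a b d] := main _ _ _ hm P213 u2; by rewrite u1 in b.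
  - by move: u2; rewrite (nu _ _ hm) eqxx.
  - have [V a b d] := main _ _ _ hm P231 u2.
    rewrite /= (negbTE a) (negbTE b) d eqxx; split => //.
    by apply: symV V; rewrite /vdm3; ring.
have [u3|u3] := boolP (cnorm l3 == 1); last first.
  have [m hm [Em|[Em|Em]]] := refl l3 r3 n3; subst m.
  - have [V a b d] := main _ _ _ hm P312 u3; by rewrite u1 in b.
  - have [V a b d] := main _ _ _ hm P321 u3; by rewrite u2 in b.
  - by move: u3; rewrite (nu _ _ hm) eqxx.
left; rewrite /= u1 u2 u3; split => //.
by apply: unit_triple => //; apply/eqP.
Qed.

End SelfInversive.

Section CubicRoots.
Context {R : realType}.
Notation C := R[i].

Lemma cubic_split (e1 e2 e3 : C) : exists l1 l2 l3, forall l,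
  l ^+ 3 - e1 * l ^+ 2 + e2 * l - e3 = (l - l1) * (l - l2) * (l - l3).
Proof.
pose A : 'M[C]_3 := \matrix_(i < 3, j < 3)
  (nth [::] [:: [:: 0; 0; e3]; [:: 1; 0; - e2]; [:: 0; 1; e1]] i)`_j.
have [l1 [l2 [l3 [_ H]]]] := eigenvalues3 A.
exists l1, l2, l3 => l; rewrite -H det3 /principal_minors /mxtrace sum3 !mxE /=; ring.
Qed.

Lemma real_conj (z : C) : conjc z = z -> z = (complex.Re z)%:C.
Proof. by case: z => a b [] h; have -> : b = 0 by lra. Qed.

(** Three real roots would make the discriminant a square of a real number, hence nonnegative. So
    some root is nonreal, its conjugate is another, and the third is real because the sum is. *)
Lemma cubic_nonreal_roots (A B : R) : B != 0 -> A ^+ 3 / 2 - 3 * B ^+ 2 < 0 ->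
  exists (y1 : R) (y2 : C), complex.Im y2 != 0 /\ forall y : C,
    1 - y ^+ 2 / 2 * A%:C + y ^+ 3 / 3 * B%:C =
    B%:C / 3 * ((y - y1%:C) * (y - y2) * (y - conjc y2)).
Proof.
move=> B0 D0.
(* Symmetric functions of the roots after division by B / 3; the second one is 0. *)
pose e1 : R := 3 * A / (2 * B); pose e3 : R := - (3 / B).
have BC0 : B%:C != 0 :> C by rewrite -(rmorph0 (real_complex R)) (inj_eq (@complexI R)).
have E1C : e1%:C = 3 * A%:C / (2 * B%:C) :> C by rewrite /e1 !(rmorphM, fmorphV, rmorph_nat).
have E3C : e3%:C = - (3 / B%:C) :> C by rewrite /e3 !(rmorphN, rmorphM, fmorphV, rmorph_nat).
have suf x y z : (forall l : C, l ^+ 3 - e1%:C * l ^+ 2 + 0 * l - e3%:C = (l - x) * (l - y) * (l - z)) ->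
    complex.Im x != 0 -> exists (y1 : R) (y2 : C), complex.Im y2 != 0 /\ forall y : C,
    1 - y ^+ 2 / 2 * A%:C + y ^+ 3 / 3 * B%:C =
    B%:C / 3 * ((y - y1%:C) * (y - y2) * (y - conjc y2)).
  move=> {}H x0.
  have cub w : 1 - w ^+ 2 / 2 * A%:C + w ^+ 3 / 3 * B%:C = B%:C / 3 * ((w - x) * (w - y) * (w - z)).
    by rewrite -H E1C E3C; field; exact: BC0.
  have [V1 _ _] := vieta3 H.
  have rc : (conjc x - x) * (conjc x - y) * (conjc x - z) = 0.
    rewrite -H; have h : x ^+ 3 - e1%:C * x ^+ 2 + 0 * x - e3%:C = 0 by rewrite H subrr !mul0r.
    have := congr1 conjc h.
    by rewrite !(conjcD, conjcN, conjcM, conjcX, conjc_real, conjc0).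
  have nx : conjc x - x != 0.
    apply: contra x0; rewrite subr_eq0 => /eqP h; move: (real_conj h) => ->; by rewrite /=.
  have realc (w : C) : e1%:C = x + conjc x + w -> w = (complex.Re w)%:C.
    move=> h; apply: real_conj; have := congr1 conjc h.
    rewrite !conjcD conjcK conjc_real h => h'.
    by apply: (addrI (x + conjc x)); rewrite h' [conjc x + x]addrC.
  have : (conjc x == y) || (conjc x == z).
    by move/eqP: rc; rewrite -mulrA mulf_eq0 (negbTE nx) /= mulf_eq0 !subr_eq0.
  move=> /orP[]/eqP E.
    exists (complex.Re z), x; split => // w; rewrite cub -E -realc; last by rewrite V1 E.
    by ring.
  exists (complex.Re y), x; split => // w; rewrite cub -E -realc; last by rewrite V1 E; ring.
  by ring.
have [x [y [z H]]] := cubic_split e1%:C 0 e3%:C.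
have [x0|x0] := eqVneq (complex.Im x) 0; last exact: suf H x0.
have [y0|y0] := eqVneq (complex.Im y) 0; last first.
  by apply: (suf y x z) => // l; rewrite H; ring.
have [z0|z0] := eqVneq (complex.Im z) 0; last first.
  by apply: (suf z x y) => // l; rewrite H; ring.
exfalso; have [V1 V2 V3] := vieta3 H.
have rl (w : C) : complex.Im w = 0 -> conjc w = w.
  by case: w => a b /= ->; rewrite oppr0.
have : 0 <= complex.Re (vdm3 x y z ^+ 2).
  by apply: conj_fixed_sqr_Re; rewrite /vdm3 !(conjcM, conjcD, conjcN) !rl.
rewrite (vdm3_sqrE V1 V2 V3).
have -> : e1%:C ^+ 2 * 0 ^+ 2 - 4 * 0 ^+ 3 - 4 * e1%:C ^+ 3 * e3%:C + 18 * e1%:C * 0 * e3%:C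
   - 27 * e3%:C ^+ 2 = ((A ^+ 3 / 2 - 3 * B ^+ 2) * (9 / B ^+ 2) ^+ 2)%:C :> C.
  rewrite E1C E3C !(rmorphD, rmorphN, rmorphM, rmorphXn, fmorphV, rmorph_nat) /=.
  by field; exact: BC0.
rewrite /= leNgt => /negP; apply; rewrite nmulr_rlt0 // exprn_even_gt0 //=.
by rewrite mulf_neq0 // ?invr_eq0 ?expf_neq0 // pnatr_eq0.
Qed.

End CubicRoots.

(** * Reality of the coefficients and the discriminant on the imaginary axis *)

Section TraceExpansion.
Context {R : realType}.
Notation C := R[i].
Context (al s : C -> C) (A B : C) (r0 k0 : R).
Hypothesis r0_gt0 : 0 < r0.
Hypothesis k0_gt0 : 0 < k0.
Hypothesis alE : forall mu, al mu = 3 + A / 2 * mu ^+ 2 + B / 6 * mu ^+ 3 + mu ^+ 4 * s mu.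
Hypothesis s_lip : forall mu mu', cnorm mu <= r0 -> cnorm mu' <= r0 ->
  cnorm (s mu) <= k0 /\ cnorm (s mu - s mu') <= cnorm (mu - mu') * k0.
Hypothesis al_conj : forall mu, al (conjc mu) = conjc (al mu).

Let Os : cbigO 0 s.
Proof.
by exists r0, k0; split => // mu mur; rewrite expr0 mulr1; have [] := s_lip mur mur.
Qed.

Let OsN : cbigO 0 (fun mu => s (- mu)).
Proof.
exists r0, k0; split => // mu mur; rewrite expr0 mulr1.
have mur' : cnorm (- mu) <= r0 by rewrite cnormN.
by have [] := s_lip mur' mur'.
Qed.

(** By [al_conj] the expansion and its conjugate are the same function of mu; [cbigO_coef] compares
    them order by order. *)
Lemma trace_coef_real : conjc A = A /\ conjc B = B.
Proof.
pose s' mu := conjc (s (conjc mu)).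
have Os' : cbigO 0 s'.
  exists r0, k0; split => // mu mur; rewrite expr0 mulr1 /s' cnormJ.
  have mur' : cnorm (conjc mu) <= r0 by rewrite cnormJ.
  by have [] := s_lip mur' mur'.
have E mu : (A - conjc A) / 2 * mu ^+ 2 + (B - conjc B) / 6 * mu ^+ 3
    + mu ^+ 4 * (s mu - s' mu) = 0.
  have := al_conj (conjc mu); rewrite conjcK !alE => h.
  have h2 : conjc (2^-1 : C) = 2^-1 by rewrite conjc_inv conjc_nat.
  have h6 : conjc (6^-1 : C) = 6^-1 by rewrite conjc_inv conjc_nat.
  have h3 : conjc (3 : C) = 3 by rewrite conjc_nat.
  have E3 (x y z p : C) : conjc (3 + x / 2 * y + z / 6 * p) = 3 + conjc x / 2 * conjc y + conjc z / 6 * conjc p.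
    by rewrite conjcD [conjc (3 + _)]conjcD !conjcM h2 h3 h6.
  rewrite conjcD conjcM E3 !conjcX conjcK in h.
  apply: etrans (subrr (3 + A / 2 * mu ^+ 2 + B / 6 * mu ^+ 3 + mu ^+ 4 * s mu)).
  by rewrite {2}h /s'; ring.
have A0 : A = conjc A.
  suff : (A - conjc A) / 2 = 0.
    by move=> /eqP; rewrite mulf_eq0 invr_eq0 pnatr_eq0 orbF subr_eq0 => /eqP.
  apply: (@cbigO_coef _ 2).
  apply: cbigO_ext (cbigON (cbigOD (cbigOM (cbigO_Xn 3) (cbigO_cst ((B - conjc B) / 6)))
    (cbigOW (cbigOM (cbigO_Xn 4) (cbigOB Os Os'))))) => mu.
  by rewrite -[LHS]addr0 -(E mu); ring.
have B0 : B = conjc B.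
  suff : (B - conjc B) / 6 = 0.
    by move=> /eqP; rewrite mulf_eq0 invr_eq0 pnatr_eq0 orbF subr_eq0 => /eqP.
  apply: (@cbigO_coef _ 3).
  apply: cbigO_ext (cbigON (cbigOM (cbigO_Xn 4) (cbigOB Os Os'))) => mu.
  by rewrite -[LHS]addr0 -(E mu) {1}A0 subrr mul0r mul0r add0r; ring.
by split.
Qed.

(** At order six the square of b - b' contributes - 3 B^2, and the two cubic terms contribute (9/2 -
    4) A^3; the quartic term has order eight. *)
Lemma disc3_asymptotics :
  cbigO 7 (fun mu => disc3 (al mu) (al (- mu)) - mu ^+ 6 * (A ^+ 3 / 2 - 3 * B ^+ 2)).
Proof.
have O1 := @cbigO_Xn R 1.
have Ox : cbigO 1 (fun mu : C => mu ^+ 1 * (B / 6 + mu ^+ 1 * s mu)).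
  exact: cbigOM O1 (cbigOD (cbigO_cst (B / 6)) (cbigOW (cbigOM O1 Os))).
have Oy : cbigO 1 (fun mu : C => mu ^+ 1 * (- (B / 6) + mu ^+ 1 * s (- mu))).
  exact: cbigOM O1 (cbigOD (cbigO_cst (- (B / 6))) (cbigOW (cbigOM O1 OsN))).
have Od : cbigO 1 (fun mu : C => mu ^+ 1 * (s mu - s (- mu))).
  exact: cbigOM O1 (cbigOB Os OsN).
have Ot := cbigOD Ox Oy.
have c z := @cbigO_cst R z.
have OX := cbigOW Ox; have OY := cbigOW Oy; have OT := cbigOW Ot; have OD := cbigOW Od.
(* [b = al mu - 3 = mu^2 beta], [b' = al (- mu) - 3 = mu^2 beta'], with
   [beta = A / 2 + x], [beta' = A / 2 + y]; in terms of [b, b'] the discriminant is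
   [- 27 (b - b')^2 + 18 b b' (b + b') - 4 (b + b')^3 + (b b')^2]. *)
apply: cbigO_ext (cbigOM (cbigO_Xn 6)
  (cbigOD (cbigOD (cbigOD
     (cbigOM Od (cbigOD (c (- 18 * B)) (cbigOMl (- 27) OD)))
     (cbigOM Ot (cbigOD (cbigOD (c (3 / 2 * A ^+ 2)) (cbigOMl (- 3 * A) OT))
        (cbigOMl (- 4) (cbigOM OT OT)))))
     (cbigOM Ox (cbigOM OY (cbigOD (c (18 * A)) (cbigOMl 18 OT)))))
     (cbigOW (cbigOM (cbigO_Xn 2)
       (cbigOM (cbigOM (cbigOD (c (A / 2)) OX) (cbigOD (c (A / 2)) OY))
               (cbigOM (cbigOD (c (A / 2)) OX) (cbigOD (c (A / 2)) OY))))))) => mu.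
rewrite /disc3 !alE; move: (s mu) (s (- mu)) => p q; by field.
Qed.

Lemma disc3_axis_sign (A1 B1 : R) : A = A1%:C -> B = B1%:C ->
  let D := A1 ^+ 3 / 2 - 3 * B1 ^+ 2 in D != 0 ->
  exists2 r : R, 0 < r & forall t : R, 0 < `|t| < r ->
    0 < - D * complex.Re (disc3 (al (0 +i* t)) (conjc (al (0 +i* t)))).
Proof.
move=> EA EB D D0; have [r [c [r1 c1 H]]] := disc3_asymptotics.
(* For |t| < |D| / c the error c |t|^7 stays below the leading term |D| t^6. *)
exists (Num.min r (`|D| / c)); first by rewrite lt_min r1 divr_gt0 // normr_gt0.
move=> t /andP[t0]; rewrite lt_min => /andP[tr tD].
have ct : cnorm (0 +i* t) = `|t| :> R by rewrite /= expr0n add0r sqrtr_sqr.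
have := H (0 +i* t); rewrite ct => /(_ (ltW tr)).
have -> : - (0 +i* t) = conjc (0 +i* t) :> C by simpc.
rewrite al_conj EA EB.
have -> : (0 +i* t) ^+ 6 * (A1%:C ^+ 3 / 2 - 3 * B1%:C ^+ 2) = (- t ^+ 6 * D)%:C :> C.
  have -> : (0 +i* t) = 'i * t%:C :> C by simpc.
  rewrite /D !(rmorphM, rmorphN, rmorphB, rmorphXn, fmorphV, rmorph_nat) /=.
  rewrite exprMn (_ : 'i ^+ 6 = -1 :> C); last by rewrite (exprM _ 2 3) sqr_i; ring.
  by ring.
set d := disc3 _ _ => h.
have := le_trans (cnorm_geRe _) h; rewrite cReD cReN /=.
have p0 : 0 < t ^+ 6 by rewrite exprn_even_gt0 //= -normr_gt0.
have -> : `|t| ^+ 7 = `|t| * t ^+ 6 by rewrite exprS -normrX [`|t ^+ 6|]gtr0_norm.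
move: tD; rewrite ltr_pdivlMr // => tD h'.
have h2 : `|D * (complex.Re d - - t ^+ 6 * D)| < `|D| * (`|D| * t ^+ 6).
  rewrite normrM ltr_pM2l ?normr_gt0 //; apply: le_lt_trans h' _.
  by rewrite mulrA ltr_pM2r // mulrC.
have DD : `|D| * `|D| = D * D by rewrite -normrM ger0_norm // -expr2 sqr_ge0.
have := le_lt_trans (ler_norm _) h2; rewrite mulrA DD; lra.
Qed.

End TraceExpansion.

(** * Continuation of simple roots *)

Section Contraction.
Context {R : realType}.
Notation C := R[i].

(** The intervals of radius 2 c / 2^n around x n are nested, and the limit is the supremum of their
    left ends; this yields the rate directly. *)
Lemma geometric_limit (x : nat -> R) (c : R) :
  (forall n, `|x n.+1 - x n| <= c / 2 ^+ n) ->
  exists l, forall n, `|x n - l| <= 2 * c / 2 ^+ n.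
Proof.
move=> H; pose e n : R := 2 * c / 2 ^+ n.
have eS n : e n.+1 = e n - c / 2 ^+ n.
  rewrite /e exprS invfM; have : (2 : R) ^+ n != 0 by rewrite expf_neq0 // pnatr_eq0.
  by move=> h; field.
have nest n k : x (n + k)%N + e (n + k)%N <= x n + e n /\ x n - e n <= x (n + k)%N - e (n + k)%N.
  elim: k => [|k [h1 h2]]; first by rewrite addn0.
  by rewrite addnS eS; have := H (n + k)%N; rewrite ler_norml => /andP[]; split; lra.
have e0 n : 0 <= e n.
  rewrite /e !mulr_ge0 ?invr_ge0 ?exprn_ge0 //.
  by have := le_trans (normr_ge0 _) (H 0%N); rewrite expr0 divr1.
have le n m : x n - e n <= x m + e m.
  have [nm|/ltnW mn] := leqP n m.
    by have [_] := nest n (m - n)%N; rewrite subnKC //; have := e0 m; lra.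
  by have [+ _] := nest m (n - m)%N; rewrite subnKC //; have := e0 n; lra.
pose S := [set x n - e n | n in [set: nat]].
have ne : S !=set0 by exists (x 0%N - e 0%N); exists 0%N.
have ub m : ubound S (x m + e m) by move=> _ [n _ <-]; apply: le.
exists (sup S) => n; rewrite ler_norml; apply/andP; split.
  have : sup S <= x n + e n by apply: ge_sup.
  by rewrite /e; lra.
have : x n - e n <= sup S by apply: ub_le_sup; [exists (x 0%N + e 0%N) | exists n].
by rewrite /e; lra.
Qed.

Lemma cgeometric_limit (x : nat -> C) (c : R) :
  (forall n, cnorm (x n.+1 - x n) <= c / 2 ^+ n) ->
  exists l, forall n, cnorm (x n - l) <= 4 * c / 2 ^+ n.
Proof.
move=> H.
have [|a Ha] := @geometric_limit (fun n => complex.Re (x n)) c.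
  move=> n; apply: le_trans (H n); rewrite -cReN -cReD; exact: cnorm_geRe.
have [|b Hb] := @geometric_limit (fun n => complex.Im (x n)) c.
  move=> n; apply: le_trans (H n); rewrite -cImN -cImD; exact: cnorm_geIm.
exists (a +i* b) => n; apply: le_trans (cnorm_leReIm _) _.
rewrite cReD cReN cImD cImN /=; have := Ha n; have := Hb n; lra.
Qed.

(** Invariance of the ball is not assumed: steps of length at most rho / 2^(n+1) add up to less than
    rho, so the iterates never leave it. *)
Lemma contraction_fixpoint (N : C -> C) y0 (rho : R) : 0 < rho ->
  (forall y y', cnorm (y - y0) <= rho -> cnorm (y' - y0) <= rho ->
     cnorm (N y - N y') <= cnorm (y - y') / 2) ->
  cnorm (N y0 - y0) <= rho / 2 ->
  exists2 y, cnorm (y - y0) <= rho & N y = y.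
Proof.
move=> rho0 HN N0; pose x n := iter n N y0.
have p2 n : 0 < (2 : R) ^+ n by rewrite exprn_gt0.
have E n : rho / 2 / 2 ^+ n = rho / 2 ^+ n - rho / 2 ^+ n.+1.
  by rewrite exprS invfM; have := lt0r_neq0 (p2 n) => h; field.
have X n : cnorm (x n - y0) <= rho - rho / 2 ^+ n /\ cnorm (x n.+1 - x n) <= rho / 2 / 2 ^+ n.
  elim: n => [|n [h1 h2]]; first by rewrite expr0 !divr1 !subrr cnorm0.
  have b1 : cnorm (x n.+1 - y0) <= rho - rho / 2 ^+ n.+1.
    have := ler_cnormD (x n.+1 - x n) (x n - y0); rewrite subrKA; have := E n; lra.
  have g n' : 0 <= rho / 2 ^+ n' by rewrite divr_ge0 ?(ltW rho0) ?(ltW (p2 _)).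
  split => //; apply: le_trans (HN _ _ _ _) _.
  - by apply: le_trans b1 _; have := g n.+1; lra.
  - by apply: le_trans h1 _; have := g n; lra.
  by rewrite exprS invfM; move: h2; have := lt0r_neq0 (p2 n) => hn; lra.
have [l Hl] := cgeometric_limit (fun n => (X n).2).
have small (a : R) : (forall n, a <= (2^-1) ^+ n * (4 * (rho / 2) + rho)) -> a <= 0.
  move=> Ha; rewrite leNgt; apply/negP => a0.
  have half01 : 0 <= (2^-1 : R) < 1 by apply/andP; split; lra.
  by have := geometric_bound0 half01 (ltW a0) Ha; move: a0 => /[swap] ->; rewrite ltxx.
have cv n : 4 * (rho / 2) / 2 ^+ n <= (2^-1) ^+ n * (4 * (rho / 2) + rho).
  rewrite exprVn mulrC ler_wpM2l ?invr_ge0 ?(ltW (p2 n)) //; lra.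
have ly0 : cnorm (l - y0) <= rho.
  rewrite -subr_le0; apply: small => n; apply: le_trans (cv n).
  have := ler_cnormD (l - x n) (x n - y0); rewrite subrKA.
  have [h _] := X n; have := Hl n; rewrite cnorm_distC.
  have : 0 <= rho / 2 ^+ n by rewrite divr_ge0 ?(ltW rho0) ?(ltW (p2 n)).
  lra.
exists l => //; apply/eqP; rewrite -subr_eq0 -cnorm_eq0 eq_le cnorm_ge0 andbT.
apply: small => n.
have h1 : cnorm (N l - x n.+1) <= cnorm (l - x n) / 2.
  apply: HN => //; apply: le_trans (X n).1 _.
  by rewrite gerBl divr_ge0 ?(ltW rho0) ?(ltW (p2 n)).
have := ler_cnormD (N l - x n.+1) (x n.+1 - l); rewrite subrKA.
have := Hl n; have := Hl n.+1; rewrite [cnorm (x n - l)]cnorm_distC.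
have -> : 4 * (rho / 2) / 2 ^+ n.+1 = 4 * (rho / 2) / 2 ^+ n / 2.
  by rewrite exprS invfM; have := lt0r_neq0 (p2 n) => hn; field.
have := cv n; lra.
Qed.

Lemma is_derive_quadratic (h : R -> R) (l K delta : R) : 0 < delta ->
  (forall t, `|t| <= delta -> `|h t - t * l| <= K * t ^+ 2) -> is_derive (0 : R) 1 h l.
Proof.
move=> d0 H.
have h0 : h 0 = 0.
  have := H 0; rewrite normr0 mul0r subr0 expr0n mulr0 normr_le0 => /(_ (ltW d0)) /eqP; exact.
have cv : (fun x : R => x^-1 *: (h (x *: 1 + 0) - h 0)) x @[x --> 0^'] --> l.
  apply/cvgrPdist_le => e e0; near=> x.
  have x0 : x != 0 by near: x; exact: nbhs_dnbhs_neq.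
  have xe : `|x| < Num.min delta (e / (`|K| + 1)).
    by near: x; apply: dnbhs0_lt; rewrite lt_min d0 divr_gt0 // ltr_wpDl.
  move: xe; rewrite lt_min ltr_pdivlMr ?ltr_wpDl // => /andP[xd xe].
  rewrite h0 subr0 addr0 /GRing.scale /= mulr1.
  have -> : l - x^-1 * h x = - (x^-1 * (h x - x * l)) by field.
  rewrite normrN normrM normfV mulrC ler_pdivrMr ?normr_gt0 //.
  apply: le_trans (H x (ltW xd)) _.
  apply: le_trans (_ : `|K| * `|x| * `|x| <= _).
    by rewrite -mulrA -normrM -expr2 [`|x ^+ 2|]ger0_norm ?sqr_ge0 // ler_wpM2r ?sqr_ge0 ?ler_norm.
  rewrite ler_wpM2r //; have := normr_ge0 x; nra.
by split; [exact: (cvgP l cv) | exact: (cvg_lim _ cv)].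
Unshelve. all: by end_near. Qed.

Lemma lipschitz_continuous_at (h : R -> R) (delta K t : R) : `|t| < delta ->
  (forall t', `|t'| < delta -> `|h t - h t'| <= K * `|t - t'|) -> {for t, continuous h}.
Proof.
move=> td H; apply/cvgrPdist_le => e e0; near=> t'.
have h1 : `|t - t'| < Num.min (delta - `|t|) (e / (`|K| + 1)).
  near: t'; exists (Num.min (delta - `|t|) (e / (`|K| + 1))) => //=.
  by rewrite lt_min subr_gt0 td divr_gt0 // ltr_wpDl.
have K1 : 0 < `|K| + 1 by rewrite ltr_wpDl.
move: h1; rewrite lt_min ltr_pdivlMr // => /andP[h1 h2].
apply: le_trans (H t' _) _.
  by have := ler_normB t (t - t'); rewrite subKr; lra.
apply: le_trans (ler_wpM2r (normr_ge0 _) (ler_norm K)) _.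
have := normr_ge0 (t - t'); nra.
Unshelve. all: by end_near. Qed.

End Contraction.

(** * Perturbation of a simple root *)

Section Branches.
Context {R : realType}.
Notation C := R[i].

(** Bound and Lipschitz constant are kept together because products need both; membership then
    follows the syntax of an expression. *)
Definition bounded_lip (Y delta : R) (h : R -> C -> C) := exists2 K : R, 0 < K &
  forall t t' y y', `|t| <= delta -> `|t'| <= delta -> cnorm y <= Y -> cnorm y' <= Y ->
    cnorm (h t y) <= K /\ cnorm (h t y - h t' y') <= K * (`|t - t'| + cnorm (y - y')).

Lemma bounded_lip_cst Y delta z : bounded_lip Y delta (fun _ _ => z).
Proof.
exists (cnorm z + 1); first by rewrite ltr_wpDl ?cnorm_ge0.
move=> t t' y y' _ _ _ _; rewrite subrr cnorm0 lerDl ler01; split => //.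
by rewrite mulr_ge0 ?addr_ge0 ?cnorm_ge0.
Qed.

Lemma bounded_lipD Y delta g h : bounded_lip Y delta g -> bounded_lip Y delta h ->
  bounded_lip Y delta (fun t y => g t y + h t y).
Proof.
move=> [K K0 HK] [L L0 HL]; exists (K + L); first exact: addr_gt0.
move=> t t' y y' ht ht' hy hy'.
have [k1 k2] := HK t t' y y' ht ht' hy hy'; have [l1 l2] := HL t t' y y' ht ht' hy hy'.
split; first by apply: le_trans (ler_cnormD _ _) _; apply: lerD.
rewrite opprD addrACA; apply: le_trans (ler_cnormD _ _) _.
by rewrite mulrDl lerD.
Qed.

Lemma bounded_lipM Y delta g h : bounded_lip Y delta g -> bounded_lip Y delta h ->
  bounded_lip Y delta (fun t y => g t y * h t y).
Proof.
move=> [K K0 HK] [L L0 HL]; exists (2 * (K * L)); first by rewrite !mulr_gt0.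
move=> t t' y y' ht ht' hy hy'.
have [k1 k2] := HK t t' y y' ht ht' hy hy'; have [l1 l2] := HL t t' y y' ht ht' hy hy'.
have [_ _] := HK t' t y' y ht' ht hy' hy; have [l1' _] := HL t' t y' y ht' ht hy' hy.
split.
  rewrite cnormM; apply: le_trans (ler_pM (cnorm_ge0 _) (cnorm_ge0 _) k1 l1) _.
  by rewrite ler_peMl ?mulr_ge0 ?(ltW K0) ?(ltW L0) // ler1n.
have -> : g t y * h t y - g t' y' * h t' y' =
    g t y * (h t y - h t' y') + (g t y - g t' y') * h t' y' by ring.
apply: le_trans (ler_cnormD _ _) _; rewrite !cnormM.
have d0 : 0 <= `|t - t'| + cnorm (y - y') by rewrite addr_ge0 ?cnorm_ge0.
have := ler_pM (cnorm_ge0 _) (cnorm_ge0 _) k1 l2.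
have := ler_pM (cnorm_ge0 _) (cnorm_ge0 _) k2 l1'.
move: (cnorm (g t y) * _) (cnorm (g t y - _) * _) => p q; lra.
Qed.

Lemma bounded_lip_t Y delta : 0 < delta -> bounded_lip Y delta (fun t _ => t%:C).
Proof.
move=> d0; exists (delta + 1); first by rewrite addr_gt0.
move=> t t' y y' ht ht' _ _; rewrite cnormR -rmorphB cnormR; split.
  by apply: le_trans ht _; rewrite lerDl.
have := cnorm_ge0 (y - y'); have := normr_ge0 (t - t'); nra.
Qed.

Lemma bounded_lip_y Y delta : 0 < Y -> bounded_lip Y delta (fun _ y => y).
Proof.
move=> d0; exists (Y + 1); first by rewrite addr_gt0.
move=> t t' y y' _ _ hy hy'; split.
  by apply: le_trans hy _; rewrite lerDl.
have := cnorm_ge0 (y - y'); have := normr_ge0 (t - t'); nra.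
Qed.

Lemma bounded_lip_comp Y delta (s : C -> C) (r k : R) h : 0 < k ->
  (forall z z', cnorm z <= r -> cnorm z' <= r ->
     cnorm (s z) <= k /\ cnorm (s z - s z') <= cnorm (z - z') * k) ->
  (forall t y, `|t| <= delta -> cnorm y <= Y -> cnorm (h t y) <= r) ->
  bounded_lip Y delta h -> bounded_lip Y delta (fun t y => s (h t y)).
Proof.
move=> k0 Hs hr [K K0 HK]; exists (k + K * k); first by rewrite addr_gt0 // mulr_gt0.
move=> t t' y y' ht ht' hy hy'.
have [s1 s2] := Hs _ _ (hr t y ht hy) (hr t' y' ht' hy').
have [_ k2] := HK t t' y y' ht ht' hy hy'.
split; first by apply: le_trans s1 _; rewrite lerDl mulr_ge0 ?ltW.
apply: le_trans s2 _; apply: le_trans (ler_wpM2r (ltW k0) k2) _.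
have d0 : 0 <= `|t - t'| + cnorm (y - y') by rewrite addr_ge0 ?cnorm_ge0.
by rewrite mulrDl mulrAC lerDr mulr_ge0 // ltW.
Qed.

(** A Lipschitz implicit function theorem: Newton's iteration with the derivative frozen at g0 =
    F'(a), which is nonzero because the root is simple. *)
Lemma simple_root_branch (alpha a b c : C) (Q : R -> C -> C) (Y delta rho0 : R) :
  let F y := alpha * ((y - a) * (y - b) * (y - c)) in
  alpha != 0 -> a != b -> a != c -> 0 < delta -> 0 < rho0 ->
  cnorm a + rho0 <= Y -> bounded_lip Y delta Q ->
  exists (rho delta' K : R) (eta : R -> C),
  [/\ 0 < rho <= rho0, 0 < delta' <= delta /\ 0 < K, eta 0 = a,
   forall t, `|t| <= delta' -> cnorm (eta t - a) <= rho /\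
      F (eta t) + t%:C * Q t (eta t) = 0 &
   (forall t y, `|t| <= delta' -> cnorm (y - a) <= rho -> F y + t%:C * Q t y = 0 ->
      y = eta t) /\
   (forall t t', `|t| <= delta' -> `|t'| <= delta' ->
      cnorm (eta t - eta t') <= K * `|t - t'|)].
Proof.
move=> F alpha0 ab ac d0 rho00 aY [Kq Kq0 HQ].
pose g0 := alpha * ((a - b) * (a - c)).
have g0n : g0 != 0 by rewrite /g0 !mulf_neq0 // subr_eq0.
have G0 : 0 < cnorm g0 by rewrite lt_neqAle eq_sym cnorm_eq0 g0n cnorm_ge0.
have al0 : 0 < cnorm alpha by rewrite lt_neqAle eq_sym cnorm_eq0 alpha0 cnorm_ge0.
pose G := cnorm g0; pose m := cnorm (a - b + (a - c)); have m0 : 0 <= m := cnorm_ge0 _.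
(* The nonlinear part of F then contributes at most 1/4 to the contraction factor. *)
pose rho := Num.min rho0 (Num.min 1 (G / (4 * cnorm alpha * (3 + 2 * m)))).
have den0 : 0 < 4 * cnorm alpha * (3 + 2 * m) by rewrite !mulr_gt0 //; lra.
have rhop : 0 < rho by rewrite !lt_min rho00 ltr01 divr_gt0.
have rho1 : rho <= 1 by rewrite !ge_min lexx orbT.
have rhole : rho <= rho0 by rewrite !ge_min lexx.
have rhoG : rho * (4 * cnorm alpha * (3 + 2 * m)) <= G.
  by rewrite -ler_pdivlMr // !ge_min lexx !orbT.
(* The first quotient gives the remaining 1/4 from t Q; the second keeps the first step N t a - a
   within rho / 2. *)
pose delta' := Num.min delta (Num.min (G / (4 * Kq)) (G * rho / (2 * Kq))).
have d'0 : 0 < delta'.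
  by rewrite !lt_min d0 !divr_gt0 ?mulr_gt0.
have d'd : delta' <= delta by rewrite ge_min lexx.
have d'1 (t : R) : `|t| <= delta' -> `|t| * Kq <= G / 4.
  move=> h; have : `|t| <= G / (4 * Kq) by apply: le_trans h _; rewrite !ge_min lexx !orbT.
  by rewrite ler_pdivlMr ?mulr_gt0 //; lra.
have d'2 (t : R) : `|t| <= delta' -> `|t| * Kq <= G * rho / 2.
  move=> h; have : `|t| <= G * rho / (2 * Kq) by apply: le_trans h _; rewrite !ge_min lexx !orbT.
  by rewrite ler_pdivlMr ?mulr_gt0 //; lra.
have inY y : cnorm (y - a) <= rho -> cnorm y <= Y.
  by move=> h; have := ler_cnormD (y - a) a; rewrite subrK; lra.
pose N t y := y - (F y + t%:C * Q t y) / g0.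
have N_fix t y : N t y = y <-> F y + t%:C * Q t y = 0.
  split=> [/eqP|h]; last by rewrite /N h mul0r subr0.
  rewrite /N -subr_eq0 addrAC subrr sub0r oppr_eq0 mulf_eq0 invr_eq0 (negbTE g0n) orbF.
  by move=> /eqP.
have half (p : C) (x : R) : cnorm (g0 * p) <= G * x -> cnorm p <= x.
  by rewrite cnormM ler_pM2l.
have contr t y y' : `|t| <= delta' -> cnorm (y - a) <= rho -> cnorm (y' - a) <= rho ->
    cnorm (N t y - N t y') <= cnorm (y - y') / 2.
  move=> td ya y'a; apply: half.
  have -> : g0 * (N t y - N t y') =
     - (alpha * ((y - a) ^+ 2 + (y - a) * (a - b + (a - c)) + (y' - a) * ((y - a) + (y' - a) + (a - b + (a - c)))) * (y - y'))
     - t%:C * (Q t y - Q t y').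
    by rewrite /N /F /g0; field; move: g0n; rewrite /g0 !mulf_eq0 !negb_or => /and3P[-> -> ->].
  have td1 : `|t| <= delta by apply: le_trans d'd.
  have [_ hQ] := HQ t t y y' td1 td1 (inY _ ya) (inY _ y'a).
  rewrite subrr normr0 add0r in hQ.
  apply: le_trans (ler_cnormD _ _) _; rewrite !cnormN !cnormM cnormR.
  have h2 : `|t| * cnorm (Q t y - Q t y') <= G / 4 * cnorm (y - y').
    apply: le_trans (ler_wpM2l (normr_ge0 t) hQ) _.
    by rewrite mulrA ler_wpM2r ?cnorm_ge0 // d'1.
  set v := y - a in ya *; set v' := y' - a in y'a *; set z := a - b + (a - c).
  have h3 : cnorm (v ^+ 2 + v * z + v' * (v + v' + z)) <= rho * (3 + 2 * m).
    apply: le_trans (ler_cnormD _ _) _.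
    have e1 : cnorm (v ^+ 2 + v * z) <= rho * (1 + m).
      apply: le_trans (ler_cnormD _ _) _; rewrite cnormX cnormM -/m.
      have := cnorm_ge0 v; have := m0; nra.
    have e2 : cnorm (v' * (v + v' + z)) <= rho * (2 + m).
      rewrite cnormM ler_pM ?cnorm_ge0 //.
      apply: le_trans (ler_cnormD _ _) _; rewrite -/m lerD2r.
      by apply: le_trans (ler_cnormD _ _) _; lra.
    lra.
  have h4 : cnorm alpha * cnorm (v ^+ 2 + v * z + v' * (v + v' + z)) <= G / 4.
    apply: le_trans (ler_wpM2l (ltW al0) h3) _; move: rhoG; lra.
  have := ler_wpM2r (cnorm_ge0 (y - y')) h4; lra.
have Na t : `|t| <= delta' -> cnorm (N t a - a) <= rho / 2.
  move=> td; apply: half.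
  have -> : g0 * (N t a - a) = - (t%:C * Q t a).
    by rewrite /N /F; field; exact: g0n.
  have td1 : `|t| <= delta by apply: le_trans d'd.
  have aa : cnorm (a - a) <= rho by rewrite subrr cnorm0 ltW.
  have [hQ _] := HQ t t a a td1 td1 (inY _ aa) (inY _ aa).
  rewrite cnormN cnormM cnormR; apply: le_trans (ler_wpM2l (normr_ge0 t) hQ) _.
  by apply: le_trans (d'2 t td) _; lra.
have uniq t y y' : `|t| <= delta' -> cnorm (y - a) <= rho -> cnorm (y' - a) <= rho ->
    N t y = y -> N t y' = y' -> y = y'.
  move=> td ya y'a Ny Ny'; have := contr t y y' td ya y'a; rewrite Ny Ny' => h.
  have := cnorm_ge0 (y - y') => h'; apply/eqP; rewrite -subr_eq0 -cnorm_eq0; apply/eqP; lra.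
pose eta t := xget a [set y | cnorm (y - a) <= rho /\ N t y = y].
have etaP t : `|t| <= delta' -> cnorm (eta t - a) <= rho /\ N t (eta t) = eta t.
  move=> td; rewrite /eta; case: xgetP => [y _ //|none].
  have [y ya Ny] := contraction_fixpoint rhop (fun y y' => contr t y y' td) (Na t td).
  by have := none y; case.
exists rho, delta', (2 * (Kq * (1 + delta)) / G), eta; split.
- by rewrite rhop.
- by rewrite d'0 d'd; split => //; rewrite !mulr_gt0 ?invr_gt0 // addr_gt0.
- have z0 : `|0 : R| <= delta' by rewrite normr0 ltW.
  have [e1 e2] := etaP 0 z0.
  apply: (uniq 0) => //; first by rewrite subrr cnorm0 ltW.
  by apply/N_fix; rewrite /F subrr !mul0r mulr0 add0r.
- by move=> t td; have [e1 e2] := etaP t td; split => //; apply/N_fix.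
split=> [t y td ya hy|t t' td td'].
  by have [e1 e2] := etaP t td; apply: (uniq t) => //; apply/N_fix.
have [e1 e2] := etaP t td; have [e1' e2'] := etaP t' td'.
have c1 := contr t (eta t) (eta t') td e1 e1'.
have td1 : `|t| <= delta by apply: le_trans d'd.
have td1' : `|t'| <= delta by apply: le_trans d'd.
have [q1 q2] := HQ t t' (eta t') (eta t') td1 td1' (inY _ e1') (inY _ e1').
rewrite subrr cnorm0 addr0 in q2.
(* Dependence of the map on t at a fixed point; the contraction factor 1/2 turns it into twice that
   bound for [eta]. *)
have c2 : cnorm (N t (eta t') - N t' (eta t')) <= Kq * (1 + delta) * `|t - t'| / G.
  apply: half; rewrite [G * _]mulrC divfK ?gt_eqF //.
  have -> : g0 * (N t (eta t') - N t' (eta t')) =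
    - ((t - t')%:C * Q t (eta t') + t'%:C * (Q t (eta t') - Q t' (eta t'))).
    by rewrite /N rmorphB /=; field; exact: g0n.
  rewrite cnormN; apply: le_trans (ler_cnormD _ _) _; rewrite !cnormM !cnormR.
  have := ler_wpM2l (normr_ge0 (t - t')) q1.
  have := ler_pM (normr_ge0 t') (cnorm_ge0 _) td1' q2.
  lra.
have c3 := ler_cnormD (N t (eta t) - N t (eta t')) (N t (eta t') - N t' (eta t')).
rewrite subrKA e2 e2' in c3; rewrite e2 in c1; rewrite e2' in c2.
have -> : 2 * (Kq * (1 + delta)) / G * `|t - t'| = 2 * (Kq * (1 + delta) * `|t - t'| / G) by ring.
lra.
Qed.

End Branches.

(** * Spectral curves *)

Section Curves.
Context {R : realType}.
Notation C := R[i].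

Lemma iC_sqr : 'i * 'i = -1 :> C.
Proof. by rewrite -expr2 sqr_i. Qed.

Lemma cnorm_iC : cnorm ('i : C) = 1.
Proof. by rewrite /= expr0n /= expr1n add0r sqrtr1. Qed.

(** Injectivity holds because eta stays near a, away from 0, while t' (eta t - eta t') is smaller
    than (t - t') eta t. *)
Lemma branch_curve (eta : R -> C) (a : C) (delta' K : R) : a != 0 -> 0 < delta' -> 0 < K ->
  eta 0 = a ->
  (forall t t', `|t| <= delta' -> `|t'| <= delta' -> cnorm (eta t - eta t') <= K * `|t - t'|) ->
  exists2 delta0 : R, 0 < delta0 & forall delta, 0 < delta <= delta0 ->
    curve_tangent_at0 delta (fun t => 'i * t%:C * eta t) ('i * a).
Proof.
move=> a0 d'0 K0 eta0 lip.
have na : 0 < cnorm a by rewrite lt_neqAle eq_sym cnorm_eq0 a0 cnorm_ge0.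
(* Equality of two curve values with t distinct from t' would force |a| <= 2 K delta. *)
exists (Num.min delta' (cnorm a / (4 * K))); first by rewrite lt_min d'0 divr_gt0 ?mulr_gt0.
move=> delta /andP[d0]; rewrite le_min ler_pdivlMr ?mulr_gt0 // => /andP[dd' dK].
have inI (t : R) : t \in `]- delta, delta[ -> `|t| < delta by rewrite in_itv /= ltr_norml.
have ler (t : R) : `|t| < delta -> `|t| <= delta' by move=> h; apply: le_trans dd'; apply: ltW.
have z0 : `|0 : R| <= delta' by rewrite normr0 ltW.
pose gam t := 'i * t%:C * eta t.
have gdiff t t' : gam t - gam t' = 'i * ((t - t')%:C * eta t + t'%:C * (eta t - eta t')).
  by rewrite /gam rmorphB /=; ring.
have eta_a t : `|t| < delta -> cnorm (eta t - a) <= K * delta.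
  move=> td; rewrite -eta0; apply: le_trans (lip t 0 (ler t td) z0) _.
  by rewrite subr0 ler_pM2l // ltW.
split.
- by rewrite rmorph0 mulr0 mul0r.
- move=> t t' /inI td /inI td' E; have : gam t - gam t' = 0 by rewrite /gam E subrr.
  rewrite gdiff => /(congr1 (fun z => cnorm z)); rewrite cnorm0 cnormM cnorm_iC mul1r => E0.
  have h1 := ler_cnormD ((t - t')%:C * eta t + t'%:C * (eta t - eta t')) (- (t'%:C * (eta t - eta t'))).
  rewrite addrK E0 add0r cnormN !cnormM !cnormR in h1.
  have h2 := ler_cnormD (a - eta t) (eta t); rewrite subrK cnorm_distC in h2.
  have h3 := eta_a t td.
  have h4 := ler_wpM2l (normr_ge0 t') (lip t t' (ler t td) (ler t' td')).
  have h5 : `|t'| * (K * `|t - t'|) <= delta * (K * `|t - t'|).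
    by rewrite ler_wpM2r ?mulr_ge0 ?(ltW K0) // ltW.
  have p0 := normr_ge0 (t - t').
  have h6 : `|t - t'| * (cnorm a - K * delta) <= `|t - t'| * cnorm (eta t).
    by apply: ler_wpM2l => //; lra.
  have h7 : 0 <= `|t - t'| * (cnorm a - delta * (4 * K)).
    by rewrite mulr_ge0 // subr_ge0.
  have h8 : `|t - t'| * cnorm a <= 0 by lra.
  have : `|t - t'| <= 0.
    by rewrite leNgt; apply/negP => q; have := mulr_gt0 q na; rewrite ltNge h8.
  by rewrite normr_le0 subr_eq0 => /eqP.
- move=> t /inI td.
  pose L := cnorm a + K * delta + delta * K.
  have lipg t' : `|t'| < delta -> cnorm (gam t - gam t') <= L * `|t - t'|.
    move=> td'; rewrite gdiff cnormM cnorm_iC mul1r; apply: le_trans (ler_cnormD _ _) _.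
    rewrite !cnormM !cnormR.
    have h2 := ler_cnormD (eta t - a) a; rewrite subrK in h2.
    have h3 := eta_a t td.
    have h4 := ler_wpM2l (normr_ge0 t') (lip t t' (ler t td) (ler t' td')).
    have h5 : `|t'| * (K * `|t - t'|) <= delta * (K * `|t - t'|).
      by rewrite ler_wpM2r ?mulr_ge0 ?(ltW K0) // ltW.
    have h6 : `|t - t'| * cnorm (eta t) <= `|t - t'| * (cnorm a + K * delta).
      by apply: ler_wpM2l => //; lra.
    rewrite /L; lra.
  split.
    apply: (@lipschitz_continuous_at _ _ delta L) => // t' td'.
    rewrite -cReN -cReD; exact: le_trans (cnorm_geRe _) (lipg t' td').
  apply: (@lipschitz_continuous_at _ _ delta L) => // t' td'.
  rewrite -cImN -cImD; exact: le_trans (cnorm_geIm _) (lipg t' td').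
exists 1; first exact: oner_neq0.
have quad t : `|t| <= delta -> cnorm (gam t - t%:C * ('i * a)) <= K * t ^+ 2.
  move=> td; have -> : gam t - t%:C * ('i * a) = 'i * (t%:C * (eta t - eta 0)).
    by rewrite eta0 /gam; ring.
  rewrite !cnormM cnorm_iC mul1r cnormR.
  have := lip t 0 (le_trans td dd') z0; rewrite subr0 => h.
  have := ler_wpM2l (normr_ge0 t) h.
  by rewrite mulrCA -normrM -expr2 [`|t ^+ 2|]ger0_norm ?sqr_ge0.
have Rt (t : R) (z : C) : complex.Re (t%:C * z) = t * complex.Re z by rewrite cReM /= mul0r subr0.
have It (t : R) (z : C) : complex.Im (t%:C * z) = t * complex.Im z by rewrite cImM /= mul0r addr0.
rewrite rmorph1 mul1r; apply/is_cderiveP; split.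
  apply: (@is_derive_quadratic _ _ _ K delta) => // t td.
  rewrite -Rt -cReN -cReD; exact: le_trans (cnorm_geRe _) (quad t td).
apply: (@is_derive_quadratic _ _ _ K delta) => // t td.
rewrite -It -cImN -cImD; exact: le_trans (cnorm_geIm _) (quad t td).
Qed.

Context (al s : C -> C) (A1 B1 : R) (r0 k0 : R).
Notation A := (A1%:C).
Notation B := (B1%:C).
Hypothesis r0_gt0 : 0 < r0.
Hypothesis k0_gt0 : 0 < k0.
Hypothesis alE : forall mu, al mu = 3 + A / 2 * mu ^+ 2 + B / 6 * mu ^+ 3 + mu ^+ 4 * s mu.
Hypothesis s_lip : forall mu mu', cnorm mu <= r0 -> cnorm mu' <= r0 ->
  cnorm (s mu) <= k0 /\ cnorm (s mu - s mu') <= cnorm (mu - mu') * k0.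
Hypothesis al_conj : forall mu, al (conjc mu) = conjc (al mu).
Hypothesis B1_neq0 : B1 != 0.

Let charp mu l := l ^+ 3 - al mu * l ^+ 2 + al (- mu) * l - 1.
Let F (y : C) := 1 - y ^+ 2 / 2 * A + y ^+ 3 / 3 * B.
Let Sp (t : R) (y : C) := s ('i * t%:C * y).
Let Sm (t : R) (y : C) := s (-1 * ('i * t%:C * y)).
(** The remainder of the blow-up, written with products and factors -1 only, so that the closure
    rules of [bounded_lip] apply term by term. *)
Let Q (t : R) (y : C) :=
  - (1 / 4) * t%:C * (A / 2 * (y * y) + - (B / 3) * (y * (y * y))) +
  (1 + 1 / 4 * (t%:C * t%:C)) * ((y * y) * (y * y)) *
    (1 / 2 * t%:C * (Sp t y + Sm t y) + 'i * (Sp t y + -1 * Sm t y)).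
(** Covers the circle except -1. It is rational, so the blow-up is an algebraic identity, and l = 1
    - i t + O(t^2) gives the cubic its signs. *)
Let cayley (t : R) : C := (1 - 'i * t%:C / 2) / (1 + 'i * t%:C / 2).

Let cayley_den (t : R) : 1 + 'i * t%:C / 2 != 0 :> C.
Proof.
apply/eqP => /(congr1 (@complex.Re R)).
have -> : 1 + 'i * t%:C / 2 = 1%:C + 'i * (t / 2)%:C :> C.
  by rewrite rmorphM fmorphV rmorph_nat rmorph1 mulrA.
by rewrite cReD cReM /= !mul0r mulr0 subr0 addr0 => /eqP; rewrite oner_eq0.
Qed.

Let cnorm_cayley t : cnorm (cayley t) = 1.
Proof.
have -> : cayley t = conjc (1 + 'i * t%:C / 2) / (1 + 'i * t%:C / 2).
  congr (_ / _); rewrite conjcD !conjcM conjc1 conjc_real conjc_inv conjc_nat.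
  by rewrite (_ : conjc 'i = - 'i) ?mulNr //; simpc.
by rewrite cnormM cnormV cnormJ divff // cnorm_eq0.
Qed.

(* The blow-up [mu = i t y], with [l] on the unit circle in Cayley coordinates, turns
   the triple root of the characteristic polynomial at the origin into the roots of the
   cubic [F]. *)
Let charp_cayley t y : charp ('i * t%:C * y) (cayley t) * (1 + 'i * t%:C / 2) ^+ 3
  = 'i * t%:C ^+ 3 * (F y + t%:C * Q t y).
Proof.
set mu := 'i * t%:C * y; set T := t%:C : C.
pose tau : C := 'i * T / 2.
have L : charp mu (cayley t) * (1 + 'i * T / 2) ^+ 3 =
   (1 - tau) ^+ 3 - (1 + tau) ^+ 3 - al mu * ((1 - tau) * (1 - tau ^+ 2))
   + al (- mu) * ((1 + tau) * (1 - tau ^+ 2)).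
  rewrite /charp /cayley -/T -/tau; move: (cayley_den t); rewrite -/T -/tau => h.
  by field.
have tau2 : tau ^+ 2 = - (T ^+ 2 / 4).
  transitivity (('i * 'i) * (T ^+ 2 / 4)); first by rewrite /tau; field.
  by rewrite iC_sqr mulN1r.
have tau3 : (1 - tau) ^+ 3 - (1 + tau) ^+ 3 = - 6 * tau + tau * (T ^+ 2 / 2).
  transitivity (- 6 * tau - 2 * tau * tau ^+ 2); first by ring.
  by rewrite tau2; field.
have mu2 : mu ^+ 2 = - (T ^+ 2 * y ^+ 2).
  transitivity (('i * 'i) * (T ^+ 2 * y ^+ 2)); first by rewrite /mu; ring.
  by rewrite iC_sqr mulN1r.
have mu3 : mu ^+ 3 = - ('i * T ^+ 3 * y ^+ 3).
  rewrite exprS mu2 /mu; ring.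
have mu4 : mu ^+ 4 = T ^+ 4 * y ^+ 4.
  by rewrite (exprM mu 2 2) mu2; ring.
have muN3 : (- mu) ^+ 3 = 'i * T ^+ 3 * y ^+ 3.
  by rewrite -mulN1r exprMn mu3; ring.
have muN2 : (- mu) ^+ 2 = - (T ^+ 2 * y ^+ 2) by rewrite sqrrN.
have muN4 : (- mu) ^+ 4 = T ^+ 4 * y ^+ 4 by rewrite -mu4 -mulN1r exprMn; ring.
rewrite L tau3 tau2 !alE mu2 mu3 mu4 muN2 muN3 muN4.
have -> : s mu = Sp t y by [].
have -> : s (- mu) = Sm t y by rewrite /Sm mulN1r.
have -> : 'i * T ^+ 3 * (F y + T * Q t y) =
  'i * T ^+ 3 * (F y + T * (- (1 / 4) * T * (A / 2 * (y * y) + - (B / 3) * (y * (y * y))) +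
  (1 + 1 / 4 * (T * T)) * ((y * y) * (y * y)) * (1 / 2 * T * (Sp t y + Sm t y)))) +
  ('i * 'i) * (T ^+ 4 * (1 + 1 / 4 * (T * T)) * y ^+ 4 * (Sp t y - Sm t y)).
  by rewrite /Q -/T; ring.
by rewrite iC_sqr /F /tau; field.
Qed.

Let charp_zero t y : t != 0 -> charp ('i * t%:C * y) (cayley t) = 0 <-> F y + t%:C * Q t y = 0.
Proof.
move=> t0; have TC : t%:C != 0 :> C by rewrite -(rmorph0 (real_complex R)) (inj_eq (@complexI R)).
have i0 : 'i != 0 :> C by apply/eqP => h; have := cnorm_iC; rewrite h cnorm0 => /eqP; rewrite eq_sym oner_eq0.
have := charp_cayley t y; split=> h; move: H; rewrite h ?mul0r ?mulr0.
  move=> /esym/eqP; rewrite mulf_eq0 => /orP[|/eqP //].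
  by rewrite mulf_eq0 (negbTE i0) /= expf_eq0 (negbTE TC).
by move=> /eqP; rewrite mulf_eq0 expf_eq0 (negbTE (cayley_den t)) /= orbF => /eqP.
Qed.

Let Q_lip Y : 0 < Y -> exists2 delta : R, 0 < delta & bounded_lip Y delta Q.
Proof.
(* Keeps i t y in the disc where [s] is controlled. *)
move=> Y0; exists (r0 / Y); first exact: divr_gt0.
have d0 : 0 < r0 / Y by exact: divr_gt0.
have bt := bounded_lip_t Y d0; have b1 := @bounded_lip_y R Y (r0 / Y) Y0.
have bc z := @bounded_lip_cst R Y (r0 / Y) z.
have bD := @bounded_lipD R Y (r0 / Y); have bM := @bounded_lipM R Y (r0 / Y).
have bmu := bM _ _ (bM _ _ (bc 'i) bt) b1.
have bmuN := bM _ _ (bc (-1)) bmu.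
have mur t y : `|t| <= r0 / Y -> cnorm y <= Y -> cnorm ('i * t%:C * y) <= r0.
  move=> ht hy; rewrite !cnormM cnorm_iC mul1r cnormR.
  have := ler_pM (normr_ge0 t) (cnorm_ge0 y) ht hy.
  by rewrite divfK // gt_eqF.
have bSp : bounded_lip Y (r0 / Y) Sp.
  exact: (bounded_lip_comp k0_gt0 s_lip mur bmu).
have bSm : bounded_lip Y (r0 / Y) Sm.
  apply: (bounded_lip_comp k0_gt0 s_lip _ bmuN) => t y ht hy.
  by rewrite mulN1r cnormN mur.
exact: (bD _ _ (bM _ _ (bM _ _ (bc (- (1 / 4))) bt)
    (bD _ _ (bM _ _ (bc (A / 2)) (bM _ _ b1 b1)) (bM _ _ (bc (- (B / 3))) (bM _ _ b1 (bM _ _ b1 b1)))))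
  (bM _ _ (bM _ _ (bD _ _ (bc 1) (bM _ _ (bc (1 / 4)) (bM _ _ bt bt))) (bM _ _ (bM _ _ b1 b1) (bM _ _ b1 b1)))
    (bD _ _ (bM _ _ (bM _ _ (bc (1 / 2)) bt) (bD _ _ bSp bSm))
            (bM _ _ (bc 'i) (bD _ _ bSp (bM _ _ (bc (-1)) bSm)))))).
Qed.

(** For l on the circle, the value at - conj mu is - l^3 times the conjugate of the value at mu. *)
Let charp_conj mu l : cnorm l = 1 -> charp mu l = 0 -> charp (- conjc mu) l = 0.
Proof.
move=> /eqP; rewrite cnorm1_conj => /eqP l1 h.
have := congr1 conjc h; rewrite /charp !(conjcD, conjcN, conjcM, conjcX) conjc1 conjc0.
rewrite -!al_conj opprK conjcN => h'.
have {}h' : conjc l ^+ 3 - al (conjc mu) * conjc l ^+ 2 + al (- conjc mu) * conjc l - 1 = 0.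
  by rewrite -[RHS]h'; ring.
transitivity (- (conjc l ^+ 3 - al (conjc mu) * conjc l ^+ 2 + al (- conjc mu) * conjc l - 1) * l ^+ 3); last first.
  by rewrite h' oppr0 mul0r.
transitivity (- ((l * conjc l) ^+ 3 - al (conjc mu) * (l * conjc l) ^+ 2 * l
  + al (- conjc mu) * (l * conjc l) * l ^+ 2 - l ^+ 3)); last by ring.
by rewrite l1; ring.
Qed.

Let charp_bigO mu : cnorm mu <= r0 -> cnorm mu <= 1 ->
  cnorm (al mu - 3) <= (cnorm A / 2 + cnorm B / 6 + k0) * cnorm mu ^+ 2.
Proof.
move=> mur mu1; have [sk _] := s_lip mur mur.
have -> : al mu - 3 = mu ^+ 2 * (A / 2 + mu * (B / 6) + mu ^+ 2 * s mu) by rewrite alE; ring.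
rewrite cnormM cnormX mulrC ler_wpM2r ?exprn_ge0 ?cnorm_ge0 //.
have c2 : cnorm (2^-1 : C) = 2^-1 by rewrite cnormV -(rmorph_nat (real_complex R)) cnormR ger0_norm.
have c6 : cnorm (6^-1 : C) = 6^-1 by rewrite cnormV -(rmorph_nat (real_complex R)) cnormR ger0_norm.
have h1 := ler_cnormD (A / 2 + mu * (B / 6)) (mu ^+ 2 * s mu).
have h2 := ler_cnormD (A / 2) (mu * (B / 6)).
have h3 : cnorm (mu * (B / 6)) <= cnorm B / 6.
  by rewrite !cnormM c6 ler_piMl // mulr_ge0 ?cnorm_ge0.
have h4 : cnorm (mu ^+ 2 * s mu) <= k0.
  rewrite cnormM cnormX; have h := exprn_ile1 2 (cnorm_ge0 mu) mu1.
  by have := ler_pM (exprn_ge0 2 (cnorm_ge0 mu)) (cnorm_ge0 _) h sk; rewrite mul1r.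
rewrite cnormM c2 in h2; lra.
Qed.

(** A root satisfies (l - 1)^3 = (al(mu) - 3) l^2 - (al(-mu) - 3) l = O(mu^2), so it lies near 1,
    far from the point -1 that the Cayley transform misses. *)
Let unit_root_cayley (eps : R) : 0 < eps -> exists2 r : R, 0 < r &
  forall mu l, cnorm mu < r -> cnorm l = 1 -> charp mu l = 0 ->
    exists2 t : R, l = cayley t & `|t| < eps.
Proof.
move=> eps0; pose k : R := cnorm A / 2 + cnorm B / 6 + k0.
have k_gt0 : 0 < k by rewrite /k ltr_wpDl // addr_ge0 // mulr_ge0 ?cnorm_ge0 ?invr_ge0.
pose e : R := Num.min 1 (eps / 4).
have e0 : 0 < e by rewrite lt_min ltr01 divr_gt0.
have e1 : e <= 1 by rewrite ge_min lexx.
have e2 : e <= eps / 4 by rewrite ge_min lexx orbT.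
(* Ensures |l - 1| < e. Then e <= 1 gives |1 + l| >= 1, and e <= eps / 4 leaves room for t, twice
   the imaginary part of w. *)
exists (Num.min (Num.min r0 1) (e ^+ 3 / (2 * k))).
  by rewrite !lt_min r0_gt0 ltr01 divr_gt0 ?mulr_gt0 ?exprn_gt0.
move=> mu l; rewrite !lt_min ltr_pdivlMr ?mulr_gt0 // => /andP[/andP[mur mu1] muk] l1 h.
have b1 := charp_bigO (ltW mur) (ltW mu1).
have b2 : cnorm (al (- mu) - 3) <= k * cnorm mu ^+ 2.
  by rewrite -[cnorm mu]cnormN; apply: charp_bigO; rewrite cnormN ltW.
have l3 : cnorm (l - 1) ^+ 3 <= 2 * k * cnorm mu.
  have -> : cnorm (l - 1) ^+ 3 = cnorm ((al mu - 3) * l ^+ 2 - (al (- mu) - 3) * l).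
    rewrite -cnormX; congr cnorm.
    by rewrite -[RHS]addr0 -h /charp; ring.
  apply: le_trans (ler_cnormD _ _) _; rewrite cnormN !cnormM l1 !mulr1.
  have m2 : cnorm mu ^+ 2 <= cnorm mu by rewrite expr2 ler_piMl ?cnorm_ge0 // ltW.
  have := ler_wpM2l (ltW k_gt0) m2; rewrite -/k in b1; lra.
have le : cnorm (l - 1) < e.
  rewrite -(ltr_pXn2r (n := 3)) ?nnegrE ?cnorm_ge0 ?(ltW e0) //.
  by apply: le_lt_trans l3 _; rewrite mulrC.
have l2 : 1 <= cnorm (1 + l).
  have := ler_cnormD (1 + l) (1 - l); rewrite addrACA subrr addr0.
  have -> : cnorm (1 + 1 : C) = 2 by rewrite -(rmorph1 (real_complex R)) -rmorphD cnormR ger0_norm.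
  by rewrite [cnorm (1 - l)]cnorm_distC; lra.
have l2n : 1 + l != 0 by rewrite -cnorm_eq0 gt_eqF //; lra.
pose w := (1 - l) / (1 + l).
have lw : l = (1 - w) / (1 + w).
  have d : 1 + w = 2 / (1 + l) by rewrite /w; field.
  by rewrite d /w; field; exact: l2n.
have ll : l * conjc l = 1 by apply/eqP; rewrite -cnorm1_conj l1.
have cw : conjc w = - w.
  have l0 : l != 0 by rewrite -cnorm_eq0 l1 oner_neq0.
  have cl : conjc l = l^-1 by apply: (mulfI l0); rewrite ll divff.
  rewrite /w conjcM conjc_inv conjcD conjcN conjcD conjc1 cl.
  by field; rewrite ?[l + 1]addrC ?l0 ?l2n.
have wi : w = 'i * (complex.Im w)%:C.
  have x0 : complex.Re w = 0 by have := congr1 (@complex.Re R) cw; rewrite cReN; case: (w) => p q /=; lra.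
  by move: x0; case: (w) => p q /= ->; simpc.
exists (2 * complex.Im w).
  rewrite {1}lw /cayley rmorphM rmorph_nat.
  have -> : 'i * (2 * (complex.Im w)%:C) / 2 = w by rewrite {2}wi; field.
  by [].
have ww : cnorm w <= cnorm (l - 1).
  rewrite /w cnormM cnormV cnorm_distC ler_pdivrMr; last by lra.
  by rewrite ler_peMr ?cnorm_ge0.
rewrite normrM ger0_norm //; have := cnorm_geIm w; lra.
Qed.

(* The bound is uniform in [t] because only [mu = i t y] has to be small for the cubic
   term to dominate. *)
Let root_bounded : exists Y r : R, [/\ 0 < Y, 0 < r & forall t y,
  cnorm ('i * t%:C * y) < r -> F y + t%:C * Q t y = 0 -> cnorm y <= Y].
Proof.
have bB : 0 < cnorm B by rewrite cnormR normr_gt0.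
pose Y : R := 1 + 6 * (2 + cnorm A / 2) / cnorm B.
have Ypos : 0 <= 6 * (2 + cnorm A / 2) / cnorm B.
  by rewrite divr_ge0 ?cnorm_ge0 // mulr_ge0 // addr_ge0 // divr_ge0 ?cnorm_ge0.
(* The last two bounds keep the coefficient of y^3 above |B| / 6 and the perturbation of A / 2 below
   1. *)
exists Y, (Num.min (Num.min r0 1) (Num.min (cnorm B / (12 * k0)) k0^-1)); split.
- by rewrite /Y; lra.
- by rewrite !lt_min r0_gt0 ltr01 divr_gt0 ?mulr_gt0 ?invr_gt0.
move=> t y; set mu := 'i * t%:C * y.
rewrite !lt_min => /andP[/andP[mur mu1] /andP[muB muk]] h.
rewrite ltr_pdivlMr ?mulr_gt0 // in muB.
rewrite -div1r ltr_pdivlMr // in muk.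
have murN : cnorm (- mu) <= r0 by rewrite cnormN ltW.
have [sp _] := s_lip (ltW mur) (ltW mur); have [sm _] := s_lip murN murN.
pose se := (s mu + s (- mu)) / 2; pose so := s mu - s (- mu).
have c2 : cnorm (2^-1 : C) = 2^-1 by rewrite cnormV -(rmorph_nat (real_complex R)) cnormR ger0_norm.
have c3 : cnorm (3^-1 : C) = 3^-1 by rewrite cnormV -(rmorph_nat (real_complex R)) cnormR ger0_norm.
have se_k : cnorm se <= k0.
  by rewrite /se cnormM c2; have := ler_cnormD (s mu) (s (- mu)); lra.
have so_k : cnorm so <= 2 * k0.
  by rewrite /so; have := ler_cnormD (s mu) (- s (- mu)); rewrite cnormN; lra.
have E : (1 + (t ^+ 2 / 4)%:C) * (y ^+ 3 * (B / 3 + mu * so) - y ^+ 2 * (A / 2 + mu ^+ 2 * se)) = -1.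
  (* The subtracted multiple of i^2 + 1 is zero; it makes the identity hold with i as an
     indeterminate, as [field] requires. *)
  have EQ : F y + t%:C * Q t y - ('i * 'i + 1) *
     ((1 + (t ^+ 2 / 4)%:C) * (t%:C ^+ 2 * y ^+ 4 * se)) - 0
     = 1 + (1 + (t ^+ 2 / 4)%:C) * (y ^+ 3 * (B / 3 + mu * so) - y ^+ 2 * (A / 2 + mu ^+ 2 * se)).
    rewrite /F /Q /se /so -[Sp t y]/(s mu) -[Sm t y]/(s (-1 * mu)) mulN1r.
    rewrite rmorphM fmorphV rmorph_nat rmorphXn /=.
    move: (s mu) (s (- mu)) => p q; rewrite /mu; by field.
  by move: EQ; rewrite iC_sqr addNr mul0r !subr0 h => /esym/eqP; rewrite addrC addr_eq0 => /eqP.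
have low : cnorm (y ^+ 3 * (B / 3 + mu * so) - y ^+ 2 * (A / 2 + mu ^+ 2 * se)) <= 1.
  have E1 : cnorm (1 + (t ^+ 2 / 4)%:C : C) *
      cnorm (y ^+ 3 * (B / 3 + mu * so) - y ^+ 2 * (A / 2 + mu ^+ 2 * se)) = 1.
    by rewrite -cnormM E cnormN cnorm1.
  have : 1 <= cnorm (1 + (t ^+ 2 / 4)%:C : C).
    rewrite -(rmorph1 (real_complex R)) -rmorphD cnormR.
    apply: le_trans (ler_norm _); rewrite lerDl divr_ge0 ?sqr_ge0 //.
  move=> h1; rewrite -E1 ler_peMl ?cnorm_ge0 //.
have b3 : cnorm B / 6 <= cnorm (B / 3 + mu * so).
  have := ler_cnormD (B / 3 + mu * so) (- (mu * so)); rewrite addrK cnormN (cnormM B) (cnormM mu) c3.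
  have := ler_wpM2l (cnorm_ge0 mu) so_k; lra.
have a2 : cnorm (A / 2 + mu ^+ 2 * se) <= cnorm A / 2 + 1.
  apply: le_trans (ler_cnormD _ _) _; rewrite (cnormM A) (cnormM (mu ^+ 2)) cnormX c2 lerD2l.
  have := ler_wpM2l (exprn_ge0 2 (cnorm_ge0 mu)) se_k.
  have m2 : cnorm mu ^+ 2 <= cnorm mu by rewrite expr2 ler_piMl ?cnorm_ge0 // ltW.
  have := ler_wpM2r (ltW k0_gt0) m2; lra.
rewrite leNgt; apply/negP => yY.
have y1 : 1 < cnorm y by rewrite /Y in yY; lra.
have y0 : 0 < cnorm y by lra.
have main : cnorm y ^+ 3 * (cnorm B / 6) <= 1 + cnorm y ^+ 2 * (cnorm A / 2 + 1).
  have := ler_cnormD (y ^+ 3 * (B / 3 + mu * so) - y ^+ 2 * (A / 2 + mu ^+ 2 * se))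
    (y ^+ 2 * (A / 2 + mu ^+ 2 * se)).
  rewrite subrK cnormM cnormX [cnorm (y ^+ 2 * _)]cnormM cnormX.
  have := ler_wpM2l (exprn_ge0 3 (cnorm_ge0 y)) b3.
  have := ler_wpM2l (exprn_ge0 2 (cnorm_ge0 y)) a2.
  lra.
have y2 : 1 <= cnorm y ^+ 2 by rewrite exprn_ege1 // ltW.
have main2 : cnorm y ^+ 2 * (cnorm y * (cnorm B / 6)) <= cnorm y ^+ 2 * (cnorm A / 2 + 2).
  rewrite mulrA -exprSr; lra.
rewrite ler_pM2l ?exprn_gt0 // in main2.
have : cnorm y <= 6 * (2 + cnorm A / 2) / cnorm B by rewrite ler_pdivlMr //; lra.
rewrite /Y in yY; lra.
Qed.

(** The hard inclusion is that no other points occur. A point of S near 0 has small t and bounded y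
    = mu / (i t), hence small F y, so y is close to one of the three roots and equals the branch
    there by uniqueness. *)
Lemma spectral_curves (S : set C) (y1 : R) (y2 : C) : complex.Im y2 != 0 ->
  (forall y : C, 1 - y ^+ 2 / 2 * A + y ^+ 3 / 3 * B
     = B / 3 * ((y - y1%:C) * (y - y2) * (y - conjc y2))) ->
  (forall mu, S mu <-> exists2 l, cnorm l = 1 &
     l ^+ 3 - al mu * l ^+ 2 + al (- mu) * l - 1 = 0) ->
  (forall t : R, S (0 +i* t)) ->
  (exists (r delta : R) (gamma2 gamma3 : R -> C), [/\ 0 < r /\ 0 < delta,
     curve_tangent_at0 delta gamma2 ('i * y2),
     curve_tangent_at0 delta gamma3 ('i * conjc y2) &
     forall mu, cnorm mu < r -> (S mu <-> complex.Re mu = 0 \/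
       exists2 t, t \in `]- delta, delta[ & mu = gamma2 t \/ mu = gamma3 t)]) /\
  (forall e : R, 0 < e -> exists mu, [/\ S mu, cnorm mu < e & complex.Re mu != 0]).
Proof.
move=> Im2 fac SP axis.
have [Y [rY [Y0 rY0 Ybound]]] := root_bounded.
have nI2 : 0 < `|complex.Im y2| by rewrite normr_gt0.
(* Half the distance from y2 to the real line: the branch stays nonreal, so its curve leaves the
   axis for t != 0. *)
pose rho0 : R := Num.min 1 (`|complex.Im y2| / 2).
have rho00 : 0 < rho0 by rewrite lt_min ltr01 divr_gt0.
have rho01 : rho0 <= 1 by rewrite ge_min lexx.
have rho02 : rho0 <= `|complex.Im y2| / 2 by rewrite ge_min lexx orbT.
(* Large enough for the a priori bound on y and for the balls of radius rho0 around all three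
   roots. *)
pose YY : R := Y + `|y1| + cnorm y2 + 1.
have YY0 : 0 < YY by rewrite /YY; have := cnorm_ge0 y2; have := normr_ge0 y1; lra.
have [dQ dQ0 HQ] := Q_lip YY0.
have BC0 : B != 0 :> C by rewrite -(rmorph0 (real_complex R)) (inj_eq (@complexI R)).
have al0 : B / 3 != 0 :> C by rewrite mulf_neq0 // invr_eq0 pnatr_eq0.
have n12 : y1%:C != y2 by apply: contra Im2 => /eqP <-.
have n13 : y1%:C != conjc y2.
  by apply: contra Im2 => /eqP h; rewrite -[y2]conjcK -h conjc_real.
have n23 : y2 != conjc y2.
  apply: contra Im2 => /eqP /(congr1 (@complex.Im R)); case: (y2) => p q /= h.
  by apply/eqP; lra.
have Y1 : cnorm (y1%:C : C) + rho0 <= YY.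
  by rewrite cnormR /YY; have := cnorm_ge0 y2; lra.
have Y2 : cnorm y2 + rho0 <= YY by rewrite /YY; have := normr_ge0 y1; lra.
have Y3 : cnorm (conjc y2) + rho0 <= YY by rewrite cnormJ.
have [p1 [d1 [K1 [e1 [/andP[p10 p1l] [/andP[d10 d1l] K10] e10 sol1 [uni1 lip1]]]]]] :=
  simple_root_branch al0 n12 n13 dQ0 rho00 Y1 HQ.
have n21 : y2 != y1%:C by rewrite eq_sym.
have [p2 [d2 [K2 [e2 [/andP[p20 p2l] [/andP[d20 d2l] K20] e20 sol2 [uni2 lip2]]]]]] :=
  simple_root_branch al0 n21 n23 dQ0 rho00 Y2 HQ.
have n31 : conjc y2 != y1%:C by rewrite eq_sym.
have n32 : conjc y2 != y2 by rewrite eq_sym.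
have [p3 [d3 [K3 [e3 [/andP[p30 p3l] [/andP[d30 d3l] K30] e30 sol3 [uni3 lip3]]]]]] :=
  simple_root_branch al0 n31 n32 dQ0 rho00 Y3 HQ.
have F1 y : F y = B / 3 * ((y - y1%:C) * (y - y2) * (y - conjc y2)) by apply: fac.
have F2 y : F y = B / 3 * ((y - y2) * (y - y1%:C) * (y - conjc y2)) by rewrite F1; ring.
have F3 y : F y = B / 3 * ((y - conjc y2) * (y - y1%:C) * (y - y2)) by rewrite F1; ring.
have y20 : y2 != 0 by apply: contra Im2 => /eqP ->.
have y30 : conjc y2 != 0 by rewrite conjc_eq0.
have [c2 c20 cur2] := branch_curve y20 d20 K20 e20 lip2.
have [c3 c30 cur3] := branch_curve y30 d30 K30 e30 lip3.
pose delta : R := Num.min (Num.min d1 (Num.min d2 d3)) (Num.min c2 c3).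
have delta0 : 0 < delta by rewrite !lt_min d10 d20 d30 c20 c30.
have del1 : delta <= d1 by rewrite !ge_min lexx.
have del2 : delta <= d2 by rewrite !ge_min lexx !orbT.
have del3 : delta <= d3 by rewrite !ge_min lexx !orbT.
have delc2 : delta <= c2 by rewrite !ge_min lexx !orbT.
have delc3 : delta <= c3 by rewrite !ge_min lexx !orbT.
have onS t y : F y + t%:C * Q t y = 0 -> S ('i * t%:C * y).
  move=> h; have [->|t0] := eqVneq t 0.
    by rewrite rmorph0 mulr0 mul0r; exact: (axis 0).
  by apply/SP; exists (cayley t) => //; exact: (charp_zero y t0).2 h.
have inI (t : R) : t \in `]- delta, delta[ -> `|t| < delta by rewrite in_itv /= ltr_norml.
have on2 t : `|t| < delta -> S ('i * t%:C * e2 t).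
  by move=> td; apply: onS; rewrite F2; have [] := sol2 t (le_trans (ltW td) del2).
have on3 t : `|t| < delta -> S ('i * t%:C * e3 t).
  by move=> td; apply: onS; rewrite F3; have [] := sol3 t (le_trans (ltW td) del3).
split; last first.
  move=> e e_gt0.
  have q0 : 0 < cnorm y2 + 1 by rewrite ltr_wpDl ?cnorm_ge0.
  pose t : R := Num.min (delta / 2) (e / (2 * (cnorm y2 + 1))).
  have t0 : 0 < t by rewrite lt_min !divr_gt0 ?mulr_gt0.
  have td : `|t| < delta.
    by rewrite gtr0_norm //; apply: le_lt_trans (_ : delta / 2 < delta); [rewrite ge_min lexx|lra].
  have te : t * (2 * (cnorm y2 + 1)) <= e.
    by rewrite -ler_pdivlMr ?mulr_gt0 // ge_min lexx orbT.
  have [h2 _] := sol2 t (le_trans (ltW td) del2).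
  exists ('i * t%:C * e2 t); split; first exact: on2.
    rewrite !cnormM cnorm_iC mul1r cnormR gtr0_norm //.
    have := ler_cnormD (e2 t - y2) y2; rewrite subrK => h3.
    have := ler_wpM2l (ltW t0) (_ : cnorm (e2 t) <= cnorm y2 + 1).
    move=> h4; apply: le_lt_trans (h4 _) _; first by lra.
    have := mulr_gt0 t0 q0; lra.
  have hI : complex.Im (e2 t) != 0.
    have := cnorm_geIm (e2 t - y2); rewrite cImD cImN.
    have [->|//] := eqVneq (complex.Im (e2 t)) 0.
    by rewrite sub0r normrN; lra.
  have -> : complex.Re ('i * t%:C * e2 t) = - (t * complex.Im (e2 t)).
    by rewrite !cReM !cImM /=; ring.
  by rewrite oppr_eq0 mulf_neq0 // gt_eqF.
have [Kq Kq0 Qb] := HQ.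
pose rho : R := Num.min p1 (Num.min p2 p3).
have rhop : 0 < rho by rewrite !lt_min p10 p20 p30.
have rho1 : rho <= p1 by rewrite !ge_min lexx.
have rho2 : rho <= p2 by rewrite !ge_min lexx !orbT.
have rho3 : rho <= p3 by rewrite !ge_min lexx !orbT.
have nal : 0 < cnorm (B / 3 : C) by rewrite lt_neqAle eq_sym cnorm_eq0 al0 cnorm_ge0.
(* Forces |F y| = |t Q| below |B / 3| rho^3, the least value of |F| outside the three balls of
   radius rho that the factorization allows. *)
pose eps : R := Num.min delta (cnorm (B / 3 : C) * rho ^+ 3 / Kq).
have eps0 : 0 < eps by rewrite lt_min delta0 divr_gt0 // mulr_gt0 // exprn_gt0.
have [ru ru0 Hu] := unit_root_cayley eps0.
have bB : 0 < cnorm B by rewrite cnormR normr_gt0.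
pose r : R := Num.min (Num.min ru rY) (Num.min r0 (cnorm B / (12 * k0))).
exists r, delta, (fun t => 'i * t%:C * e2 t), (fun t => 'i * t%:C * e3 t); split.
- by split => //; rewrite !lt_min ru0 rY0 r0_gt0 divr_gt0 ?mulr_gt0.
- by apply: cur2; rewrite delta0.
- by apply: cur3; rewrite delta0.
move=> mu; rewrite !lt_min ltr_pdivlMr ?mulr_gt0 // => /andP[/andP[muu muY] /andP[mur muB]].
split; last first.
  case=> [re0|[t /inI td [->|->]]]; [|exact: on2|exact: on3].
  by have -> : mu = 0 +i* complex.Im mu; [move: re0; case: (mu) => p q /= -> | exact: axis].
move=> /SP[l l1 hl]; have [t lt teps] := Hu mu l muu l1 hl.
move: teps; rewrite lt_min ltr_pdivlMr // => /andP[td tK].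
rewrite lt in hl l1.
have i0 : 'i != 0 :> C by apply/eqP => h; have := cnorm_iC; rewrite h cnorm0 => /eqP; rewrite eq_sym oner_eq0.
(* The scaling breaks down at l = 1. There the polynomial is - mu^3 times a factor near B / 3, so
   only mu = 0 is possible. *)
have [t0|t0] := eqVneq t 0.
  left; have : charp mu 1 = 0.
    by rewrite -hl t0 /cayley rmorph0 mulr0 mul0r subr0 addr0 divr1.
  have -> : charp mu 1 = - (mu ^+ 3 * (B / 3 + mu * (s mu - s (- mu)))).
    rewrite /charp !alE; move: (s mu) (s (- mu)) => p q; by field.
  move=> /eqP; rewrite oppr_eq0 mulf_eq0 expf_eq0 /= => /orP[/eqP -> //|/eqP h].
  have murN : cnorm (- mu) <= r0 by rewrite cnormN ltW.
  have [sp _] := s_lip (ltW mur) (ltW mur); have [sm _] := s_lip murN murN.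
  have h1 : cnorm B / 3 = cnorm (mu * (s mu - s (- mu))).
    have -> : mu * (s mu - s (- mu)) = - (B / 3) by apply/eqP; rewrite -addr_eq0 addrC h.
    by rewrite cnormN cnormM cnormV -[in RHS](rmorph_nat (real_complex R)) [cnorm 3%:R%:C]cnormR ger0_norm.
  have so_k : cnorm (s mu - s (- mu)) <= 2 * k0.
    by have := ler_cnormD (s mu) (- s (- mu)); rewrite cnormN; lra.
  have := ler_wpM2l (cnorm_ge0 mu) so_k; rewrite -cnormM -h1; lra.
have TC : t%:C != 0 :> C by rewrite -(rmorph0 (real_complex R)) (inj_eq (@complexI R)).
pose y := mu / ('i * t%:C).
have muy : mu = 'i * t%:C * y by rewrite /y mulrC divfK // mulf_neq0.
rewrite muy in hl muY; have G := (charp_zero y t0).1 hl.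
have yY := Ybound t y muY G.
have yYY : cnorm y <= YY by rewrite /YY; have := cnorm_ge0 y2; have := normr_ge0 y1; lra.
have tQ : `|t| <= dQ by apply: le_trans (ltW td) (le_trans del1 d1l).
have [qb _] := Qb t t y y tQ tQ yYY yYY.
have Fsmall : cnorm (F y) < cnorm (B / 3 : C) * rho ^+ 3.
  have -> : F y = - (t%:C * Q t y) by apply/eqP; rewrite -addr_eq0 G.
  rewrite cnormN cnormM cnormR; apply: le_lt_trans tK.
  by rewrite ler_wpM2l.
(* Near the real root both y and conj y solve the equation for the same t; uniqueness makes y
   real. *)
have [n1|n1] := leP (cnorm (y - y1%:C)) rho.
  left; have td1 : `|t| <= d1 by apply: le_trans (ltW td) del1.
  have y_eq : y = e1 t by apply: uni1 => //; [exact: le_trans rho1 | rewrite -F1].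
  have cy_eq : conjc y = e1 t.
    apply: uni1 => //.
      apply: le_trans rho1; rewrite (_ : conjc y - y1%:C = conjc (y - y1%:C)) ?cnormJ //.
      by rewrite conjcD conjcN conjc_real.
    rewrite -F1; apply/(charp_zero (conjc y) t0).
    have -> : 'i * t%:C * conjc y = - conjc ('i * t%:C * y).
      rewrite !conjcM conjc_real (_ : conjc 'i = - 'i); last by simpc.
      by rewrite !mulNr opprK.
    exact: charp_conj.
  rewrite muy; move: (real_conj (etrans cy_eq (esym y_eq))) => {}/esym; move: (y) => z <-.
  by rewrite !cReM !cImM /=; ring.
have [n2|n2] := leP (cnorm (y - y2)) rho.
  right; exists t; first by rewrite in_itv /= -ltr_norml.
  left; rewrite muy; congr (_ * _); apply: uni2.
  - exact: le_trans (ltW td) del2.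
  - exact: le_trans rho2.
  - by rewrite -F2.
have [n3|n3] := leP (cnorm (y - conjc y2)) rho.
  right; exists t; first by rewrite in_itv /= -ltr_norml.
  right; rewrite muy; congr (_ * _); apply: uni3.
  - exact: le_trans (ltW td) del3.
  - exact: le_trans rho3.
  - by rewrite -F3.
exfalso; move: Fsmall; apply/negP; rewrite -leNgt F1 (cnormM (B / 3)) ler_wpM2l ?cnorm_ge0 //.
rewrite !cnormM exprSr expr2; apply: ler_pM; rewrite ?mulr_ge0 ?(ltW rhop) //; last exact: ltW.
by apply: ler_pM; rewrite ?(ltW rhop) // ltW.
Qed.

End Curves.

Lemma discr_real (R : realType) (A B : R) :
  (A ^+ 3 / 2 - 3 * B ^+ 2)%:C = 2^-1 * A%:C ^+ 3 - 3 * B%:C ^+ 2 :> R[i].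
Proof.
have E3 : (A ^+ 3 / 2)%:C = 2^-1 * A%:C ^+ 3 :> R[i].
  by rewrite rmorphM fmorphV rmorph_nat rmorphXn mulrC.
have E2 : (3 * B ^+ 2)%:C = 3 * B%:C ^+ 2 :> R[i].
  by rewrite rmorphM rmorph_nat rmorphXn.
by rewrite -E3 -E2 -rmorphB.
Qed.

Theorem theorem2 (R : realType) (f F : R -> R) (a E c : R)
    (um up : R * R * R -> R) (u : R -> R) (M : R[i] -> 'M[R[i]]_3)
    (f_C2 : class_C2 f)
    (F_f : forall x : R, is_derive x 1 F (f x))
    (params_interior : interior (parameter_region F) (a, E, c))
    (turning_points : turning_point_branch F um up (a, E, c))
    (u_profile : wave_profile f F a E c (um (a, E, c))
                   (period F um up (a, E, c)) u)
    (M_monodromy : monodromy_matrix f c u (period F um up (a, E, c)) M)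
    (Ta_TE : ~ (derive1 (fun a' => period F um up (a', E, c)) a = 0 /\
                derive1 (fun E' => period F um up (a, E', c)) E = 0))
    (tr3_neq0 : \tr (derive1n 3 M 0) != 0) :
  let Delta :=
    2^-1 * (\tr (derive1n 2 M 0)) ^+ 3 - 3 * (\tr (derive1n 3 M 0)) ^+ 2 in
  let cubic (y : R[i]) :=
    1 - y ^+ 2 / 2 * \tr (derive1n 2 M 0) + y ^+ 3 / 3 * \tr (derive1n 3 M 0) in
  (0 < Delta ->
    exists r : R, 0 < r /\
      forall s : R, `|s| < r ->
        spec f c u (0 +i* s) /\
        (s != 0 -> spec_multiplicity M (0 +i* s) = 3%N))
  /\
  (Delta < 0 ->
    (exists y2 y3 : R[i],
      [/\ complex.Im y2 != 0,
          y3 = y2^*,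
          forall y, (cubic y = 0 /\ complex.Im y != 0) <-> (y = y2 \/ y = y3)
        & exists (r delta : R) (gamma2 gamma3 : R -> R[i]),
          [/\ 0 < r /\ 0 < delta,
              curve_tangent_at0 delta gamma2 ((0 +i* 1) * y2),
              curve_tangent_at0 delta gamma3 ((0 +i* 1) * y3),
              forall mu : R[i], `|mu| < r%:C ->
                (spec f c u mu <->
                  complex.Re mu = 0 \/
                  exists2 t, t \in `]- delta, delta[ &
                    mu = gamma2 t \/ mu = gamma3 t)
            & forall s : R, 0 < `|s| < r ->
                spec_multiplicity M (0 +i* s) = 1%N]])
    /\ modulationally_unstable f c u).
Proof.
have [um_simple T0] : derive1 (potential F a c) (um (a, E, c)) != 0 /\ period F um up (a, E, c) != 0.
  have um_simple : derive1 (potential F a c) (um (a, E, c)) != 0.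
    by have [[_ [_ ]]] := nbhs_singleton turning_points.
  split; first exact: um_simple.
  exact: (trace_deriv_neq0_T M_monodromy tr3_neq0).
set T := period _ _ _ _ in u_profile M_monodromy T0.
have ev mu := eigenvalues_monodromy f_C2 F_f um_simple u_profile M_monodromy mu.
have trJ mu : \tr (M (conjc mu)) = conjc (\tr (M mu)) by exact: tr_monodromy_conj M_monodromy mu.
have [s [r0 [k0 [r0p k0p trE s_lip]]]] := tr_monodromy_taylor f_C2 F_f um_simple u_profile M_monodromy.
have specE mu := spec_eigenvalues f_C2 u_profile M_monodromy mu T0.
have normE (l : R[i]) : (`|l| == 1) = (cnorm l == 1).
  by rewrite cnormE -[1 in LHS](rmorph1 (real_complex R)) (inj_eq (@complexI R)).
have [cA cB] := trace_coef_real r0p k0p trE s_lip trJ.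
have axisN (t : R) : - (0 +i* t) = conjc (0 +i* t) by simpc.
(* On the axis - mu = conj mu, so the two middle coefficients are conjugate up to sign and the roots
   are those of a self-inversive cubic. *)
have axis (t : R) : (spec_multiplicity M (0 +i* t) = 3%N /\
    complex.Re (disc3 (\tr (M (0 +i* t))) (conjc (\tr (M (0 +i* t))))) <= 0) \/
   (spec_multiplicity M (0 +i* t) = 1%N /\
    0 <= complex.Re (disc3 (\tr (M (0 +i* t))) (conjc (\tr (M (0 +i* t)))))).
  rewrite /spec_multiplicity (eq_count normE).
  have [l1 [l2 [l3 [-> H]]]] := ev (0 +i* t).
  by apply: self_inversive_roots => l; rewrite -H axisN trJ.
(* Either alternative leaves a unit eigenvalue, so the entire imaginary axis is spectrum. *)
have axis_spec (t : R) : spec f c u (0 +i* t).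
  apply/specE; rewrite -(eq_has normE) has_count -/(spec_multiplicity M _).
  by case: (axis t) => -[->].
have [A1 EA] : exists A1 : R, \tr (derive1n 2 M 0) = A1%:C.
  by eexists; exact: real_conj cA.
have [B1 EB] : exists B1 : R, \tr (derive1n 3 M 0) = B1%:C.
  by eexists; exact: real_conj cB.
have sgn := disc3_axis_sign r0p k0p trE s_lip trJ EA EB.
move=> Delta cubic; set D := A1 ^+ 3 / 2 - 3 * B1 ^+ 2 in sgn.
have DE : Delta = D%:C.
  by rewrite discr_real; congr (2^-1 * _ ^+ 3 - 3 * _ ^+ 2).
have B10 : B1 != 0.
  by apply: contra tr3_neq0 => /eqP B0; rewrite EB B0.
have Delta_gt0 : (0 < Delta) = (0 < D) by rewrite DE -[0 in LHS](rmorph0 (real_complex R)) ltcR.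
have Delta_lt0 : (Delta < 0) = (D < 0) by rewrite DE -[0 in LHS](rmorph0 (real_complex R)) ltcR.
rewrite Delta_gt0 Delta_lt0; split => [Dp|Dn].
  (* For D > 0 the real part of the discriminant is strictly negative, which excludes the
     alternative with a single unit root. *)
  have [r rp Hr] := sgn (lt0r_neq0 Dp).
  exists r; split => // t tr; split => [|t0]; first exact: axis_spec.
  have := Hr t; rewrite normr_gt0 t0 tr => /(_ isT); rewrite nmulr_rgt0 ?oppr_lt0 // => h.
  by case: (axis t) => -[-> //]; rewrite leNgt h.
have [r rp Hr] := sgn (ltr0_neq0 Dn).
have [y1 [y2 [y2n yE]]] := cubic_nonreal_roots B10 Dn.
have B3 : B1%:C / 3 != 0 :> R[i].
  by rewrite mulf_neq0 ?invr_neq0 ?pnatr_eq0 // -(rmorph0 (real_complex R)) (inj_eq (@complexI R)).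
have [[r' [delta [g2 [g3 [[r'p dp] t2 t3 Hs]]]]] unst] :
  (exists (r delta : R) (gamma2 gamma3 : R -> R[i]), [/\ 0 < r /\ 0 < delta,
     curve_tangent_at0 delta gamma2 ((0 +i* 1) * y2),
     curve_tangent_at0 delta gamma3 ((0 +i* 1) * conjc y2) &
     forall mu, cnorm mu < r -> (spec f c u mu <-> complex.Re mu = 0 \/
       exists2 t, t \in `]- delta, delta[ & mu = gamma2 t \/ mu = gamma3 t)]) /\
  (forall e : R, 0 < e -> exists mu, [/\ spec f c u mu, cnorm mu < e & complex.Re mu != 0]).
  apply: (spectral_curves (A1 := A1) (B1 := B1) r0p k0p _ s_lip trJ B10 y2n yE _ axis_spec).
    by move=> mu; rewrite trE; congr (3 + _ / 2 * mu ^+ 2 + _ / 6 * mu ^+ 3 + _).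
  move=> mu; rewrite specE; have [l1 [l2 [l3 [-> H]]]] := ev mu; split.
    move=> /hasP[l lin /eqP ll]; exists l => //; rewrite H.
    by move: lin; rewrite !inE => /or3P[]/eqP ->; rewrite subrr ?(mul0r, mulr0).
  move=> [l l1' hl]; apply/hasP; exists l; last exact/eqP.
  by move/eqP: hl; rewrite H !mulf_eq0 !subr_eq0 !inE -orbA.
split; last first.
  by move=> e /unst[mu [h1 h2 h3]]; exists mu; split => //; rewrite cnormE ltcR.
exists y2, (conjc y2); split => //.
  move=> y; have -> : cubic y = B1%:C / 3 * ((y - y1%:C) * (y - y2) * (y - conjc y2)).
    by rewrite -yE; congr (1 - y ^+ 2 / 2 * _ + y ^+ 3 / 3 * _).
  split.
    move=> [/eqP]; rewrite mulf_eq0 (negPf B3) !mulf_eq0 !subr_eq0 /= => /orP[/orP[]|] /eqP -> h; [|by left|by right].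
    by move: h; rewrite /= eqxx.
  case=> ->; rewrite subrr ?(mul0r, mulr0); split => //.
  by case: (y2) y2n => p q /=; rewrite oppr_eq0.
exists (Num.min r r'), delta, g2, g3; split => //.
- by rewrite lt_min rp r'p.
- by move=> mu; rewrite cnormE ltcR lt_min => /andP[_]; exact: Hs.
move=> t; rewrite lt_min => /and3P[t0 tr _].
have := Hr t; rewrite t0 tr => /(_ isT); rewrite pmulr_rgt0 ?oppr_gt0 // => h.
by case: (axis t) => -[-> //]; rewrite leNgt h.
Qed.
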